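(* Let $f\subset\mathrm{Pol}^3(\mathbb{C}^3)$ be (the closure of) a $GL_3$-invariant stratum of ternary cubics, and let $\eta_f\subset J^3(3,1)$ be the corresponding ternary singularity. (1) The Thom polynomial $[\eta_f(3,1)]$ is determined by the $GL_3$-equivariant class $[f]_{GL_3}$: $$[\eta_f(3,1)]=e(\mathrm{Pol}^1(\mathbb{C}^3))\,e(\mathrm{Pol}^2(\mathbb{C}^3))\cdot[f]_{GL_3}\Big|_{\alpha_i\mapsto u/3-\alpha_i}.$$ (2) $[\eta_f(3,1)]$ determines the Legendre Thom polynomial $\tilde K_{\eta_f}$ up to the ideal of $Q$-polynomials indexed by strict partitions of length $\ge4$. (3) $[\eta_f(3,1)]$ determines the stable Thom polynomial $\mathrm{Tp}(\eta_f(-2))$ up to the ideal of Schur polynomials $s_\mu$ indexed by thick partitions (i.e. partitions $\mu$ containing $(4,4)$). Moreover, the Legendre Thom polynomials $\tilde K_{\eta_f}$ for the strata of reduced cubics are: - smooth cubics: $Q_{3,2,1}$. - nodal cubics: $12Q_{4,2,1}+12tQ_{3,2,1}$. - cuspidal cubics: $24Q_{5,2,1}+24Q_{4,3,1}+48tQ_{4,2,1}+24t^2Q_{3,2,1}$. - conic and a transversal line: $18Q_{5,2,1}+27Q_{4,3,1}+42tQ_{4,2,1}+21t^2Q_{3,2,1}$. - conic and a tangent line: $36Q_{6,2,1}+90Q_{5,3,1}+54Q_{4,3,2}+120tQ_{5,2,1}+138tQ_{4,3,1}+126t^2Q_{4,2,1}+42t^3Q_{3,2,1}$. - three non-concurrent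 lines: $12Q_{6,2,1}+30Q_{5,3,1}+45Q_{4,3,2}+40tQ_{5,2,1}+55tQ_{4,3,1}+45t^2Q_{4,2,1}+15t^3Q_{3,2,1}$. - three concurrent lines: $12Q_{7,2,1}+42Q_{6,3,1}+30Q_{5,4,1}+75Q_{5,3,2}+52tQ_{6,2,1}+125tQ_{5,3,1}+100tQ_{4,3,2}+85t^2Q_{5,2,1}+100t^2Q_{4,3,1}+60t^3Q_{4,2,1}+15t^4Q_{3,2,1}$ modulo $\mathbb{Z}\,Q_{4,3,2,1}$.
   Context: Everything is over $\mathbb{C}$; cohomology has integer coefficients (rational where denominators occur). $J^k(n,p)$: $k$-jets of germs $(\mathbb{C}^n,0)\to(\mathbb{C}^p,0)$. The contact group $\mathcal{K}$ acts by $f\mapsto M\cdot(f\circ\varphi)$ ($\varphi$ a jet of a diffeomorphism germ of the source, $M$ a jet of a germ $(\mathbb{C}^n,0)\to GL_p$), and $H^*_{\mathcal K}=H^*_{GL_n\times GL_p}=\mathbb{Z}[a_1,\dots,a_n,b_1,\dots,b_p]$ with $a_i,b_j$ the Chern classes of the standard representations. For $p=1$ write $u=b_1$, and let $\alpha_1,\dots,\alpha_n$ be the Chern roots, $a_i=e_i(\alpha_1,\dots,\alpha_n)$. For a $\mathcal{K}$-invariant closed subvariety $\eta\subset J^k(n,p)$ (a contact singularity), its Thom polynomial is $[\eta(n,p)]=[\eta\subset J^k(n,p)]\in H^*_{\mathcal K}$. Stable Thom polynomial: let $\rho^{n\to p}:\mathbb{Z}[c_1,c_2,\dots]\to\mathbb{Z}[a_1,\dots,a_n,b_1,\dots,b_p]$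 be given by $1+c_1+c_2+\cdots=\frac{1+b_1+\cdots+b_p}{1+a_1+\cdots+a_n}$. Let $\sigma(\eta)\subset J^k(n+1,p+1)$ be the closure of the contact orbits of $(f_1,\dots,f_p,x_{n+1})$, $f\in\eta$. By Damon's theorem there is a unique $\mathrm{Tp}(\eta)$ with $[\sigma^i(\eta)]=\rho^{n+i\to p+i}(\mathrm{Tp}(\eta))$ for all $i\ge0$. For $\eta\subset J^k(3,1)$ it is denoted $\mathrm{Tp}(\eta(-2))$. Schur polynomials: $s_\mu=\det[c_{\mu^T_i+j-i}]$, $\mu^T$ the conjugate partition. $\mathrm{Pol}^d(\mathbb{C}^3)=\mathrm{Sym}^d((\mathbb{C}^3)^\vee)$, with $GL_1$ acting by scalars (target); its $GL_3\times GL_1$-weights are $u-d_1\alpha_1-d_2\alpha_2-d_3\alpha_3$ with $d_1+d_2+d_3=d$, and $e(\mathrm{Pol}^d(\mathbb{C}^3))$ is their product. For a closed $GL_3$-invariant subvariety (cone) $f\subset\mathrm{Pol}^3(\mathbb{C}^3)$, $\eta_f\subset J^3(3,1)$ is its image under the linear inclusion $\mathrm{Pol}^3(\mathbb{C}^3)\to J^3(3,1)$; it is contact invariant. $[f]_{GL_3}$ is the equivariant class, in terms of $c_1,c_2,c_3$, the elementary symmetric polynomials of the Chern roots of $(\mathbb{C}^3)^\vee$ (these roots are the variables to which the substitution $\alpha_i\mapsto u/3-\alpha_i$ is applied). The classes of the closures of the reduced strata are: smooth: $1$; nodal: $12c_1$; cuspidal: $24c_1^2$; conic + transversal line: $18c_1^2+9c_2$;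 conic + tangent line: $36c_1^3+18c_1c_2$; three non-concurrent lines: $12c_1^3+6c_1c_2+27c_3$; three concurrent lines: $12c_1^4+6c_1^2c_2+27c_1c_3$. (Generic Arnold types, in the same order: $P_8$, $T_{3,3,4}$, $Q_{10}$, $T_{3,4,4}$, $S_{11}$, $T_{4,4,4}$, $U_{12}$.) $Q$-functions: $q(z)=1+Q_1z+Q_2z^2+\cdots=\prod_i\frac{1+x_iz}{1-x_iz}$; $\Gamma$ is the subring of symmetric functions generated by the $Q_i$. $Q_{(i)}=Q_i$, $Q_{(i,j)}=Q_iQ_j+2\sum_{s=1}^j(-1)^sQ_{i+s}Q_{j-s}$, and $Q_\lambda=\mathrm{Pf}(Q_{(\lambda_i,\lambda_j)})$ for strict $\lambda$ (adjoin a zero part if $\ell(\lambda)$ is odd); these form a $\mathbb{Z}$-basis of $\Gamma$. $\deg t=1$. Define $\mathcal{L}_n:\Gamma[t]\to\mathbb{Z}[a_1,\dots,a_n,u/2]$ by $t\mapsto-u/2$ and $Q_\lambda\mapsto Q_\lambda(\frac u2-\alpha_1,\dots,\frac u2-\alpha_n)$. Legendre Thom polynomial: for a function singularity $\eta\subset J^k(n_0,1)$ let $\eta(n,1)\subset J^k(n,1)$, $n\ge n_0$, be its iterated quadratic unfoldings (closure of contact orbits of $f+x_{n_0+1}^2+\cdots+x_n^2$, $f\in\eta$). By Kazarian's theorem there is a unique $\tilde K_\eta\in\Gamma[t]$, the Legendre Thom polynomial (in the $Q$-basis), with $[\eta(n,1)]=\prod_{i=1}^n(u-\alpha_i)\cdot\mathcal{L}_n(\tilde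 K_\eta)$ for all such $n$. ''Determines up to an ideal'' means: in (2), any $P\in\Gamma[t]$ with $\prod_{i=1}^3(u-\alpha_i)\cdot\mathcal{L}_3(P)=[\eta_f(3,1)]$ is congruent to $\tilde K_{\eta_f}$ modulo the $\mathbb{Z}[t]$-span of $Q_\mu$ with $\ell(\mu)\ge4$; in (3), any $P\in\mathbb{Z}[c_1,c_2,\dots]$ with $\rho^{3\to1}(P)=[\eta_f(3,1)]$ is congruent to $\mathrm{Tp}(\eta_f(-2))$ modulo the $\mathbb{Z}$-span of $s_\mu$ with $\mu\supset(4,4)$. *)

(* Defs.v *)
From Stdlib Require Import ClassicalEpsilon.
From HB Require Import structures.
From mathcomp Require Import all_boot all_order all_algebra.
From mathcomp Require Import finmap complex reals.
(* monalg and mpoly define the same notations for different types *)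
From mathcomp Require Import -(notations) monalg.
From mathcomp Require Import mpoly.

Set Implicit Arguments.
Unset Strict Implicit.
Unset Printing Implicit Defensive.

Import GRing.Theory.
Local Open Scope ring_scope.

(** * Zariski topology and equivariant classes in a torus representation

    A representation of the torus (C^* )^r is given by a finite set I of
    coordinates and the weight [w i] of the i-th coordinate line.
    H^*_T(pt) is the polynomial ring in the r Chern roots; H^*_G(pt), for G a
    product of general linear groups with maximal torus T, is identified with
    its image in H^*_T(pt), so classes are written in Chern roots.  Rational
    coefficients are used because of the denominators in u/2 and u/3. *)

Definition linear_form (R : nzRingType) (r : nat) (d : 'rV[int]_r) :
    {mpoly R[r]} := \sum_(l < r) (d 0 l)%:~R *: 'X_l.

Section EquivariantClass.
Variables (C : fieldType) (I : finType) (r : nat) (w : I -> 'rV[int]_r).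
Local Notation point := {ffun I -> C}.
Local Notation S := {mpoly C[#|I|]}.

Definition peval (x : point) (p : S) : C := p.@[fun j => x (enum_val j)].

Definition vanishes_on (X : point -> Prop) (p : S) : Prop :=
  forall x, X x -> peval x p = 0.

Definition zclosure (X : point -> Prop) (x : point) : Prop :=
  forall p, vanishes_on X p -> peval x p = 0.

Definition zclosed (X : point -> Prop) : Prop :=
  forall x, zclosure X x -> X x.

Definition mon_weight (m : 'X_{1..#|I|}) : 'rV[int]_r :=
  \sum_(j < #|I|) w (enum_val j) *+ m j.

Definition of_weight (d : 'rV[int]_r) (p : S) : bool :=
  all (fun m => mon_weight m == d) (msupp p).

(* h = dim (S / I(X))_d, witnessed by a basis *)
Definition hilbert_dim (X : point -> Prop) (d : 'rV[int]_r) (h : nat) : Prop :=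
  exists b : 'I_h -> S,
    (forall i, of_weight d (b i)) /\
    forall p, of_weight d p ->
      exists! c : {ffun 'I_h -> C}, vanishes_on X (p - \sum_i c i *: b i).

(* The K-polynomial (the class of O_X in K_T(V) = R(T)), a finite integral
   combination  sum_k k.1 * e^(k.2)  of characters: the numerator of the
   multigraded Hilbert series,  Hilb(S/I(X)) = K(X) * Hilb(S). *)
Definition is_Kpoly (X : point -> Prop) (K : seq (int * 'rV[int]_r)) : Prop :=
  exists hX hV : 'rV[int]_r -> nat,
    [/\ forall d, hilbert_dim X d (hX d),
        forall d, hilbert_dim (fun _ => True) d (hV d) &
        forall d, (hX d)%:Z = \sum_(k <- K) k.1 * (hV (d - k.2))%:Z].

(* Degree e part of  sum_k k.1 * exp (- k.2).  The coordinate function of a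
   line of weight chi is graded by chi, so that the hyperplane {x_i = 0}, with
   K = 1 - e^(w i), gets the class w i = e(normal bundle). *)
Definition Kpoly_part (K : seq (int * 'rV[int]_r)) (e : nat) : {mpoly rat[r]} :=
  \sum_(k <- K) (k.1%:~R / e`!%:R) *: (- linear_form rat k.2) ^+ e.

(* [X] is the lowest degree term (its degree is codim X) of the Chern
   character of the class of O_X; the class of the empty set is 0.  See
   Miller-Sturmfels, Combinatorial Commutative Algebra, section 8.5. *)
Definition is_eqclass (X : point -> Prop) (P : {mpoly rat[r]}) : Prop :=
  exists K d,
    [/\ is_Kpoly X K,
        forall e, (e < d)%N -> Kpoly_part K e = 0,
        P = Kpoly_part K d &
        P = 0 -> forall e, Kpoly_part K e = 0].

Definition eqclass (X : point -> Prop) : {mpoly rat[r]} :=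
  epsilon (inhabits 0) (is_eqclass X).

Definition euler_class : {mpoly rat[r]} := \prod_(i : I) linear_form rat (w i).

End EquivariantClass.

Arguments zclosure {C I}.
Arguments zclosed {C I}.

(** * Jets and the contact group *)

Definition jet_index (k n p : nat) : finType :=
  ({m : 'X_{1..n < k.+1} | (0 < mdeg m)%N} * 'I_p)%type.

Definition jet (C : Type) (k n p : nat) := {ffun jet_index k n p -> C}.

Definition alpha (n p : nat) (i : 'I_n) : {mpoly rat[n + p]} := 'X_(lshift p i).
Definition beta (n p : nat) (j : 'I_p) : {mpoly rat[n + p]} := 'X_(rshift n j).
Definition u_class (n : nat) : {mpoly rat[n + 1]} := beta n ord0.

(* beta_j - sum_i m_i alpha_i *)
Definition target_weight (n p : nat) (m : 'X_{1..n}) (j : 'I_p) :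
    'rV[int]_(n + p) :=
  row_mx (\row_(i < n) - (m i)%:Z) (\row_(j' < p) (j' == j)%:Z).

Definition jet_weight (k n p : nat) (i : jet_index k n p) : 'rV[int]_(n + p) :=
  target_weight (bmnm (val i.1)) i.2.

Section Jets.
Variables (C : fieldType) (k : nat).

Definition jet_poly (n p : nat) (f : jet C k n p) (j : 'I_p) : {mpoly C[n]} :=
  \sum_(m : {m : 'X_{1..n < k.+1} | (0 < mdeg m)%N})
     f (m, j) *: 'X_[bmnm (val m)].

(* the k-jet of a polynomial map germ with F(0) = 0 *)
Definition jet_of (n p : nat) (F : 'I_p -> {mpoly C[n]}) : jet C k n p :=
  [ffun i => (F i.2)@_(bmnm (val i.1))].

(* Only the k-jets of phi and M matter, so polynomial representatives are
   used. *)
Definition contact_equiv (n p : nat) (f g : jet C k n p) : Prop :=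
  exists (phi : n.-tuple {mpoly C[n]}) (M : 'M[{mpoly C[n]}]_p),
    [/\ forall i, (tnth phi i)@_0%MM = 0,
        \matrix_(i < n, j < n) (tnth phi i)@_U_(j)%MM \in unitmx,
        \matrix_(i < p, j < p) (M i j)@_0%MM \in unitmx &
        g = jet_of (fun i => \sum_j M i j * (jet_poly f j \mPo phi))].

Definition contact_closure (n p : nat) (X : jet C k n p -> Prop) :
    jet C k n p -> Prop :=
  zclosure (fun g => exists2 f, X f & contact_equiv f g).

Definition thom (n p : nat) (X : jet C k n p -> Prop) : {mpoly rat[n + p]} :=
  eqclass (@jet_weight k n p) X.

(* (f_1, ..., f_p, x_(n+1)) *)
Definition suspend (n p : nat) (f : jet C k n p) : jet C k n.+1 p.+1 :=
  jet_of (fun j : 'I_p.+1 =>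
    if unlift ord_max j is Some j' then mwiden (jet_poly f j')
    else 'X_ord_max).

Definition sigma (n p : nat) (X : jet C k n p -> Prop) :
    jet C k n.+1 p.+1 -> Prop :=
  contact_closure (fun g => exists2 f, X f & g = suspend f).

Fixpoint sigma_iter (n p : nat) (X : jet C k n p -> Prop) (i : nat) :
    jet C k (i + n) (i + p) -> Prop :=
  match i return jet C k (i + n) (i + p) -> Prop with
  | 0 => X
  | i'.+1 => sigma (@sigma_iter n p X i')
  end.

(* f + x_(n+1)^2 + ... + x_(n+i)^2 *)
Definition add_squares (n i : nat) (f : jet C k n 1) : jet C k (n + i) 1 :=
  jet_of (fun j => (jet_poly f j \mPo [tuple 'X_(lshift i l) | l < n])
                   + \sum_(l < i) 'X_(rshift n l) ^+ 2).

Definition quad_unfolding (n i : nat) (X : jet C k n 1 -> Prop) :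
    jet C k (n + i) 1 -> Prop :=
  contact_closure (fun g => exists2 f, X f & g = add_squares i f).

End Jets.

Arguments thom {C k n p} X.
Arguments sigma_iter {C k n p} X i _.
Arguments quad_unfolding {C k n} i X _.

(** * Stable Thom polynomials *)

(* Z[c_1, c_2, ...]-style polynomial rings in countably many variables, the
   variable with index i : nat playing the role of c_(i+1), Q_(i+1), ... *)
Definition infpoly (R : nzRingType) := monalg.malg (monalg.cmonom nat) R.

Definition infpoly_eval (R : nzRingType) (S : comNzRingType)
    (phi : R -> S) (v : nat -> S) (P : infpoly R) : S :=
  monalg.mmap phi
    (fun m : monalg.cmonom nat => \prod_(i <- finsupp m) v i ^+ m i) P.

(* the degree d part of (1 + b_1 + ... + b_p) / (1 + a_1 + ... + a_n) *)
Definition quotient_chern (n p d : nat) : {mpoly rat[n + p]} :=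
  (\prod_(j < p) (1 + beta n j *: 'X)
   * \prod_(i < n) \sum_(k < d.+1) (- alpha p i) ^+ k *: 'X^k)`_d.

Definition rho (n p : nat) : infpoly int -> {mpoly rat[n + p]} :=
  infpoly_eval intr (fun i => quotient_chern n p i.+1).

Definition is_stable_thom (C : fieldType) (k n p : nat)
    (X : jet C k n p -> Prop) (Tp : infpoly int) : Prop :=
  forall i, thom (sigma_iter X i) = rho (i + n) (i + p) Tp.

Definition is_partition (mu : seq nat) : bool :=
  sorted geq mu && (0%N \notin mu).

Definition contains (mu la : seq nat) : bool :=
  all (fun i => nth 0 la i <= nth 0 mu i)%N (iota 0 (size la)).

Definition conj_part (mu : seq nat) : seq nat :=
  [seq count (fun x => i < x)%N mu | i <- iota 0 (head 0%N mu)].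

Definition chern_var (d : nat) : infpoly int :=
  if d is d'.+1 then monalg.mkmalgU (monalg.ucm d') 1 else 1.

Definition schur (mu : seq nat) : infpoly int :=
  \det (\matrix_(i < head 0%N mu, j < head 0%N mu)
          let a := nth 0%N (conj_part mu) i in
          if (i <= a + j)%N then chern_var (a + j - i) else 0).

Definition congr_mod_thick (P T : infpoly int) : Prop :=
  exists s : seq (int * seq nat),
    all (fun c => is_partition c.2 && contains c.2 [:: 4%N; 4%N]) s /\
    P - T = \sum_(c <- s) c.1 *: schur c.2.

(** * Q-functions and Legendre Thom polynomials *)

Section QFunctions.
Variables (R : comNzRingType) (n : nat).

(* Q_d(x_1, ..., x_n) *)
Definition Qgen (d : nat) : {mpoly R[n]} :=
  (\prod_(j < n) ((1 + 'X_j *: 'X)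
                  * \sum_(k < d.+1) ('X_j : {mpoly R[n]}) ^+ k *: 'X^k))`_d.

Definition Qpair (i j : nat) : {mpoly R[n]} :=
  Qgen i * Qgen j
  + (\sum_(1 <= s < j.+1) (-1) ^+ s * Qgen (i + s) * Qgen (j - s)) *+ 2.

(* The Pfaffian of the skew matrix with entries A (la_i) (la_j), i < j, by
   expansion along the first row; fuel is the length of la. *)
Fixpoint pfaffian (T : comNzRingType) (A : nat -> nat -> T) (fuel : nat)
    (la : seq nat) : T :=
  match fuel, la with
  | fuel'.+1, x :: la' =>
      \sum_(j < size la')
        (-1) ^+ j * A x (nth 0%N la' j)
        * pfaffian A fuel' (take j la' ++ drop j.+1 la')
  | _, _ => 1
  end.

Definition Qfun (la : seq nat) : {mpoly R[n]} :=
  let la' := if odd (size la) then rcons la 0%N else la in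
  pfaffian Qpair (size la') la'.

End QFunctions.

Definition is_strict (la : seq nat) : bool :=
  sorted gtn la && (0%N \notin la).

(* An element of Lambda[t], Lambda the ring of symmetric functions, is given
   by its images in Z[t][x_1, ..., x_n], for all n.  Gamma[t] is the subring
   generated over Z[t] by the Q_i; membership forces compatibility in n. *)
Definition symfun_t : Type := forall n : nat, {mpoly {poly int}[n]}.

Definition in_Gamma_t (F : symfun_t) : Prop :=
  exists G : infpoly {poly int},
    forall n, F n = infpoly_eval (fun c => c%:MP) (fun i => Qgen _ n i.+1) G.

(* t |-> - u/2,  x_i |-> u/2 - alpha_i; on the basis this is
   Q_la |-> Q_la (u/2 - alpha_1, ..., u/2 - alpha_n). *)
Definition Legendre (n : nat) (F : symfun_t) : {mpoly rat[n + 1]} :=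
  let u2 := (1 / 2%:R : rat) *: u_class n in
  mmap (fun c : {poly int} => (map_poly intr c).[- u2])
       (fun i => u2 - alpha 1 i) (F n).

Definition is_legendre_thom (C : fieldType) (k n0 : nat)
    (X : jet C k n0 1 -> Prop) (K : symfun_t) : Prop :=
  in_Gamma_t K /\
  forall i, thom (quad_unfolding i X)
    = \prod_(l < n0 + i) (u_class (n0 + i) - alpha 1 l) * Legendre (n0 + i) K.

Definition congr_mod_long (F G : symfun_t) : Prop :=
  exists s : seq ({poly int} * seq nat),
    all (fun c => is_strict c.2 && (4 <= size c.2)%N) s /\
    forall n, F n - G n = \sum_(c <- s) c.1 *: Qfun _ n c.2.

(** * Forms and ternary singularities *)

Definition form_index (d n : nat) : finType :=
  {m : 'X_{1..n < d.+1} | mdeg m == d}.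

Definition Pol (C : Type) (d n : nat) := {ffun form_index d n -> C}.

(* In the Chern roots of the dual of the standard representation of GL_n. *)
Definition GL_weight (d n : nat) (m : form_index d n) : 'rV[int]_n :=
  \row_(i < n) (bmnm (val m) i)%:Z.

(* u - sum_i d_i alpha_i *)
Definition GLGL_weight (d n : nat) (m : form_index d n) : 'rV[int]_(n + 1) :=
  target_weight (bmnm (val m)) ord0.

Section Forms.
Variable C : fieldType.

Definition form_poly (d n : nat) (f : Pol C d n) : {mpoly C[n]} :=
  \sum_(m : form_index d n) f m *: 'X_[bmnm (val m)].

Definition linear_poly (n : nat) (a : 'rV[C]_n) : {mpoly C[n]} :=
  \sum_(i < n) a 0 i *: 'X_i.

Definition form_subst (d n : nat) (g : 'M[C]_n) (f : Pol C d n) : Pol C d n :=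
  [ffun m => (form_poly f \mPo [tuple linear_poly (row i g) | i < n])
               @_(bmnm (val m))].

Definition GL_invariant (d n : nat) (X : Pol C d n -> Prop) : Prop :=
  forall g f, g \in unitmx -> X f -> X (form_subst g f).

Definition form_class (d n : nat) (X : Pol C d n -> Prop) : {mpoly rat[n]} :=
  eqclass (@GL_weight d n) X.

Definition form_jet (d n : nat) (f : Pol C d n) : jet C d n 1 :=
  jet_of d (fun _ => form_poly f).

Definition eta (X : Pol C 3 3 -> Prop) : jet C 3 3 1 -> Prop :=
  fun g => exists2 f, X f & g = form_jet f.

End Forms.

Definition euler_Pol (d n : nat) : {mpoly rat[n + 1]} :=
  euler_class (@GLGL_weight d n).

Definition dual_root_subst (n : nat) (P : {mpoly rat[n]}) : {mpoly rat[n + 1]} :=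
  P \mPo [tuple (1 / 3%:R : rat) *: u_class n - alpha 1 i | i < n].

(** * Strata of reduced plane cubics *)

Section Strata.
Variable C : fieldType.
Local Notation form := {mpoly C[3]}.
Local Notation eval_at F v := (F.@[fun i => (v : 'rV[C]_3) 0 i]).

Definition singular_point (F : form) (v : 'rV[C]_3) : Prop :=
  [/\ v != 0, eval_at F v = 0 & forall i, eval_at (mderiv i F) v = 0].

Definition hessian (F : form) (v : 'rV[C]_3) : 'M[C]_3 :=
  \matrix_(i, j) eval_at (mderiv i (mderiv j F)) v.

Definition mirreducible (F : form) : Prop :=
  (1 < msize F)%N /\
  forall G H : form, F = G * H -> (msize G <= 1)%N \/ (msize H <= 1)%N.

Definition conic_and_line (F : form) (a : 'rV[C]_3) (q : form) : Prop :=
  [/\ a != 0, q \is 2.-homog, mirreducible q & F = linear_poly a * q].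

Definition meet_in_two_points (a : 'rV[C]_3) (q : form) : Prop :=
  exists v1 v2 : 'rV[C]_3,
    [/\ \rank (col_mx v1 v2) = 2%N,
        eval_at (linear_poly a) v1 = 0 /\ eval_at (linear_poly a) v2 = 0 &
        eval_at q v1 = 0 /\ eval_at q v2 = 0].

Definition lines (F : form) (A : 'M[C]_3) : Prop :=
  (forall i j, i != j -> \rank (col_mx (row i A) (row j A)) = 2%N) /\
  F = \prod_i linear_poly (row i A).

Inductive stratum : Type :=
  | Smooth | Nodal | Cuspidal | ConicTransversal | ConicTangent
  | Triangle | Concurrent.

(* An irreducible cubic has a node (resp. a cusp) at a singular point when the
   tangent cone there is reduced (resp. a double line), i.e. when the Hessian
   of the form, which has the point in its kernel, has rank 2 (resp. 1). *)
Definition in_stratum (s : stratum) (F : form) : Prop :=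
  match s with
  | Smooth => forall v, ~ singular_point F v
  | Nodal => mirreducible F /\
      exists2 v, singular_point F v & \rank (hessian F v) = 2%N
  | Cuspidal => mirreducible F /\
      exists2 v, singular_point F v & \rank (hessian F v) = 1%N
  | ConicTransversal =>
      exists a q, conic_and_line F a q /\ meet_in_two_points a q
  | ConicTangent =>
      exists a q, conic_and_line F a q /\ ~ meet_in_two_points a q
  | Triangle => exists2 A, lines F A & \rank A = 3%N
  | Concurrent => exists2 A, lines F A & \rank A = 2%N
  end.

Definition stratum_closure (s : stratum) : Pol C 3 3 -> Prop :=
  zclosure (fun f => in_stratum s (form_poly f)).

End Strata.

Definition stratum_class (s : stratum) : {mpoly rat[3]} :=
  let c := mesym 3 rat in
  match s with
  | Smooth => 1
  | Nodal => 12 *: c 1%N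
  | Cuspidal => 24 *: c 1%N ^+ 2
  | ConicTransversal => 18 *: c 1%N ^+ 2 + 9 *: c 2%N
  | ConicTangent => 36 *: c 1%N ^+ 3 + 18 *: (c 1%N * c 2%N)
  | Triangle => 12 *: c 1%N ^+ 3 + 6 *: (c 1%N * c 2%N) + 27 *: c 3%N
  | Concurrent =>
      12 *: c 1%N ^+ 4 + 6 *: (c 1%N ^+ 2 * c 2%N) + 27 *: (c 1%N * c 3%N)
  end.

(* For concurrent lines the Legendre Thom polynomial is only given modulo
   Z Q_(4,3,2,1). *)
Definition stratum_legendre (s : stratum) : symfun_t := fun n =>
  let Q la : {mpoly {poly int}[n]} := Qfun _ n la in
  let t : {poly int} := 'X in
  match s with
  | Smooth => Q [:: 3; 2; 1]%N
  | Nodal => 12 *: Q [:: 4; 2; 1]%N + (12 * t) *: Q [:: 3; 2; 1]%N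
  | Cuspidal =>
      24 *: Q [:: 5; 2; 1]%N + 24 *: Q [:: 4; 3; 1]%N
      + (48 * t) *: Q [:: 4; 2; 1]%N + (24 * t ^+ 2) *: Q [:: 3; 2; 1]%N
  | ConicTransversal =>
      18 *: Q [:: 5; 2; 1]%N + 27 *: Q [:: 4; 3; 1]%N
      + (42 * t) *: Q [:: 4; 2; 1]%N + (21 * t ^+ 2) *: Q [:: 3; 2; 1]%N
  | ConicTangent =>
      36 *: Q [:: 6; 2; 1]%N + 90 *: Q [:: 5; 3; 1]%N + 54 *: Q [:: 4; 3; 2]%N
      + (120 * t) *: Q [:: 5; 2; 1]%N + (138 * t) *: Q [:: 4; 3; 1]%N
      + (126 * t ^+ 2) *: Q [:: 4; 2; 1]%N + (42 * t ^+ 3) *: Q [:: 3; 2; 1]%N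
  | Triangle =>
      12 *: Q [:: 6; 2; 1]%N + 30 *: Q [:: 5; 3; 1]%N + 45 *: Q [:: 4; 3; 2]%N
      + (40 * t) *: Q [:: 5; 2; 1]%N + (55 * t) *: Q [:: 4; 3; 1]%N
      + (45 * t ^+ 2) *: Q [:: 4; 2; 1]%N + (15 * t ^+ 3) *: Q [:: 3; 2; 1]%N
  | Concurrent =>
      12 *: Q [:: 7; 2; 1]%N + 42 *: Q [:: 6; 3; 1]%N + 30 *: Q [:: 5; 4; 1]%N
      + 75 *: Q [:: 5; 3; 2]%N
      + (52 * t) *: Q [:: 6; 2; 1]%N + (125 * t) *: Q [:: 5; 3; 1]%N
      + (100 * t) *: Q [:: 4; 3; 2]%N
      + (85 * t ^+ 2) *: Q [:: 5; 2; 1]%N + (100 * t ^+ 2) *: Q [:: 4; 3; 1]%N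
      + (60 * t ^+ 3) *: Q [:: 4; 2; 1]%N + (15 * t ^+ 4) *: Q [:: 3; 2; 1]%N
  end.

(* Main.v *)
From Stdlib Require Import Classical ClassicalEpsilon.
From Stdlib Require Import FunctionalExtensionality PropExtensionality.
Require Import Defs.
From mathcomp Require Import all_boot all_order all_algebra.
From mathcomp Require Import fingroup perm.
From mathcomp Require Import finmap complex reals.
From mathcomp Require Import -(notations) monalg.
From mathcomp Require Import mpoly.
From mathcomp Require Import ring zify.

(** Three facts carry the proof.

    First, the equivariant class of any set X is computed by an initial ideal.
    Dickson's lemma and inclusion-exclusion express the indicator of the standard
    monomials as a finite combination of divisibility conditions
    ([antichain_indicator]), and this combination is a K-polynomial for every
    positive grading with the same homogeneous elements ([Kpoly_exists]). The
    K-polynomial is unique because the Hilbert series of the ambient space is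
    invertible ([Kpoly_part_unique]). On cubic forms the torus of the target acts
    through scalars of the source, so the gradings by GL_3 and by GL_3 x GL_1 have
    the same homogeneous elements; one set of characters is carried to the other by
    alpha_i |-> u/3 - alpha_i. A cone of cubics lies in the jet space as a
    coordinate subspace, and the missing coordinates contribute the Euler classes
    of linear and quadratic forms by a Koszul argument ([eqclass_ext]). This is
    the formula for the Thom polynomial ([thom_eta]).

    Second, three variables detect exactly the Q-polynomials of length at most 3.
    Every element of Gamma[t] is a combination of Q-polynomials of strict partitions,
    by a straightening that increases the sum of the squares of the parts
    ([qmon_span]). In three variables, multiplication by the Vandermonde determinant
    turns Q-polynomials of lengths 2 and 3 into alternants times
    prod_(i < j) (x_i + x_j), and Q-polynomials of greater length into 0
    ([vdm_pfaffian3], [pfaffian_even_zero]). Hence the relations in three variables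
    are spanned by long partitions ([Q_kernel3]). The Legendre substitution is
    injective, so a Thom polynomial in three variables determines its Legendre Thom
    polynomial up to long Q-polynomials. This uses that the iterated unfolding with
    no square added is the singularity itself: the cone is closed and stable under
    contact equivalence, since target scalars are absorbed in the source by cube
    roots ([quad_unfolding0]).

    The same scheme works for Schur polynomials. They span by the Leibniz expansion
    of Jacobi-Trudi determinants ([chern_mon_span]). In three roots y_i = - alpha_i
    and one target class b, multiplication by the Toeplitz matrix of
    prod (1 - y_i z) reduces a Jacobi-Trudi determinant to a 3 x 3 determinant times
    b or 0 for each further row ([jt_det_split]). It vanishes for thick partitions,
    and the others are distinguished by alternants and powers of b
    ([thin_jt_independent]).

    Third, for the strata, the Thom polynomial is divisible by the Euler classes of
    linear and quadratic forms, and 8 x_1 x_2 x_3 prod_(i < j) (x_i + x_j), for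
    x_i = u/2 - alpha_i, is the Euler class of quadratic forms. Dividing by it
    leaves one polynomial identity per stratum ([stratum_identity]). The remaining
    ambiguity by long Q-polynomials is removed by degrees. Thom polynomials are
    homogeneous in any number of variables, so only terms of the degree of the known
    part can be added ([Legendre_determined]), and the least degree of a strict
    partition with four parts is 10, the degree for concurrent lines, where it is
    reached by (4, 3, 2, 1) alone ([strict_long_sum]). *)

Set Implicit Arguments.
Unset Strict Implicit.
Unset Printing Implicit Defensive.

Import Order.TTheory GRing.Theory Num.Theory.
Local Open Scope ring_scope.

(** * Collecting coefficients *)

Section Grouping.
Variables (R : nzRingType) (V : lmodType R) (T : eqType) (F : T -> V).
Implicit Types s : seq (R * T).

Definition coef_at s (u : T) : R := \sum_(c <- s | c.2 == u) c.1.

Lemma big_group s L : uniq L -> {subset [seq c.2 | c <- s] <= L} ->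
  \sum_(c <- s) c.1 *: F c.2 = \sum_(u <- L) coef_at s u *: F u.
Proof.
move=> uL sub; rewrite /coef_at.
under [RHS]eq_bigr do rewrite big_mkcond scaler_suml.
rewrite exchange_big /= big_seq [RHS]big_seq; apply: eq_bigr => k kK.
rewrite (bigD1_seq k.2) //=; last by apply/sub/map_f.
by rewrite eqxx big1 ?addr0 // => u /negPf ne; rewrite eq_sym ne scale0r.
Qed.

End Grouping.

(** * Dickson's lemma *)

Section Dickson.

Lemma mnmwiden_split n (m : 'X_{1..n.+1}) :
  m = (mnmwiden [multinom m (widen_ord (leqnSn n) i) | i < n]
       + U_(ord_max) *+ m ord_max)%MM.
Proof.
apply/mnmP => i; rewrite mnmDE mulmnE mnm1E.
case: (unliftP ord_max i) => [j ->|->]; last first.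
  by rewrite mnmwiden_ordmax eqxx mul1n.
have -> : lift ord_max j = widen_ord (leqnSn n) j by apply/val_inj; exact: lift_max.
rewrite mnmwiden_widen mnmE.
by rewrite -(inj_eq val_inj) /= gtn_eqF ?ltn_ord // mul0n addn0.
Qed.

Lemma mnmwiden_le n (m m' : 'X_{1..n}) j k :
  (m <= m')%MM -> (j <= k)%N ->
  (mnmwiden m + U_(ord_max) *+ j <= mnmwiden m' + U_(ord_max) *+ k)%MM.
Proof.
move=> /mnm_lepP le_m le_jk; apply/mnm_lepP => i.
rewrite !mnmDE !mulmnE; apply: leq_add; last by rewrite leq_mul2l le_jk orbT.
case: (unliftP ord_max i) => [l ->|->]; last by rewrite !mnmwiden_ordmax.
have -> : lift ord_max l = widen_ord (leqnSn n) l by apply/val_inj; exact: lift_max.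
by rewrite !mnmwiden_widen.
Qed.

Definition upset n (L : 'X_{1..n} -> Prop) :=
  forall m m' : 'X_{1..n}, (m <= m')%MM -> L m -> L m'.

(** The monomial ideals of k[x_1, ..., x_(n+1)] are increasing chains of monomial
    ideals L_k of k[x_1, ..., x_n]. Generators of the union of the L_k all
    appear in some L_B, and generators of L_0, ..., L_B then suffice. *)
Lemma dickson n (L : 'X_{1..n} -> Prop) : upset L ->
  exists s : seq 'X_{1..n}, forall m, L m <-> has (fun g => (g <= m)%MM) s.
Proof.
elim: n L => [|n IHn] L upL.
  have E0 (m : 'X_{1..0}) : m = 0%MM by apply/mnmP; case.
  case: (classic (L 0%MM)) => L0.
    by exists [:: 0%MM] => m; rewrite (E0 m) /= lepm_refl; split.
  by exists [::] => m; rewrite (E0 m) /=; split=> //; move/L0.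
pose Lk k (m : 'X_{1..n}) := L (mnmwiden m + U_(ord_max) *+ k)%MM.
have upLk k : upset (Lk k).
  by move=> m m' le_m; apply: upL; exact: mnmwiden_le.
have upLu : upset (fun m => exists k, Lk k m).
  by move=> m m' le_m [k Lm]; exists k; exact: upLk Lm.
have [s sP] := choice _ (fun k => IHn (Lk k) (upLk k)).
have [t tP] := IHn _ upLu.
have [B BP] : exists B, forall g, g \in t -> Lk B g.
  have: forall g, g \in t -> exists k, Lk k g.
    by move=> g gt; apply/tP/hasP; exists g => //; exact: lepm_refl.
  elim: (t) => [|g t' IHt] Ht; first by exists 0%N.
  have [k Lkg] := Ht g (mem_head _ _).
  have [B HB] := IHt (fun h ht => Ht h (@mem_behead _ (g :: t') h ht)).
  exists (maxn k B) => h; rewrite inE => /orP[/eqP->|ht].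
    by apply: upL Lkg; apply: mnmwiden_le; rewrite ?lepm_refl ?leq_maxl.
  by apply: upL (HB h ht); apply: mnmwiden_le; rewrite ?lepm_refl ?leq_maxr.
exists (flatten [seq [seq (mnmwiden g + U_(ord_max) *+ k)%MM | g <- s k]
         | k <- iota 0 B.+1]) => m; split=> [Lm|/hasP[g /flatten_mapP[k]]]; last first.
  move=> _ /mapP[h hs ->] le_h; apply: upL le_h _.
  by apply/sP/hasP; exists h => //; exact: lepm_refl.
pose m' := [multinom m (widen_ord (leqnSn n) i) | i < n].
have Em : m = (mnmwiden m' + U_(ord_max) *+ m ord_max)%MM by exact: mnmwiden_split.
pose k := minn (m ord_max) B.
have Lkm : Lk k m'.
  rewrite /k; case: (leqP (m ord_max) B) => [_|/ltnW leB]; first by rewrite /Lk -Em.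
  have /tP/hasP[g gt le_g] : exists j, Lk j m' by exists (m ord_max); rewrite /Lk -Em.
  exact: upLk le_g (BP g gt).
have /hasP[g gs le_g] := (sP k m').1 Lkm.
apply/hasP; exists (mnmwiden g + U_(ord_max) *+ k)%MM; last first.
  by rewrite Em; apply: mnmwiden_le => //; exact: geq_minl.
apply/flatten_mapP; exists k; last exact: map_f.
by rewrite mem_iota add0n ltnS geq_minr.
Qed.

(** Inclusion-exclusion: a further generator g multiplies the indicator of the
    complement by 1 - [g <= m], and [h <= m] [g <= m] = [lcm h g <= m]. *)
Lemma antichain_indicator n (s : seq 'X_{1..n}) :
  exists K : seq (int * 'X_{1..n}), forall m,
    (~~ has (fun g => (g <= m)%MM) s)%:Z = \sum_(k <- K) k.1 * (k.2 <= m)%MM%:Z.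
Proof.
elim: s => [|g s [K KP]].
  exists [:: (1, 0%MM)] => m; rewrite big_seq1 /= mul1r.
  by have -> : (0 <= m)%MM by apply/mnm_lepP => i; rewrite mnm0E.
exists (K ++ [seq (- k.1, mlcm k.2 g) | k <- K]) => m.
rewrite big_cat big_map /= -KP.
under [X in _ = _ + X]eq_bigr => k _.
  rewrite lem_mlcm -mulnb PoszM mulNr mulrA -mulNr.
  over.
rewrite -big_distrl /= sumrN -KP.
by case: (g <= m)%MM; case: has.
Qed.

End Dickson.

(** * Hilbert functions and initial ideals *)

Section Grading.
Variables (I : finType) (r : nat) (w : I -> 'rV[int]_r).
Local Notation N := #|I|.
Local Notation wt := (mon_weight w).

Lemma mon_weight0 : wt 0%MM = 0.
Proof. by rewrite /mon_weight big1 // => j _; rewrite mnm0E mulr0n. Qed.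

Lemma mon_weightD m m' : wt (m + m')%MM = wt m + wt m'.
Proof.
rewrite /mon_weight -big_split; apply: eq_bigr => j _.
by rewrite mnmDE mulrnDr.
Qed.

Lemma mon_weightU j : wt U_(j)%MM = w (enum_val j).
Proof.
rewrite /mon_weight (bigD1 j) //= mnm1E eqxx mulr1n big1 ?addr0 // => i ne_ij.
by rewrite mnm1E eq_sym (negPf ne_ij) mulr0n.
Qed.

Variable v : 'cV[int]_r.
(** Weights on which a linear functional v is positive leave only finitely many
    monomials in each weight, so that Hilbert functions make sense. *)
Definition height (d : 'rV[int]_r) : int := (d *m v) 0 0.
Hypothesis v_gt0 : forall i, 0 < height (w i).

Lemma heightB d d' : height (d - d') = height d - height d'.
Proof. by rewrite /height mulmxBl !mxE. Qed.

Lemma height_mon_weight m : (mdeg m)%:Z <= height (wt m).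
Proof.
rewrite /height /mon_weight mulmx_suml summxE mdegE.
rewrite (big_morph Posz PoszD (erefl _)) ler_sum // => j _.
rewrite -scaler_nat -scalemxAl mxE natz -/(height _).
by rewrite ler_peMr // -gtz0_ge1 v_gt0.
Qed.

Definition monomials_of (d : 'rV[int]_r) : seq 'X_{1..N} :=
  [seq m <- [seq bmnm x | x <- enum {: 'X_{1..N < `|height d|.+1}}] | wt m == d].

Lemma mem_monomials_of d m : (m \in monomials_of d) = (wt m == d).
Proof.
rewrite mem_filter; case: eqP => //= wt_m.
have lt_m : (mdeg m < `|height d|.+1)%N.
  by have := height_mon_weight m; rewrite wt_m; lia.
by apply/mapP; exists (BMultinom lt_m); rewrite ?mem_enum.
Qed.

Lemma uniq_monomials_of d : uniq (monomials_of d).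
Proof. by rewrite filter_uniq // map_inj_uniq ?enum_uniq //; exact: val_inj. Qed.

(** The Hilbert function of the whole polynomial ring. *)
Definition hsize (d : 'rV[int]_r) : nat := size (monomials_of d).

Lemma hsize0 : hsize 0 = 1%N.
Proof.
rewrite /hsize -[1%N]/(size [:: 0%MM : 'X_{1..N}]); apply: perm_size.
apply: uniq_perm; rewrite ?uniq_monomials_of // => m.
rewrite mem_monomials_of inE; apply/eqP/eqP => [wm|->]; last exact: mon_weight0.
apply/eqP; rewrite -mdeg_eq0; have := height_mon_weight m.
by rewrite wm /height mul0mx mxE; lia.
Qed.

Lemma hsize_le0 d : d != 0 -> height d <= 0 -> hsize d = 0%N.
Proof.
move=> d_neq0 d_le0; apply/eqP; rewrite size_eq0; apply/eqP.
case E: (monomials_of d) => [//|m s].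
have : m \in monomials_of d by rewrite E mem_head.
rewrite mem_monomials_of => /eqP wm; have := height_mon_weight m.
rewrite wm => le_m; have /eqP : mdeg m = 0%N by lia.
by rewrite mdeg_eq0 => /eqP m0; case/eqP: d_neq0; rewrite -wm m0 mon_weight0.
Qed.

(** The monomials of weight d divisible by g are g times those of weight
    d - wt g. *)
Lemma count_multiples d (g : 'X_{1..N}) :
  count (fun m => (g <= m)%MM) (monomials_of d) = hsize (d - wt g).
Proof.
rewrite -size_filter /hsize -(size_map (fun m => (m + g)%MM) (monomials_of (d - wt g))).
apply: perm_size; apply: uniq_perm.
- by rewrite filter_uniq // uniq_monomials_of.
- by rewrite map_inj_uniq ?uniq_monomials_of //; exact: addIm.
move=> m; rewrite mem_filter mem_monomials_of; apply/andP/mapP => [[le_gm /eqP <-]|].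
  exists (m - g)%MM; rewrite ?submK // mem_monomials_of.
  by rewrite -{2}(submK le_gm) mon_weightD addrK.
case=> m'; rewrite mem_monomials_of => /eqP wm ->; split; first exact: lem_addl.
by rewrite mon_weightD wm subrK.
Qed.

Lemma sumz_count (T : Type) (s : seq T) (p : pred T) :
  \sum_(x <- s) (p x)%:Z = (count p s)%:Z.
Proof.
elim: s => [|x s IH]; first by rewrite big_nil.
by rewrite big_cons /= IH PoszD.
Qed.

(** An expansion of the indicator of a set of monomials in terms of
    divisibility is the numerator of a Hilbert series: this is how a Groebner
    basis yields a K-polynomial. *)
Lemma hilbert_of_indicator (p : pred 'X_{1..N}) (K : seq (int * 'X_{1..N})) :
  (forall m, (p m)%:Z = \sum_(k <- K) k.1 * (k.2 <= m)%MM%:Z) ->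
  forall d, (count p (monomials_of d))%:Z
    = \sum_(k <- [seq (k.1, wt k.2) | k <- K]) k.1 * (hsize (d - k.2))%:Z.
Proof.
move=> pK d; rewrite -sumz_count; under eq_bigr do rewrite pK.
rewrite exchange_big big_map; apply: eq_bigr => k _.
by rewrite -big_distrr /= sumz_count count_multiples.
Qed.

Variable C : fieldType.
Local Notation S := {mpoly C[N]}.

Lemma of_weightP d (p : S) : reflect (forall m, m \in msupp p -> wt m = d) (of_weight w d p).
Proof. by apply: (iffP allP) => H m /H => [/eqP|->]. Qed.

Lemma of_weight0 d : of_weight w d (0 : S).
Proof. by rewrite /of_weight msupp0. Qed.

Lemma of_weightX m : of_weight w (wt m) ('X_[m] : S).
Proof. by rewrite /of_weight msuppX /= eqxx. Qed.

Lemma of_weightD d (p q : S) : of_weight w d p -> of_weight w d q -> of_weight w d (p + q).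
Proof.
move=> /of_weightP wp /of_weightP wq; apply/of_weightP => m /msuppD_le.
by rewrite mem_cat => /orP[/wp|/wq].
Qed.

Lemma of_weightZ d c (p : S) : of_weight w d p -> of_weight w d (c *: p).
Proof. by move=> /of_weightP wp; apply/of_weightP => m /msuppZ_le /wp. Qed.

Lemma of_weightN d (p : S) : of_weight w d p -> of_weight w d (- p).
Proof. by rewrite -scaleN1r; exact: of_weightZ. Qed.

Lemma of_weight_sum d (T : Type) (s : seq T) (P : pred T) (F : T -> S) :
  (forall x, P x -> of_weight w d (F x)) -> of_weight w d (\sum_(x <- s | P x) F x).
Proof.
move=> wF; elim/big_ind: _ => [||x /wF//]; [exact: of_weight0|exact: of_weightD].
Qed.

Lemma of_weightM d d' (p q : S) :
  of_weight w d p -> of_weight w d' q -> of_weight w (d + d') (p * q).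
Proof.
move=> /of_weightP wp /of_weightP wq; apply/of_weightP => m /msuppM_le.
by case/allpairsP => -[m1 m2] /= [/wp <- /wq <- ->]; rewrite mon_weightD.
Qed.

Variable X : {ffun I -> C} -> Prop.

Lemma peval_is_linear (x : {ffun I -> C}) (c : C) (p q : S) :
  peval x (c *: p + q) = c * peval x p + peval x q.
Proof. by rewrite /peval mevalD mevalZ. Qed.

Lemma vanishes_on_lin c (p q : S) :
  vanishes_on X p -> vanishes_on X q -> vanishes_on X (c *: p + q).
Proof. by move=> p0 q0 x Xx; rewrite peval_is_linear p0 // q0 // mulr0 addr0. Qed.

Lemma vanishes_on0 : vanishes_on X (0 : S).
Proof. by move=> x _; rewrite /peval meval0. Qed.

Lemma vanishes_onM (p q : S) : vanishes_on X p -> vanishes_on X (p * q).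
Proof. by move=> p0 x Xx; rewrite /peval mevalM [p.@[_]]p0 ?mul0r. Qed.

(** The initial ideal, formed with weight-homogeneous elements only: the ideal
    of X need not be homogeneous, but the Hilbert function only sees its
    homogeneous elements. *)
Definition lead_of (m : 'X_{1..N}) : Prop :=
  exists p : S, [/\ p != 0, vanishes_on X p, of_weight w (wt m) p & mlead p = m].

Lemma upset_lead_of : upset lead_of.
Proof.
move=> m m' le_m [p [p0 Xp wp lp]]; exists (p * 'X_[m' - m]).
have X0 : 'X_[C, m' - m] != 0 by rewrite -msupp_eq0 msuppX.
split; first by rewrite mulf_neq0.
- exact: vanishes_onM.
- have -> : wt m' = wt m + wt (m' - m)%MM by rewrite -mon_weightD addmC submK.
  by apply: of_weightM => //; exact: of_weightX.
by rewrite mleadM // lp mleadXm addmC submK.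
Qed.

Variable std : pred 'X_{1..N}.
Hypothesis stdP : forall m, ~~ std m <-> lead_of m.

Lemma mlead_cancel (m : 'X_{1..N}) (p q : S) :
  mlead p = m -> mlead q = m -> p@_m = q@_m -> p - q != 0 -> (mlead (p - q) < m)%O.
Proof.
move=> lp lq E nz; rewrite lt_neqAle; apply/andP; split.
  apply: contraNneq nz => E'.
  by rewrite -mleadc_eq0 E' mcoeffB E subrr.
by apply: le_trans (mleadB_le p q) _; rewrite lp lq joinxx.
Qed.

(** Division algorithm: induction along the monomial order, either moving the
    leading term to the normal form or cancelling it against an element of the
    ideal with the same leading monomial. *)
Lemma std_reduction d (p : S) : of_weight w d p ->
  exists c : 'X_{1..N} -> C,
    vanishes_on X (p - \sum_(m <- monomials_of d | std m) c m *: 'X_[m]).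
Proof.
move: {2}(mlead p) (erefl (mlead p)) => m; move: p.
elim/(well_founded_ind (@ltom_wf N)): m => m IH p lp wp.
have [->|p_nz] := eqVneq p 0.
  exists (fun=> 0); rewrite big1 ?subr0; first exact: vanishes_on0.
  by move=> ? _; rewrite scale0r.
have wm : wt m = d by move/of_weightP: wp => ->//; rewrite -lp mlead_supp.
have pm_nz : p@_m != 0 by rewrite -lp mleadc_eq0.
have rec (q : S) : of_weight w d q -> mlead q = m -> q@_m = p@_m ->
    exists c : 'X_{1..N} -> C,
    vanishes_on X ((p - q) - \sum_(m <- monomials_of d | std m) c m *: 'X_[m]).
  move=> wq lq qm; have [E|nz] := eqVneq (p - q) 0.
    rewrite E; exists (fun=> 0); rewrite big1 ?subr0; first exact: vanishes_on0.
    by move=> ? _; rewrite scale0r.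
  apply: IH (erefl _) _; first exact: mlead_cancel.
  by apply: of_weightD => //; exact: of_weightN.
case: (boolP (std m)) => [std_m|/stdP[q [q_nz Xq wq lq]]].
  have [|||c Hc] := rec (p@_m *: 'X_[m]).
  - by apply: of_weightZ; rewrite -wm; exact: of_weightX.
  - by rewrite mleadZ // mleadXm.
  - by rewrite mcoeffZ mcoeffX eqxx mulr1.
  exists (fun m' => c m' + (if m' == m then p@_m else 0)).
  suff -> : \sum_(m0 <- monomials_of d | std m0)
      (c m0 + (if m0 == m then p@_m else 0)) *: 'X_[m0]
      = p@_m *: 'X_[m] + \sum_(m0 <- monomials_of d | std m0) c m0 *: 'X_[m0] :> S.
    by rewrite opprD addrA.
  under eq_bigr do rewrite scalerDl.
  rewrite big_split /= addrC; congr (_ + _).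
  rewrite -big_filter (bigD1_seq m) /=; last first.
  - by rewrite filter_uniq ?uniq_monomials_of.
  - by rewrite mem_filter std_m mem_monomials_of wm eqxx.
  by rewrite eqxx big1 ?addr0 // => m' /negPf ->; rewrite scale0r.
have qm_nz : q@_m != 0 by rewrite -lq mleadc_eq0.
have [|||c Hc] := rec ((p@_m / q@_m) *: q).
- by apply: of_weightZ; rewrite -wm.
- by rewrite mleadZ // mulf_neq0 // invr_eq0.
- by rewrite mcoeffZ divfK.
exists c; have := vanishes_on_lin (p@_m / q@_m) Xq Hc.
set a := _ *: q; set b := \sum_(_ <- _ | _) _.
by have -> : a + (p - a - b) = p - b by ring.
Qed.

(** A nonzero relation would have a standard leading monomial, against the
    definition of standard. *)
Lemma std_independent d (c : 'X_{1..N} -> C) :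
  vanishes_on X (\sum_(m <- monomials_of d | std m) c m *: 'X_[m] : S) ->
  forall m, m \in monomials_of d -> std m -> c m = 0.
Proof.
move=> Xp m md std_m; set p := (\sum_(m <- _ | _) _) in Xp.
have pE m' : p@_m' = if (m' \in monomials_of d) && std m' then c m' else 0.
  rewrite raddf_sum /=; under eq_bigr do rewrite mcoeffZ mcoeffX.
  case: ifP => [/andP[m'd std']|/negP H].
    rewrite -big_filter (bigD1_seq m') /=; last first.
    - by rewrite filter_uniq ?uniq_monomials_of.
    - by rewrite mem_filter std' m'd.
    by rewrite eqxx mulr1 big1 ?addr0 // => m'' /negPf ->; rewrite mulr0.
  rewrite big_seq_cond big1 // => m'' /andP[m''d std''].
  case: eqP => [E|]; rewrite ?mulr0 //.
  by case: H; rewrite -E m''d.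
have [p0|nz] := eqVneq p 0.
  by have := pE m; rewrite p0 mcoeff0 md std_m /= => <-.
have := mlead_supp nz; rewrite mcoeff_msupp pE.
case: ifP => [/andP[ld std_l] _|]; last by rewrite eqxx.
suff /stdP : lead_of (mlead p) by rewrite std_l.
exists p; split=> //; move: ld; rewrite mem_monomials_of => /eqP ->.
rewrite /p big_seq_cond; apply: of_weight_sum => m' /andP[+ _].
by rewrite mem_monomials_of => /eqP <-; apply: of_weightZ; exact: of_weightX.
Qed.

(** Macaulay's theorem in each weight: standard monomials form a basis of the
    quotient. *)
Lemma hilbert_dim_std d : hilbert_dim w X d (count std (monomials_of d)).
Proof.
pose s := filter std (monomials_of d).
have us : uniq s by rewrite filter_uniq ?uniq_monomials_of.
have sizes : size s = count std (monomials_of d) by rewrite size_filter.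
rewrite -sizes.
have nth_s (i : 'I_(size s)) : nth 0%MM s i \in s by rewrite mem_nth.
have mem_s m : m \in s -> m \in monomials_of d /\ std m.
  by rewrite mem_filter => /andP[].
exists (fun i => 'X_[nth 0%MM s i]); split.
  move=> i; have [] := mem_s _ (nth_s i); rewrite mem_monomials_of => /eqP <- _.
  exact: of_weightX.
move=> p wp.
have sumE (c : 'X_{1..N} -> C) (a : {ffun 'I_(size s) -> C}) :
    (forall i, a i = c (nth 0%MM s i)) ->
    \sum_i a i *: 'X_[nth 0%MM s i] = \sum_(m <- monomials_of d | std m) c m *: 'X_[m] :> S.
  by move=> E; rewrite -[RHS]big_filter [RHS](big_nth 0%MM) big_mkord; apply: eq_bigr => i _; rewrite E.
have [c Hc] := std_reduction wp.
exists [ffun i : 'I_(size s) => c (nth 0%MM s i)]; split.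
  by rewrite (sumE c) // => i; rewrite ffunE.
move=> a Ha; apply/ffunP => i; rewrite ffunE.
pose c' m := if insub (index m s) is Some j then a j else 0.
have c'E j : a j = c' (nth 0%MM s j) by rewrite /c' index_uniq // valK.
rewrite c'E; apply/eqP; rewrite -subr_eq0; apply/eqP.
have [md std_m] := mem_s _ (nth_s i).
apply: (std_independent (d := d) (c := fun m => c m - c' m) _ md std_m).
have := vanishes_on_lin (-1) Hc Ha; rewrite (sumE c') //.
set A := \sum_(m <- _ | _) _; set B := \sum_(m <- _ | _) _.
have -> : \sum_(m <- monomials_of d | std m) (c m - c' m) *: 'X_[m] = A - B.
  by under eq_bigr do rewrite scalerBl; rewrite sumrB.
by rewrite scaleN1r opprB addrA subrK.
Qed.

End Grading.

(** * The equivariant class of an arbitrary set *)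

Lemma digits_inj n B (m m' : 'I_n -> nat) :
  (forall i, (m i < B)%N) -> (forall i, (m' i < B)%N) ->
  (\sum_i m i * B ^ i = \sum_i m' i * B ^ i)%N -> m =1 m'.
Proof.
elim: n m m' => [|n IH] m m' ltm ltm'; first by move=> _ [].
have B_gt0 : (0 < B)%N by apply: leq_ltn_trans (ltm ord0).
have split (f : 'I_n.+1 -> nat) :
    (\sum_i f i * B ^ i = (\sum_(i < n) f (lift ord0 i) * B ^ i) * B + f ord0)%N.
  rewrite big_ord_recl /= muln1 addnC big_distrl; congr (_ + _)%N.
  by apply: eq_bigr => i _; rewrite /= /bump /= add1n expnSr mulnA.
rewrite !split => E.
have E0 : m ord0 = m' ord0.
  by have := congr1 (modn^~ B) E; rewrite /= !modnMDl !modn_small.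
have E1 := congr1 (divn^~ B) E; rewrite /= !divnMDl // !divn_small // !addn0 in E1.
move=> i; case: (unliftP ord0 i) => [j ->|->//].
exact: (IH (fun j => m (lift ord0 j)) (fun j => m' (lift ord0 j)) _ _ E1).
Qed.

(** Kronecker substitution x_i := t ^ (B ^ i) turns distinct monomials with
    exponents below B into distinct powers of t, and a univariate polynomial has
    finitely many roots. *)
Lemma meval_eq0 (C : numFieldType) n (p : {mpoly C[n]}) :
  (forall v, p.@[v] = 0) -> p = 0.
Proof.
move=> p0; pose B := msize p; pose e (m : 'X_{1..n}) := (\sum_i m i * B ^ i)%N.
have lt_B m : m \in msupp p -> forall i, (m i < B)%N.
  move=> mp i; apply: leq_ltn_trans (msize_mdeg_lt mp).
  by rewrite mdegE (bigD1 i) //= leq_addr.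
pose P : {poly C} := \sum_(m <- msupp p) p@_m *: 'X^(e m).
have P0 : P = 0.
  apply/eqP/negPn/negP => nz.
  pose s := [seq k%:R | k <- iota 0 (size P)] : seq C.
  have : (size s < size P)%N.
    apply: max_poly_roots => //; last first.
      by rewrite map_inj_uniq ?iota_uniq // => x y /eqP; rewrite eqr_nat => /eqP.
    apply/allP => t _; rewrite /root /P horner_sum; apply/eqP.
    rewrite -[RHS](p0 (fun i => t ^+ (B ^ i))) mevalE; apply: eq_bigr => m _.
    rewrite hornerZ hornerXn -prodrXr; congr (_ * _); apply: eq_bigr => i _.
    by rewrite exprM exprAC -exprM mulnC exprM.
  by rewrite size_map size_iota ltnn.
apply/mpolyP => m; rewrite mcoeff0; case: (boolP (m \in msupp p)) => [mp|/memN_msupp_eq0//].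
have := congr1 (fun q : {poly C} => q`_(e m)) P0; rewrite coef0 coef_sum => <-.
rewrite (bigD1_seq m) ?msupp_uniq //= coefZ coefXn eqxx mulr1 big_seq_cond big1 ?addr0 //.
move=> m' /andP[m'p ne]; rewrite coefZ coefXn; case: eqP; rewrite ?mulr0 // => E.
by case/eqP: ne; apply/mnmP => i; rewrite (digits_inj (lt_B _ mp) (lt_B _ m'p) E).
Qed.

Section HilbertDim.
Variables (C : fieldType) (I : finType) (r : nat) (w : I -> 'rV[int]_r).
Variable X : {ffun I -> C} -> Prop.
Local Notation S := {mpoly C[#|I|]}.

(** Two bases of the same quotient are expressed in each other by matrices whose
    product is the identity. *)
Lemma hilbert_dim_le d h h' : hilbert_dim w X d h -> hilbert_dim w X d h' -> (h <= h')%N.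
Proof.
move=> [b [wb Hb]] [b' [wb' Hb']].
have [A HA] := choice _ (fun i => Hb' (b i) (wb i)).
have [B HB] := choice _ (fun j => Hb (b' j) (wb' j)).
pose MA := \matrix_(i < h, j < h') A i j; pose MB := \matrix_(j < h', k < h) B j k.
suff AB : MA *m MB = 1%:M by exact: mulmx1_min AB.
apply/matrixP => i k; rewrite !mxE.
have [c [_ uc]] := Hb (b i) (wb i).
have <- : c k = (i == k)%:R.
  have -> : c = [ffun k => (i == k)%:R]; last by rewrite ffunE.
  apply: uc; rewrite (bigD1 i) //= ffunE eqxx scale1r big1 ?addr0 ?subrr.
    exact: vanishes_on0.
  by move=> j /negPf ne; rewrite ffunE eq_sym ne scale0r.
have -> : c = [ffun k => \sum_j A i j * B j k].
  apply: uc; have [XA _] := HA i.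
  have -> : b i - \sum_k [ffun k => \sum_j A i j * B j k] k *: b k
      = (b i - \sum_j A i j *: b' j) + \sum_j A i j *: (b' j - \sum_k B j k *: b k).
    under [X in _ = _ + X]eq_bigr do rewrite scalerBr.
    rewrite sumrB addrA subrK; congr (_ - _).
    under [RHS]eq_bigr do rewrite scaler_sumr.
    rewrite [RHS]exchange_big; apply: eq_bigr => l _.
    by rewrite ffunE scaler_suml; apply: eq_bigr => j _; rewrite scalerA.
  have XB : vanishes_on X (\sum_j A i j *: (b' j - \sum_k B j k *: b k)).
    elim/big_rec: _ => [|j q _ Xq]; first exact: vanishes_on0.
    by apply: vanishes_on_lin => //; have [] := HB j.
  by have := vanishes_on_lin 1 XA XB; rewrite scale1r.
by rewrite ffunE; apply: eq_bigr => j _; rewrite !mxE.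
Qed.

Lemma hilbert_dim_unique d h h' : hilbert_dim w X d h -> hilbert_dim w X d h' -> h = h'.
Proof. by move=> H H'; apply/eqP; rewrite eqn_leq !(@hilbert_dim_le d). Qed.

End HilbertDim.

Section Kpolynomial.
Variables (C : numFieldType) (I : finType).
Local Notation N := #|I|.

Definition weigh (r : nat) (w : I -> 'rV[int]_r) (K : seq (int * 'X_{1..N})) :=
  [seq (k.1, mon_weight w k.2) | k <- K].

Definition positive (r : nat) (w : I -> 'rV[int]_r) :=
  exists v, forall i, 0 < height v (w i).

Lemma hilbert_dim_full (r : nat) (w : I -> 'rV[int]_r) v :
  (forall i, 0 < height v (w i)) ->
  forall d, hilbert_dim w (fun _ : {ffun I -> C} => True) d (hsize w v d).
Proof.
move=> v_gt0 d; rewrite /hsize -[size _](count_predT).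
apply: hilbert_dim_std => // m; split=> // -[p [+ p0 _ _]].
case/eqP; apply: meval_eq0 => x; have := p0 [ffun i => x (enum_rank i)] Logic.I.
by move=> E; rewrite -[RHS]E /peval; apply: meval_eq => j; rewrite ffunE enum_valK.
Qed.

(** The two gradings have the same homogeneous elements, although the
    weights differ. *)
Definition same_grading (r1 r2 : nat) (w1 : I -> 'rV[int]_r1) (w2 : I -> 'rV[int]_r2) :=
  forall m m' : 'X_{1..N},
    (mon_weight w1 m == mon_weight w1 m') = (mon_weight w2 m == mon_weight w2 m').

Lemma is_Kpoly_weigh (r : nat) (w : I -> 'rV[int]_r) (X : {ffun I -> C} -> Prop)
    (std : pred 'X_{1..N}) K :
  positive w -> (forall m, ~~ std m <-> lead_of w X m) ->
  (forall m, (std m)%:Z = \sum_(k <- K) k.1 * (k.2 <= m)%MM%:Z) ->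
  is_Kpoly w X (weigh w K).
Proof.
move=> [v v_gt0] stdP stdK.
exists (fun d => count std (monomials_of w v d)), (hsize w v); split.
- exact: hilbert_dim_std.
- exact: hilbert_dim_full.
exact: hilbert_of_indicator.
Qed.

(** The initial ideal depends only on which monomials have equal weight. One
    expansion at the level of monomials therefore serves both gradings at once;
    this is what allows the class for one group to be computed from the class
    for another. *)
Lemma Kpoly_exists (r1 r2 : nat) (w1 : I -> 'rV[int]_r1) (w2 : I -> 'rV[int]_r2)
    (X : {ffun I -> C} -> Prop) :
  positive w1 -> positive w2 -> same_grading w1 w2 ->
  exists K, is_Kpoly w1 X (weigh w1 K) /\ is_Kpoly w2 X (weigh w2 K).
Proof.
move=> pos1 pos2 same.
have [s sP] := dickson (@upset_lead_of I r1 w1 C X).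
have [K KP] := antichain_indicator s.
pose std m := ~~ has (fun g => (g <= m)%MM) s.
have stdP1 m : ~~ std m <-> lead_of w1 X m by rewrite negbK sP.
have stdP2 m : ~~ std m <-> lead_of w2 X m.
  rewrite stdP1; split=> -[p [nz Xp wp lp]]; exists p; split=> //.
    by apply/allP => m' /(allP wp); rewrite same.
  by apply/allP => m' /(allP wp); rewrite -same.
by exists K; split; apply: is_Kpoly_weigh; try exact: KP.
Qed.

Variables (r : nat) (w : I -> 'rV[int]_r).
Hypothesis w_pos : positive w.
Local Notation charpoly := (seq (int * 'rV[int]_r)).

Definition lowest_part (K : charpoly) (d : nat) (P : {mpoly rat[r]}) : Prop :=
  [/\ forall e, (e < d)%N -> Kpoly_part K e = 0,
      P = Kpoly_part K d & P = 0 -> forall e, Kpoly_part K e = 0].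

Lemma lowest_part_exists K : exists d P, lowest_part K d P.
Proof.
case: (classic (exists e, Kpoly_part K e != 0)) => [ex|nex].
  exists (ex_minn ex), (Kpoly_part K (ex_minn ex)); case: ex_minnP => d nz min.
  split=> // [e lt_ed|E]; last by rewrite E eqxx in nz.
  by apply/eqP/negPn/negP => /min; rewrite leqNgt lt_ed.
exists 0%N, (Kpoly_part K 0); split=> // _ e; apply/eqP/negPn/negP => nz.
by apply: nex; exists e.
Qed.

Lemma lowest_part_unique K K' d d' P P' :
  (forall e, Kpoly_part K e = Kpoly_part K' e) ->
  lowest_part K d P -> lowest_part K' d' P' -> P = P'.
Proof.
move=> E [low PE zero] [low' PE' zero'].
case: (ltngtP d d') => [lt_dd'|lt_d'd|eq_dd']; last by rewrite PE PE' E eq_dd'.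
  have P0 : P = 0 by rewrite PE E low'.
  by rewrite P0 PE' -E zero.
have P0 : P' = 0 by rewrite PE' -E low.
by rewrite P0 PE E zero'.
Qed.

(** The ambient Hilbert series is invertible: at a character u of minimal height
    with nonzero coefficient, the convolution with it reduces to the single term
    of u, as the other terms have nonpositive height. *)
Lemma coef_at_unique v (K : charpoly) :
  (forall i, 0 < height v (w i)) ->
  (forall d, \sum_(k <- K) k.1 * (hsize w v (d - k.2))%:Z = 0) ->
  forall u, coef_at K u = 0.
Proof.
move=> v_gt0 H.
pose s := undup [seq k.2 | k <- K].
have out u : u \notin s -> coef_at K u = 0.
  move=> us; rewrite /coef_at big_seq_cond big1 // => k /andP[kK /eqP E].
  by case/negP: us; rewrite mem_undup -E map_f.
pose bad := [seq u <- s | coef_at K u != 0].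
suff : bad = [::].
  move=> bad0 u; apply/eqP/negPn/negP => nz.
  suff : u \in bad by rewrite bad0.
  by rewrite mem_filter nz; apply: contraR nz => /out ->.
case E : bad => [//|u0 t].
have [u [ubad umin]] : exists u, u \in bad /\ forall u', u' \in bad -> height v u <= height v u'.
  rewrite E; elim: t u0 {E} => [|a t IH] u0.
    by exists u0; split=> [|u']; rewrite ?mem_head // inE => /eqP ->.
  have [b [bt bmin]] := IH a.
  case: (leP (height v u0) (height v b)) => [le|/ltW le].
    exists u0; split=> [|u']; rewrite ?mem_head // inE => /orP[/eqP->//|/bmin].
    exact: le_trans.
  exists b; split=> [|u']; rewrite inE ?bt ?orbT // => /orP[/eqP->//|/bmin//].
have := H u; pose F d : int^o := (hsize w v (u - d))%:Z.
rewrite -[LHS]/(\sum_(k <- K) k.1 *: F k.2).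
rewrite (@big_group _ _ _ F K s) ?undup_uniq //; last by move=> x; rewrite mem_undup.
have us : u \in s by move: ubad; rewrite mem_filter => /andP[].
rewrite (bigD1_seq u) ?undup_uniq //= big_seq_cond big1 => [|u' /andP[u's ne]]; last first.
  case: (eqVneq (coef_at K u') 0) => [->|nz]; first by rewrite scale0r.
  rewrite /F hsize_le0 ?scaler0 //; first by rewrite subr_eq0 eq_sym.
  by rewrite heightB subr_le0 umin // mem_filter nz.
rewrite addr0 /F subrr hsize0 // => E0.
by move: ubad; rewrite mem_filter -[coef_at K u]mulr1 [_ * 1]E0 eqxx.
Qed.

Lemma Kpoly_part_char (K : charpoly) s e : uniq s -> {subset [seq k.2 | k <- K] <= s} ->
  Kpoly_part K e = \sum_(u <- s) ((coef_at K u)%:~R / e`!%:R) *: (- linear_form rat u) ^+ e.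
Proof.
move=> us sub.
have scE (a : int) (x : rat) (p : {mpoly rat[r]}) : (a%:~R * x) *: p = (x *: p) *~ a.
  by rewrite -scalerA scaler_int.
rewrite /Kpoly_part; under eq_bigr do rewrite scE.
under [RHS]eq_bigr do rewrite scE.
rewrite /coef_at.
under [RHS]eq_bigr do rewrite big_mkcond raddf_sum /=.
rewrite [RHS]exchange_big /= big_seq [RHS]big_seq; apply: eq_bigr => k kK.
rewrite (bigD1_seq k.2) //=; last by apply/sub/map_f.
by rewrite eqxx big1 ?addr0 // => u /negPf ne; rewrite eq_sym ne.
Qed.

(** Both K-polynomials satisfy Hilb(S/I) = K * Hilb(S), hence agree as elements
    of the group ring by [coef_at_unique]; all parts of the Chern character only
    depend on that element. *)
Lemma Kpoly_part_unique (X : {ffun I -> C} -> Prop) K K' e :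
  is_Kpoly w X K -> is_Kpoly w X K' -> Kpoly_part K e = Kpoly_part K' e.
Proof.
have [v v_gt0] := w_pos.
move=> [hX [hV [HX HV EK]]] [hX' [hV' [HX' HV' EK']]].
have eV d : hV d = hsize w v d.
  by apply: hilbert_dim_unique (HV d) _; exact: hilbert_dim_full.
have eV' d : hV' d = hsize w v d.
  by apply: hilbert_dim_unique (HV' d) _; exact: hilbert_dim_full.
have eX d : hX d = hX' d by apply: hilbert_dim_unique (HX d) (HX' d).
(* the difference of the two in the group ring *)
pose K2 := K ++ [seq (- k.1, k.2) | k <- K'].
have cK2 u : coef_at K2 u = coef_at K u - coef_at K' u.
  by rewrite /coef_at big_cat big_map /= sumrN.
have cE : forall u, coef_at K2 u = 0.
  apply: (coef_at_unique v_gt0) => d; rewrite big_cat big_map /=.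
  under [X in _ + X]eq_bigr do rewrite mulNr.
  rewrite sumrN; apply/eqP; rewrite subr_eq0; apply/eqP.
  transitivity (hX d : int).
    by rewrite EK; apply: eq_bigr => k _; rewrite eV.
  by rewrite eX EK'; apply: eq_bigr => k _; rewrite eV'.
pose s := undup [seq k.2 | k <- K ++ K'].
rewrite !(@Kpoly_part_char _ s) ?undup_uniq //; first last.
- by move=> u; rewrite mem_undup map_cat mem_cat => ->.
- by move=> u; rewrite mem_undup map_cat mem_cat => ->; rewrite orbT.
apply: eq_bigr => u _; suff -> : coef_at K u = coef_at K' u by [].
by apply/eqP; rewrite -subr_eq0 -cK2 cE.
Qed.

(** The choice operator is harmless because a K-polynomial exists, for every X
    whatsoever. *)
Lemma eqclassP (X : {ffun I -> C} -> Prop) : exists K d,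
  is_Kpoly w X K /\ lowest_part K d (eqclass w X).
Proof.
have [K [HK _]] := Kpoly_exists X w_pos w_pos (fun _ _ => erefl).
have [d [P [low PE zero]]] := lowest_part_exists (weigh w K).
have : exists P, is_eqclass w X P by exists P, (weigh w K), d; split.
by move=> /(epsilon_spec (inhabits 0)) [K' [d' [H1 H2 H3 H4]]]; exists K', d'; split.
Qed.

Lemma eqclassE (X : {ffun I -> C} -> Prop) K d P :
  is_Kpoly w X K -> lowest_part K d P -> eqclass w X = P.
Proof.
move=> HK HP; have [K' [d' [HK' HP']]] := eqclassP X.
by apply: (lowest_part_unique _ HP' HP) => e; exact: (Kpoly_part_unique e HK' HK).
Qed.

Lemma linear_form_homog (u : 'rV[int]_r) : linear_form rat u \is 1.-homog.
Proof. by apply: rpred_sum => l _; rewrite rpredZ // dhomogX; apply/eqP; exact: mdeg1. Qed.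

Lemma eqclass_homog (X : {ffun I -> C} -> Prop) : exists d, eqclass w X \is d.-homog.
Proof.
have [K [d [_ [_ -> _]]]] := eqclassP X; exists d.
apply: rpred_sum => k _; rewrite rpredZ //.
have : - linear_form rat k.2 \is 1.-homog by rewrite rpredN linear_form_homog.
by move/(dhomogMn d); rewrite mul1n.
Qed.

End Kpolynomial.

(** * Enlarging the ambient representation *)

Section OfWeightComp.
Variables (C : fieldType) (I J : finType) (r : nat).
Variables (wI : I -> 'rV[int]_r) (wJ : J -> 'rV[int]_r).

(** Substituting elements of the matching weights preserves weights. *)
Lemma of_weight_comp (lq : #|I|.-tuple {mpoly C[#|J|]}) d (p : {mpoly C[#|I|]}) :
  (forall i, of_weight wJ (wI (enum_val i)) (tnth lq i)) ->
  of_weight wI d p -> of_weight wJ d (p \mPo lq).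
Proof.
move=> wlq /of_weightP wp; rewrite comp_mpolyEX big_seq.
apply: of_weight_sum => m /wp <-; apply: of_weightZ; rewrite comp_mpolyX /mon_weight.
have w1 : of_weight wJ 0 (1 : {mpoly C[#|J|]}).
  by rewrite -mpolyX0 -(mon_weight0 wJ) of_weightX.
elim/big_rec2: _ => // i q dq _ wq; apply: of_weightM => //.
elim: (m i) => [|k IH]; first by rewrite mulr0n expr0.
by rewrite exprS mulrS; exact: of_weightM.
Qed.

End OfWeightComp.

Section Koszul.
Variable r : nat.

(** Multiplication by 1 - e^u in the group ring. *)
Definition koszul (K : seq (int * 'rV[int]_r)) (u : 'rV[int]_r) :=
  K ++ [seq (- k.1, k.2 + u) | k <- K].

(** The character 1 - e^u contributes the series 1 - exp (- u), which has no
    constant term: only parts of K of degree below e occur. *)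
Lemma Kpoly_part_koszul K u e :
  Kpoly_part (koszul K u) e
    = - \sum_(i < e) (e - i)`!%:R^-1 *: ((- linear_form rat u) ^+ (e - i) * Kpoly_part K i).
Proof.
set y := - linear_form rat u.
have lfD k : - linear_form rat (k + u) = y - linear_form rat k.
  rewrite /y /linear_form -!sumrN -big_split; apply: eq_bigr => l _.
  by rewrite mxE rmorphD scalerDl opprD addrC.
have expE (x : {mpoly rat[r]}) (a : rat) :
    (a / e`!%:R) *: (y + x) ^+ e
    = \sum_(i < e.+1) (e - i)`!%:R^-1 *: (y ^+ (e - i) * ((a / i`!%:R) *: x ^+ i)).
  rewrite exprDn scaler_sumr; apply: eq_bigr => i _.
  rewrite -scaler_nat -scalerAr !scalerA; congr (_ *: _).
  rewrite -(@bin_fact e i) -1?ltnS // !natrM.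
  have nz k : k`!%:R != 0 :> rat by rewrite pnatr_eq0 -lt0n fact_gt0.
  have nzC : 'C(e, i)%:R != 0 :> rat by rewrite pnatr_eq0 -lt0n bin_gt0 -ltnS.
  by field; rewrite !nz nzC.
have -> : Kpoly_part (koszul K u) e = Kpoly_part K e
    - \sum_(i < e.+1) (e - i)`!%:R^-1 *: (y ^+ (e - i) * Kpoly_part K i).
  rewrite {1}/Kpoly_part big_cat big_map /=; congr (_ + _).
  under eq_bigr do rewrite lfD mulrNz expE.
  rewrite /Kpoly_part.
  under [X in _ = - X]eq_bigr do rewrite mulr_sumr scaler_sumr.
  rewrite [X in _ = - X]exchange_big -sumrN; apply: eq_bigr => k _.
  rewrite -[RHS]sumrN; apply: eq_bigr => i _.
  by rewrite !mulNr scaleNr mulrN scalerN.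
rewrite big_ord_recr /= subnn expr0 mul1r invr1 scale1r.
by rewrite opprD addrCA subrr addr0.
Qed.

(** The lowest term of the Chern character of 1 - e^u is u itself, and lowest
    terms multiply. *)
Lemma lowest_part_koszul K d P u : linear_form rat u != 0 ->
  lowest_part K d P -> lowest_part (koszul K u) d.+1 (linear_form rat u * P).
Proof.
move=> u_nz [low PE zero]; split.
- move=> e lt_ed; rewrite Kpoly_part_koszul big1 ?oppr0 // => i _.
  by rewrite low ?mulr0 ?scaler0 //; apply: leq_trans (ltn_ord i) _; rewrite -ltnS.
- rewrite Kpoly_part_koszul big_ord_recr /= big1 ?add0r => [|i _]; last first.
    by rewrite low ?mulr0 ?scaler0 //= ltn_ord.
  by rewrite subSnn invr1 scale1r expr1 mulNr opprK PE.
move=> /eqP; rewrite mulf_eq0 (negPf u_nz) /= => /eqP P0 e.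
rewrite Kpoly_part_koszul big1 ?oppr0 // => i _.
by rewrite zero // mulr0 scaler0.
Qed.

End Koszul.

Section Extension.
Variables (C : numFieldType) (I J : finType) (r : nat) (wJ : J -> 'rV[int]_r).
Variables (e : I -> J) (ext : {ffun I -> C} -> {ffun J -> C}).
Hypotheses (e_inj : injective e) (extE : forall f i, ext f (e i) = f i)
  (ext0 : forall f j, j \notin codom e -> ext f j = 0).
Local Notation wI := (fun i => wJ (e i)).

(** X placed inside a larger representation as the coordinate subspace indexed
    by the image of I. *)
Definition ext_set (X : {ffun I -> C} -> Prop) (g : {ffun J -> C}) : Prop :=
  exists2 f, X f & g = ext f.

Let eo (i : 'I_#|I|) : 'I_#|J| := enum_rank (e (enum_val i)).

Let eo_inj : injective eo.
Proof. by move=> i i' /enum_rank_inj /e_inj /enum_val_inj. Qed.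

Let push := [tuple ('X_(eo i) : {mpoly C[#|J|]}) | i < #|I|].
Let pull := [tuple if [pick i | eo i == j] is Some i then ('X_i : {mpoly C[#|I|]}) else 0
               | j < #|J|].

Lemma peval_push f p : peval (ext f) (p \mPo push) = peval f p.
Proof.
rewrite /peval comp_mpoly_meval; apply: meval_eq => i.
by rewrite tnth_mktuple mevalXU /eo enum_rankK extE.
Qed.

Lemma peval_pull f q : peval f (q \mPo pull) = peval (ext f) q.
Proof.
rewrite /peval comp_mpoly_meval; apply: meval_eq => j.
rewrite tnth_mktuple; case: pickP => [i /eqP <-|H].
  by rewrite mevalXU /eo enum_rankK extE.
rewrite meval0 ext0 //; apply/negP => /codomP[i E].
by have := H (enum_rank i); rewrite /eo enum_rankK -E enum_valK eqxx.
Qed.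

Lemma hilbert_dim_ext X d h : hilbert_dim wI X d h -> hilbert_dim wJ (ext_set X) d h.
Proof.
move=> [b [wb Hb]]; exists (fun i => b i \mPo push); split.
  move=> i; apply: of_weight_comp (wb i) => i'; rewrite tnth_mktuple.
  rewrite -[wJ (e _)]/(wJ (e _)) -{1}[e (enum_val i')]enum_rankK -mon_weightU.
  exact: of_weightX.
have vanE (q : {mpoly C[#|J|]}) (c : {ffun 'I_h -> C}) :
    vanishes_on (ext_set X) (q - \sum_i c i *: (b i \mPo push))
    <-> vanishes_on X (q \mPo pull - \sum_i c i *: b i).
  have E f : peval (ext f) (q - \sum_i c i *: (b i \mPo push))
      = peval f (q \mPo pull - \sum_i c i *: b i).
    rewrite /peval !mevalB; congr (_ - _); first exact/esym/peval_pull.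
    rewrite !raddf_sum; apply: eq_bigr => i _; rewrite /= !mevalZ; congr (_ * _).
    exact: peval_push.
  by split=> [H f Xf|H _ [f Xf ->]]; [rewrite -E; apply: H; exists f|rewrite E; exact: H].
move=> q wq; have wq' : of_weight wI d (q \mPo pull).
  apply: of_weight_comp wq => j; rewrite tnth_mktuple; case: pickP => [i /eqP E|_].
    by rewrite -E /eo enum_rankK -(mon_weightU (fun i => wJ (e i))) of_weightX.
  exact: of_weight0.
have [c [Hc uc]] := Hb _ wq'; exists c; split; first exact/vanE.
by move=> c' /vanE /uc.
Qed.

Variable v : 'cV[int]_r.
Hypothesis v_gt0 : forall j, 0 < height v (wJ j).

(** Monomials involving none of the variables in s. With s all the new
    variables this is the Hilbert function of the small representation. *)
Definition hsize_avoid (s : seq 'I_#|J|) d : nat :=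
  count (fun m : 'X_{1..#|J|} => all (fun j => m j == 0%N) s) (monomials_of wJ v d).

Lemma count_split (T : Type) (a b : pred T) (s : seq T) :
  count b s = (count (fun x => a x && b x) s + count (fun x => ~~ a x && b x) s)%N.
Proof. by elim: s => //= x s ->; case: (a x); case: (b x) => /=; lia. Qed.

(** Subtract the multiples of the variable of index j. *)
Lemma hsize_avoid_cons j s d : j \notin s ->
  ((hsize_avoid (j :: s) d)%:Z
   = (hsize_avoid s d)%:Z - (hsize_avoid s (d - wJ (enum_val j)))%:Z).
Proof.
move=> js; apply/esym/eqP; rewrite subr_eq; apply/eqP; rewrite -PoszD; congr Posz.
rewrite {1}/hsize_avoid (count_split (fun m : 'X_{1..#|J|} => m j == 0%N)).
congr (_ + _)%N.
rewrite /hsize_avoid -!size_filter -[RHS](size_map (fun m => (m + U_(j))%MM)).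
apply: perm_size; apply: uniq_perm.
- by rewrite filter_uniq // uniq_monomials_of.
- rewrite map_inj_uniq; last exact: addIm.
  by rewrite filter_uniq // uniq_monomials_of.
have avoidD (m : 'X_{1..#|J|}) :
    all (fun i => (m + U_(j))%MM i == 0%N) s = all (fun i => m i == 0%N) s.
  apply: eq_in_all => i is_; rewrite mnmDE mnm1E.
  have /negPf -> : j != i by apply: contraNneq js => ->.
  by rewrite addn0.
move=> m; rewrite mem_filter mem_monomials_of //; apply/idP/mapP.
  move=> /andP[/andP[mj ms] /eqP <-].
  have le_m : (U_(j) <= m)%MM by rewrite lep1mP.
  exists (m - U_(j))%MM; rewrite ?submK // mem_filter mem_monomials_of //.
  by rewrite -avoidD submK // ms -mon_weightU -{2}(submK le_m) mon_weightD addrK /=.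
case=> m'; rewrite mem_filter mem_monomials_of // => /andP[m's /eqP wm'] ->.
rewrite avoidD m's mnmDE mnm1E eqxx addn1 /= mon_weightD wm' mon_weightU.
by rewrite subrK.
Qed.

Definition outside : seq 'I_#|J| := [seq j <- enum 'I_#|J| | j \notin codom eo].

Let push_mon (m : 'X_{1..#|I|}) : 'X_{1..#|J|} :=
  [multinom if [pick i | eo i == j] is Some i then m i else 0%N | j < #|J|].

Let push_monE m i : push_mon m (eo i) = m i.
Proof.
rewrite mnmE; case: pickP => [i' /eqP /eo_inj ->//|H].
by have := H i; rewrite eqxx.
Qed.

Lemma mon_weight_push m : mon_weight wJ (push_mon m) = mon_weight wI m.
Proof.
rewrite /mon_weight (bigID (mem (codom eo))) /= [X in _ + X]big1 ?addr0; last first.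
  move=> j jo; rewrite mnmE; case: pickP => [i /eqP E|_]; last by rewrite mulr0n.
  by case/negP: jo; rewrite -E; exact: codom_f.
rewrite -big_uniq /=; last by rewrite map_inj_uniq ?enum_uniq.
rewrite big_map big_enum; apply: eq_bigr => i _.
by rewrite push_monE /eo enum_rankK.
Qed.

Lemma hsize_avoid_outside d : hsize wI v d = hsize_avoid outside d.
Proof.
have vI i : 0 < height v (wI i) by [].
rewrite /hsize /hsize_avoid -size_filter -(size_map push_mon).
apply: perm_size; apply: uniq_perm.
- rewrite map_inj_uniq ?uniq_monomials_of // => m m' /mnmP E.
  by apply/mnmP => i; rewrite -!push_monE E.
- by rewrite filter_uniq // uniq_monomials_of.
move=> m; rewrite mem_filter mem_monomials_of //; apply/mapP/idP.
  case=> m'; rewrite mem_monomials_of // => /eqP <- ->.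
  rewrite mon_weight_push eqxx andbT; apply/allP => j.
  rewrite mem_filter mnmE => /andP[+ _]; case: pickP => [i /eqP <-|//].
  by rewrite codom_f.
move=> /andP[/allP ms /eqP wm].
have E : m = push_mon [multinom m (eo i) | i < #|I|].
  apply/mnmP => j; rewrite mnmE; case: pickP => [i /eqP <-|H]; first by rewrite mnmE.
  apply/eqP/ms; rewrite mem_filter mem_enum andbT; apply/negP => /codomP[i E].
  by have := H i; rewrite E eqxx.
exists [multinom m (eo i) | i < #|I|] => //.
by rewrite mem_monomials_of // -mon_weight_push -E wm.
Qed.

(** The Koszul resolution of the coordinate subspace, one variable at a time. *)
Lemma koszul_hilbert K s d : uniq s ->
  \sum_(k <- foldr (fun j K => koszul K (wJ (enum_val j))) K s)
      k.1 * (hsize wJ v (d - k.2))%:Z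
  = \sum_(k <- K) k.1 * (hsize_avoid s (d - k.2))%:Z.
Proof.
elim: s d => [|j s IH] d.
  by move=> _; apply: eq_bigr => k _; rewrite /hsize_avoid /= count_predT.
move=> /= /andP[js us]; rewrite big_cat big_map /= IH //.
under [X in _ + X]eq_bigr => k _ do rewrite opprD addrA addrAC mulNr.
rewrite sumrN IH // -sumrB; apply: eq_bigr => k _.
by rewrite hsize_avoid_cons // mulrBr addrAC.
Qed.

Lemma is_Kpoly_ext X K : is_Kpoly wI X K ->
  is_Kpoly wJ (ext_set X) (foldr (fun j K => koszul K (wJ (enum_val j))) K outside).
Proof.
have vI i : 0 < height v (wI i) by [].
move=> [hX [hV [HX HV EK]]]; exists hX, (hsize wJ v); split.
- by move=> d; exact: hilbert_dim_ext.
- exact: hilbert_dim_full.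
move=> d; rewrite koszul_hilbert; last by rewrite filter_uniq // enum_uniq.
rewrite EK; apply: eq_bigr => k _; congr (_ * Posz _).
rewrite -hsize_avoid_outside; apply: hilbert_dim_unique (HV _) _.
exact: hilbert_dim_full.
Qed.

Lemma lowest_part_koszul_seq K d P (s : seq 'I_#|J|) :
  (forall j, linear_form rat (wJ j) != 0) -> lowest_part K d P ->
  exists d', lowest_part (foldr (fun j K => koszul K (wJ (enum_val j))) K s) d'
    ((\prod_(j <- s) linear_form rat (wJ (enum_val j))) * P).
Proof.
move=> nz HP; elim: s => [|j s [d' IH]]; first by exists d; rewrite big_nil mul1r.
by exists d'.+1; rewrite big_cons -mulrA; exact: lowest_part_koszul.
Qed.

(** A coordinate subspace is a complete intersection of hyperplanes, so that
    the class gets multiplied by the Euler class of the normal directions. *)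
Lemma eqclass_ext X : (forall j, linear_form rat (wJ j) != 0) ->
  eqclass wJ (ext_set X)
  = (\prod_(j | j \notin codom e) linear_form rat (wJ j)) * eqclass wI X.
Proof.
move=> nz.
have posJ : positive wJ by exists v.
have posI : positive wI by exists v.
have [K [d [HK HP]]] := eqclassP posI X.
have [d' HP'] := lowest_part_koszul_seq outside nz HP.
rewrite (eqclassE posJ (is_Kpoly_ext HK) HP'); congr (_ * _).
rewrite /outside big_filter big_enum_cond /=.
rewrite [RHS](reindex_onto (fun j : 'I_#|J| => enum_val j) enum_rank) /=; last first.
  by move=> j _; rewrite enum_rankK.
apply: eq_bigl => j; rewrite enum_valK eqxx andbT; congr negb.
apply/codomP/codomP => -[i E].
  by exists (enum_val i); rewrite E /eo enum_rankK.
by exists (enum_rank i); rewrite /eo enum_rankK -E enum_valK.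
Qed.

Lemma zclosed_ext X : zclosed X -> zclosed (ext_set X).
Proof.
move=> closedX g Hg; pose f := [ffun i => g (e i)].
have gE : g = ext f.
  apply/ffunP => j; case: (boolP (j \in codom e)) => [/codomP[i ->]|jo].
    by rewrite extE ffunE.
  rewrite ext0 //; have <- : peval g 'X_(enum_rank j) = g j.
    by rewrite /peval mevalXU enum_rankK.
  by apply: Hg => _ [f' _ ->]; rewrite /peval mevalXU enum_rankK ext0.
exists f => //; apply: closedX => p Xp; rewrite -peval_push -gE.
by apply: Hg => _ [f' Xf' ->]; rewrite peval_push Xp.
Qed.

End Extension.

(** * Thom polynomials of cones of ternary cubics *)

Lemma mcoeff_linear_form r (d : 'rV[int]_r) l : (linear_form rat d)@_U_(l) = (d 0 l)%:~R.
Proof.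
rewrite /linear_form raddf_sum (bigD1 l) //= mcoeffZ mcoeffXU eqxx mulr1.
by rewrite big1 ?addr0 // => i /negPf ne; rewrite mcoeffZ mcoeffXU ne mulr0.
Qed.

Lemma linear_form_is_additive r : {morph @linear_form rat r : d d' / d + d'}.
Proof.
move=> d d'; rewrite /linear_form -big_split; apply: eq_bigr => l _.
by rewrite mxE rmorphD scalerDl.
Qed.

Lemma linear_form0 r : linear_form rat (0 : 'rV[int]_r) = 0.
Proof. by rewrite /linear_form big1 // => l _; rewrite mxE scale0r. Qed.

Lemma linear_formMn r (d : 'rV[int]_r) k : linear_form rat (d *+ k) = linear_form rat d *+ k.
Proof.
elim: k => [|k IH]; first by rewrite !mulr0n linear_form0.
by rewrite !mulrS linear_form_is_additive IH.
Qed.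

Lemma comp_mpoly_comp (R : comNzRingType) n k l (lq : n.-tuple {mpoly R[k]})
    (lr : k.-tuple {mpoly R[l]}) (p : {mpoly R[n]}) :
  (p \mPo lq) \mPo lr = p \mPo [tuple tnth lq i \mPo lr | i < n].
Proof.
rewrite [p \mPo lq]comp_mpolyEX [RHS]comp_mpolyEX raddf_sum /=; apply: eq_bigr => m _.
rewrite comp_mpolyZ !comp_mpolyX rmorph_prod /=; congr (_ *: _).
by apply: eq_bigr => i _; rewrite rmorphXn /= tnth_mktuple.
Qed.

Section TargetWeight.
Variables (k n p : nat).

Lemma linear_form_target (m : 'X_{1..n}) (j : 'I_p) :
  linear_form rat (target_weight m j) = beta n j - \sum_(i < n) alpha p i *+ m i.
Proof.
rewrite /linear_form big_split_ord /= addrC; congr (_ + _).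
  rewrite (bigD1 j) //= row_mxEr mxE eqxx scale1r big1 ?addr0 // => j' /negPf ne.
  by rewrite row_mxEr mxE ne scale0r.
rewrite -sumrN; apply: eq_bigr => i _.
by rewrite row_mxEl mxE rmorphN /= scaleNr -scaler_nat.
Qed.

Lemma jet_weight_neq0 (i : jet_index k n p) : linear_form rat (jet_weight i) != 0.
Proof.
apply/eqP => /(congr1 (mcoeff U_(rshift n i.2)%MM)).
by rewrite mcoeff_linear_form mcoeff0 row_mxEr mxE eqxx.
Qed.

(** Every jet coordinate has weight 1 in its own target variable: target scalars
    act with positive weights. *)
Definition target_height : 'cV[int]_(n + p) := col_mx 0 (const_mx 1).

Lemma target_weight_gt0 (m : 'X_{1..n}) (j : 'I_p) :
  0 < height target_height (target_weight m j).
Proof.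
rewrite /height /target_height mul_row_col mulmx0 add0r mxE (bigD1 j) //=.
rewrite !mxE eqxx big1 => // j' /negPf ne; by rewrite !mxE ne mul0r.
Qed.

Lemma jet_weight_positive : positive (@jet_weight k n p).
Proof. by exists target_height => i; exact: target_weight_gt0. Qed.

End TargetWeight.

Lemma thom_homog (C : numFieldType) k n p (X : jet C k n p -> Prop) :
  exists d, thom X \is d.-homog.
Proof. exact/eqclass_homog/jet_weight_positive. Qed.

Section Forms.
Variables (d n : nat).
Hypothesis d_gt0 : (0 < d)%N.

Lemma GL_weight_gt0 (m : form_index d n) : 0 < height (const_mx 1) (GL_weight m).
Proof.
rewrite /height mxE; under eq_bigr do rewrite !mxE mulr1.
rewrite -(big_morph Posz PoszD (erefl _)) -mdegE.
by case: m => m /= /eqP ->.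
Qed.

(** On forms of degree d > 0 the weight for GL_n already determines the degree of
    a monomial in the coefficients. *)
Lemma sum_GL_weight (M : 'X_{1..#|form_index d n|}) :
  \sum_i mon_weight (@GL_weight d n) M 0 i = (d * mdeg M)%:Z.
Proof.
under eq_bigr do rewrite /mon_weight summxE.
rewrite exchange_big mdegE big_distrr /= (big_morph Posz PoszD (erefl _)).
apply: eq_bigr => j _; have /eqP E := valP (enum_val j).
rewrite (_ : (d * M j)%N = (mdeg (bmnm (val (enum_val j))) * M j)%N); last by rewrite E.
rewrite mdegE PoszM (big_morph Posz PoszD (erefl _)) mulr_suml.
by apply: eq_bigr => i _; rewrite mulmxnE mxE -mulr_natr natz.
Qed.

Lemma mon_weight_GLGL (M : 'X_{1..#|form_index d n|}) :
  mon_weight (@GLGL_weight d n) M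
  = row_mx (- mon_weight (@GL_weight d n) M) (const_mx (mdeg M)%:Z).
Proof.
apply/rowP => l; rewrite -[l]splitK; case: split => i /=.
  rewrite row_mxEl /mon_weight mxE !summxE -sumrN; apply: eq_bigr => j _.
  by rewrite !mulmxnE row_mxEl !mxE mulNrn.
rewrite row_mxEr /mon_weight mxE !summxE mdegE (big_morph Posz PoszD (erefl _)).
apply: eq_bigr => j _.
rewrite !mulmxnE row_mxEr !mxE (ord1 i) eqxx; exact: natz.
Qed.

(** Scalars of the target act on forms of a fixed degree through scalars of the
    source, so the second torus does not refine the grading. *)
Lemma same_grading_GL : same_grading (@GL_weight d n) (@GLGL_weight d n).
Proof.
move=> M M'; apply/eqP/eqP => [E|]; rewrite !mon_weight_GLGL.
  congr row_mx; first by rewrite E.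
  suff -> : mdeg M = mdeg M' by [].
  have := congr1 (fun x : 'rV[int]_n => \sum_i x 0 i) E; rewrite /= !sum_GL_weight => -[].
  by move/eqP; rewrite eqn_pmul2l // => /eqP.
by move/eq_row_mx => [/oppr_inj].
Qed.

Definition form_jet_index (m : form_index d n) : jet_index d n 1 :=
  (exist (fun m : 'X_{1..n < d.+1} => (0 < mdeg m)%N) (val m)
     (eq_ind_r (leq 1) d_gt0 (eqP (valP m))), ord0).

Lemma form_jet_index_inj : injective form_jet_index.
Proof. by move=> m m' [/val_inj]. Qed.

Lemma codom_form_jet_index j :
  (j \in codom form_jet_index) = (mdeg (bmnm (val j.1)) == d).
Proof.
apply/codomP/idP => [[m ->]|E]; first exact: (valP m).
exists (exist _ (val j.1) E); case: j E => -[m m_gt0] i E /=.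
by congr (_, _); [exact: val_inj|rewrite (ord1 i)].
Qed.

Variable C : numFieldType.

Lemma mcoeff_form_poly (f : Pol C d n) (m : form_index d n) :
  (form_poly f)@_(bmnm (val m)) = f m.
Proof.
rewrite raddf_sum (bigD1 m) //= mcoeffZ mcoeffX eqxx mulr1 big1 ?addr0 // => m' ne.
rewrite mcoeffZ mcoeffX; case: eqP => [E|]; rewrite ?mulr0 //.
by case/eqP: ne; apply/val_inj/val_inj.
Qed.

Lemma mcoeff_form_poly0 (f : Pol C d n) (m : 'X_{1..n}) :
  mdeg m != d -> (form_poly f)@_m = 0.
Proof.
move=> ne; rewrite raddf_sum big1 //= => m' _; rewrite mcoeffZ mcoeffX.
case: eqP => [E|]; rewrite ?mulr0 //; case/eqP: ne; rewrite -E; exact/eqP/(valP m').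
Qed.

Lemma form_jetE f m : form_jet (f : Pol C d n) (form_jet_index m) = f m.
Proof. by rewrite ffunE mcoeff_form_poly. Qed.

Lemma form_jet0 f j : j \notin codom form_jet_index -> form_jet (f : Pol C d n) j = 0.
Proof. by rewrite codom_form_jet_index => ne; rewrite ffunE mcoeff_form_poly0. Qed.

End Forms.

Lemma dual_root_subst_inj (P : {mpoly rat[3]}) : dual_root_subst P = 0 -> P = 0.
Proof.
pose lr : (3 + 1).-tuple {mpoly rat[3]} :=
  [tuple if split l is inl i then - 'X_i else 0 | l < 3 + 1].
move=> /(congr1 (fun p => p \mPo lr)); rewrite comp_mpoly0 => <-.
rewrite /dual_root_subst comp_mpoly_comp -[LHS]comp_mpoly_id; congr (_ \mPo _).
apply: eq_from_tnth => i; rewrite !tnth_mktuple comp_mpolyB comp_mpolyZ.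
rewrite /u_class /beta /alpha !comp_mpolyXU -!tnth_nth !tnth_mktuple.
by rewrite (unsplitK (inl i)) (unsplitK (inr ord0)) scaler0 sub0r opprK.
Qed.

(** The weight of a cubic monomial is u - sum d_i alpha_i with sum d_i = 3, that
    is sum d_i (u/3 - alpha_i): this is where u/3 comes from. *)
Lemma dual_root_linear_form (M : 'X_{1..#|form_index 3 3|}) :
  dual_root_subst (linear_form rat (mon_weight (@GL_weight 3 3) M))
  = linear_form rat (mon_weight (@GLGL_weight 3 3) M).
Proof.
rewrite /mon_weight !(big_morph _ (@linear_form_is_additive _) (@linear_form0 _)).
rewrite /dual_root_subst raddf_sum /=; apply: eq_bigr => j _; rewrite !linear_formMn.
rewrite raddfMn /=; congr (_ *+ _); set m := enum_val j.
rewrite linear_form_target /linear_form raddf_sum /=.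
under eq_bigr => i _.
  rewrite comp_mpolyZ comp_mpolyXU -tnth_nth tnth_mktuple mxE scaler_int -pmulrn mulrnBl.
  over.
rewrite sumrB; congr (_ - _); rewrite sumrMnr -mdegE (eqP (valP m)) -scaler_nat scalerA.
by rewrite -[RHS]scale1r; congr (_ *: _).
Qed.

(** By [same_grading_GL] both classes come from one list of monomials, and the
    substitution carries one set of characters to the other. *)
Lemma form_class_GLGL (C : numFieldType) (X : Pol C 3 3 -> Prop) :
  eqclass (@GLGL_weight 3 3) X = dual_root_subst (form_class X).
Proof.
have posGL : positive (@GL_weight 3 3) by exists (const_mx 1); exact: GL_weight_gt0.
have posGLGL : positive (@GLGL_weight 3 3).
  by exists (target_height 3 1) => m; exact: target_weight_gt0.
have [K [HK HK']] := Kpoly_exists X posGL posGLGL (same_grading_GL (isT : (0 < 3)%N)).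
have [d [P HP]] := lowest_part_exists (weigh (@GL_weight 3 3) K).
rewrite /form_class (eqclassE posGL HK HP).
have partE e : Kpoly_part (weigh (@GLGL_weight 3 3) K) e
    = dual_root_subst (Kpoly_part (weigh (@GL_weight 3 3) K) e).
  rewrite /Kpoly_part !big_map /dual_root_subst raddf_sum; apply: eq_bigr => k _ /=.
  rewrite comp_mpolyZ rmorphXn rmorphN /=; congr (_ *: (- _) ^+ _).
  exact/esym/dual_root_linear_form.
case: HP => low PE zero.
apply: (eqclassE (d := d) posGLGL HK'); split.
- by move=> e lt_ed; rewrite partE low // /dual_root_subst comp_mpoly0.
- by rewrite partE PE.
by move=> /dual_root_subst_inj /zero E e; rewrite partE E /dual_root_subst comp_mpoly0.
Qed.

(** An indexed product over monomials splits according to their degrees. *)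
Lemma big_monomials (T : Type) (idx : T) (op : Monoid.com_law idx) (I J K : finType) n
    (a : I -> 'X_{1..n}) (b : J -> 'X_{1..n}) (c : K -> 'X_{1..n}) (P : pred I)
    (F : 'X_{1..n} -> T) :
  injective a -> injective b -> injective c ->
  (forall m, [exists i, P i && (a i == m)] = (m \in codom b) || (m \in codom c)) ->
  (forall j k, b j != c k) ->
  \big[op/idx]_(i | P i) F (a i)
    = op (\big[op/idx]_j F (b j)) (\big[op/idx]_k F (c k)).
Proof.
move=> ai bi ci H ne.
have mapE (L : finType) (g : L -> 'X_{1..n}) (Q : pred L) :
    \big[op/idx]_(i | Q i) F (g i) = \big[op/idx]_(m <- [seq g i | i <- enum Q]) F m.
  by rewrite big_map big_enum.
rewrite !mapE -big_cat; apply: perm_big; apply: uniq_perm.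
- by rewrite map_inj_uniq ?enum_uniq.
- rewrite cat_uniq (map_inj_uniq bi) (map_inj_uniq ci) !enum_uniq andbT.
  by apply/hasPn => _ /mapP[k _ ->]; apply/mapP => -[j _ E]; case/eqP: (ne j k).
move=> m; rewrite mem_cat -[RHS]H; apply/mapP/existsP => [[x]|[i /andP[Pi /eqP <-]]].
  by rewrite mem_enum => Pi ->; exists x; rewrite eqxx andbT.
by exists i; rewrite ?mem_enum.
Qed.

Lemma codom_form_monomial d n (m : 'X_{1..n}) :
  (m \in codom (fun i : form_index d n => bmnm (val i))) = (mdeg m == d).
Proof.
apply/codomP/eqP => [[i ->]|E]; first exact/eqP/(valP i).
have lt : (mdeg m < d.+1)%N by rewrite E.
by exists (exist _ (BMultinom lt) (introT eqP E)).
Qed.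

(** The cone sits in the jet space as a coordinate subspace, whose missing
    coordinates are the monomials of degree 1 and 2. *)
Theorem thom_eta (C : numFieldType) (X : Pol C 3 3 -> Prop) :
  thom (eta X) = euler_Pol 1 3 * euler_Pol 2 3 * dual_root_subst (form_class X).
Proof.
rewrite -form_class_GLGL.
have d_gt0 : (0 < 3)%N by [].
rewrite /thom -[eta X]/(ext_set (@form_jet C 3 3) X).
rewrite (@eqclass_ext C _ _ _ _ (form_jet_index d_gt0) _ _ _ _ (target_height 3 1)); first last.
- exact: jet_weight_neq0.
- by move=> j; exact: target_weight_gt0.
- exact: form_jet0.
- exact: form_jetE.
- exact: form_jet_index_inj.
congr (_ * _).
pose F (m : 'X_{1..3}) := linear_form rat (target_weight m (ord0 : 'I_1)).
rewrite /euler_Pol /euler_class -[RHS](@big_monomials _ _ _ (jet_index 3 3 1) _ _ _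
  (fun j => bmnm (val j.1)) _ _ (fun j => j \notin codom (form_jet_index d_gt0)) F).
- by apply: eq_bigr => -[m i] _; rewrite (ord1 i).
- by move=> [m i] [m' i'] /= /val_inj/val_inj ->; rewrite (ord1 i) (ord1 i').
- by move=> ? ? /val_inj/val_inj.
- by move=> ? ? /val_inj/val_inj.
- move=> m; rewrite !codom_form_monomial; apply/existsP/idP => [[j /andP[+ /eqP <-]]|].
    rewrite codom_form_jet_index; case: j => -[[m' lt_m'] m'_gt0] i /=.
    by case: (mdeg m') lt_m' m'_gt0 => [|[|[|[|k]]]].
  move=> Hm; have lt_m : (mdeg m < 4)%N by case/orP: Hm => /eqP ->.
  have m_gt0 : (0 < mdeg m)%N by case/orP: Hm => /eqP ->.
  exists (exist _ (BMultinom lt_m) m_gt0, ord0).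
  by rewrite codom_form_jet_index /= eqxx andbT; case/orP: Hm => /eqP ->.
move=> j k; apply/eqP => E; have := eqP (valP j); have := eqP (valP k); rewrite E.
by move=> -> .
Qed.

(** * Contact equivalence of cubic forms *)

Section Order.
Variables (R : comNzRingType) (n : nat).
Implicit Types p q : {mpoly R[n]}.

Definition ord_ge k p := forall m : 'X_{1..n}, (mdeg m < k)%N -> p@_m = 0.

Lemma ord_geD k p q : ord_ge k p -> ord_ge k q -> ord_ge k (p + q).
Proof. by move=> hp hq m lt; rewrite mcoeffD hp // hq // addr0. Qed.

Lemma ord_geZ k c p : ord_ge k p -> ord_ge k (c *: p).
Proof. by move=> hp m lt; rewrite mcoeffZ hp // mulr0. Qed.

Lemma ord_geM k l p q : ord_ge k p -> ord_ge l q -> ord_ge (k + l) (p * q).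
Proof.
move=> hp hq m lt; rewrite mcoeffM big1 // => -[m1 m2] /= /eqP E.
case: (ltnP (mdeg m1) k) => [lt1|le1]; first by rewrite hp // mul0r.
by have := congr1 (@mdeg n) E; rewrite mdegD => Ed; rewrite hq ?mulr0 //; lia.
Qed.

Definition same_part k p q := [/\ ord_ge k p, ord_ge k q & ord_ge k.+1 (p - q)].

Lemma same_partM k l p p' q q' :
  same_part k p q -> same_part l p' q' -> same_part (k + l) (p * p') (q * q').
Proof.
move=> [hp hq hpq] [hp' hq' hpq']; split; try exact: ord_geM.
have -> : p * p' - q * q' = (p - q) * p' + q * (p' - q') by ring.
apply: ord_geD; first by rewrite -addSn; exact: ord_geM.
by rewrite -addnS; exact: ord_geM.
Qed.

Lemma same_part1 : same_part 0 (1 : {mpoly R[n]}) 1.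
Proof. by split=> // m _; rewrite subrr mcoeff0. Qed.

Lemma same_part0 k : same_part k (0 : {mpoly R[n]}) 0.
Proof. by split=> m _; rewrite ?subrr mcoeff0. Qed.

Lemma same_partD k p p' q q' :
  same_part k p q -> same_part k p' q' -> same_part k (p + p') (q + q').
Proof.
move=> [hp hq hpq] [hp' hq' hpq']; split; try exact: ord_geD.
have -> : p + p' - (q + q') = (p - q) + (p' - q') by ring.
exact: ord_geD.
Qed.

Lemma same_partZ k c p q : same_part k p q -> same_part k (c *: p) (c *: q).
Proof.
by move=> [hp hq hpq]; split; rewrite -?scalerBr; exact: ord_geZ.
Qed.

Lemma same_partX k p q l : same_part k p q -> same_part (k * l) (p ^+ l) (q ^+ l).
Proof.
move=> h; elim: l => [|l IH]; first by rewrite muln0 !expr0; exact: same_part1.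
by rewrite mulnS !exprS; exact: same_partM.
Qed.

End Order.

Section Substitution.
Variables (C : fieldType) (n : nat).
Implicit Types (F : {mpoly C[n]}) (g h : 'M[C]_n) (a v : 'rV[C]_n).

Definition lsubst g : n.-tuple {mpoly C[n]} := [tuple linear_poly (row i g) | i < n].

Lemma linear_poly_homog a : linear_poly a \is 1.-homog.
Proof. by apply: rpred_sum => l _; rewrite rpredZ // dhomogX; apply/eqP; exact: mdeg1. Qed.

Lemma dhomog_comp d F (lq : n.-tuple {mpoly C[n]}) :
  (forall i, tnth lq i \is 1.-homog) -> F \is d.-homog -> F \mPo lq \is d.-homog.
Proof.
move=> hlq /dhomogP hF; rewrite comp_mpolyEX big_seq; apply: rpred_sum => m /hF mE.
have <- : (\sum_i m i)%N = d by rewrite -mdegE; exact: mE.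
apply: rpredZ; rewrite comp_mpolyX.
elim/big_rec2: _ => [|i k q _ hq]; first exact: dhomog1.
by apply: dhomogM => //; have := dhomogMn (m i) (hlq i); rewrite mul1n.
Qed.

Lemma lsubst_homog d F g : F \is d.-homog -> F \mPo lsubst g \is d.-homog.
Proof. by apply: dhomog_comp => i; rewrite tnth_mktuple linear_poly_homog. Qed.

Lemma linear_poly_lsubst a g : linear_poly a \mPo lsubst g = linear_poly (a *m g).
Proof.
rewrite /linear_poly raddf_sum /=.
under eq_bigr do rewrite comp_mpolyZ comp_mpolyXU -tnth_nth tnth_mktuple scaler_sumr.
rewrite exchange_big; apply: eq_bigr => j _.
by rewrite mxE scaler_suml; apply: eq_bigr => i _; rewrite !mxE scalerA.
Qed.

Lemma lsubst_comp F g h : (F \mPo lsubst g) \mPo lsubst h = F \mPo lsubst (g *m h).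
Proof.
rewrite comp_mpoly_comp; congr (_ \mPo _); apply: eq_from_tnth => i.
by rewrite !tnth_mktuple linear_poly_lsubst row_mul.
Qed.

Lemma lsubst1 F : F \mPo lsubst 1%:M = F.
Proof.
rewrite -[RHS]comp_mpoly_id; congr (_ \mPo _); apply: eq_from_tnth => i.
rewrite !tnth_mktuple /linear_poly (bigD1 i) //= !mxE eqxx scale1r big1 ?addr0 //.
by move=> j /negPf ne; rewrite !mxE eq_sym ne scale0r.
Qed.

Lemma lsubstK F g : g \in unitmx -> (F \mPo lsubst g) \mPo lsubst (invmx g) = F.
Proof. by move=> gu; rewrite lsubst_comp mulmxV // lsubst1. Qed.

Lemma lsubstVK F g : g \in unitmx -> (F \mPo lsubst (invmx g)) \mPo lsubst g = F.
Proof. by move=> gu; rewrite lsubst_comp mulVmx // lsubst1. Qed.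

(** A linear change of variables by a scalar c multiplies forms of degree d by
    c ^ d. With d-th roots available, target scalars become source scalars. *)
Lemma lsubst_scale d F g c : F \is d.-homog ->
  F \mPo lsubst (c *: g) = c ^+ d *: (F \mPo lsubst g).
Proof.
move=> /dhomogP hF; rewrite [LHS]comp_mpolyEX [in RHS]comp_mpolyEX scaler_sumr.
rewrite big_seq [RHS]big_seq; apply: eq_bigr => m /hF mE.
rewrite scalerA mulrC -scalerA; congr (_ *: _); rewrite !comp_mpolyX.
have <- : (\sum_i m i)%N = d by rewrite -mdegE; exact: mE.
rewrite -prodrXr -scaler_prod; apply: eq_bigr => i _.
rewrite !tnth_mktuple -exprZn; congr (_ ^+ _).
by rewrite /linear_poly scaler_sumr; apply: eq_bigr => j _; rewrite !mxE scalerA.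
Qed.

Local Notation eval_at F v := (F.@[fun i => (v : 'rV[C]_n) 0 i]).

Lemma eval_linear_poly a v : eval_at (linear_poly a) v = (a *m v^T) 0 0.
Proof.
rewrite /linear_poly raddf_sum mxE; apply: eq_bigr => i _ /=.
by rewrite mevalZ mevalXU !mxE.
Qed.

Lemma eval_lsubst F g v : eval_at (F \mPo lsubst g) v = eval_at F (v *m g^T).
Proof.
rewrite comp_mpoly_meval; apply: meval_eq => i.
rewrite tnth_mktuple eval_linear_poly -row_mul mxE -[v in RHS]trmxK -trmx_mul.
by rewrite !mxE.
Qed.

Lemma mderivXU (i j : 'I_n) : mderiv i 'X_j = (j == i)%:R :> {mpoly C[n]}.
Proof.
rewrite mderivX mnm1E; case: eqP => [->|_]; last by rewrite scale0r.
by rewrite scale1r -mpolyX0; congr 'X_[_]; apply/mnmP => l; rewrite mnmBE subnn mnm0E.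
Qed.

(** Chain rule: both sides are derivations in F along the substitution, so it
    is enough to compare them on variables. *)
Lemma mderiv_comp i F (lq : n.-tuple {mpoly C[n]}) :
  mderiv i (F \mPo lq) = \sum_j (mderiv j F \mPo lq) * mderiv i (tnth lq j).
Proof.
pose chain G := mderiv i (G \mPo lq) = \sum_j (mderiv j G \mPo lq) * mderiv i (tnth lq j).
have chainM G H : chain G -> chain H -> chain (G * H).
  rewrite /chain rmorphM /= mderivM => -> ->.
  rewrite mulr_suml mulr_sumr -big_split; apply: eq_bigr => j _ /=.
  rewrite mderivM rmorphD !rmorphM /= mulrDl. 
  by congr (_ + _); [exact: mulrAC | exact: mulrA].
have chain1 : chain 1.
  rewrite /chain comp_mpoly1 -mpolyC1 mderivC big1 // => j _.
  by rewrite mderivC comp_mpoly0 mul0r.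
have chainX m : chain 'X_[m].
  rewrite mpolyXE_id; elim/big_rec: _ => [|j G _ hG]; first exact: chain1.
  apply: (chainM _ _ _ hG).
  elim: (m j) => [|k IH]; first by rewrite expr0; exact: chain1.
  rewrite exprS; apply: (chainM _ _ _ IH).
  rewrite /chain comp_mpolyXU -tnth_nth (bigD1 j) //= big1 => [|l ne].
    by rewrite mderivXU eqxx comp_mpoly1 mul1r addr0.
  by rewrite mderivXU eq_sym (negPf ne) comp_mpoly0 mul0r.
rewrite [F]mpolyE; elim/big_rec: _ => [|m G _ hG].
  rewrite comp_mpoly0 mderiv0 big1 // => j _.
  by rewrite mderiv0 comp_mpoly0 mul0r.
rewrite comp_mpolyD comp_mpolyZ mderivD mderivZ hG chainX scaler_sumr -big_split.
apply: eq_bigr => j _ /=.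
by rewrite mderivD mderivZ comp_mpolyD comp_mpolyZ mulrDl scalerAl.
Qed.

Lemma mderiv_linear_poly i a : mderiv i (linear_poly a) = (a 0 i)%:MP.
Proof.
rewrite /linear_poly raddf_sum (bigD1 i) //= big1 => [|l ne].
  by rewrite mderivZ mderivXU eqxx addr0 -mul_mpolyC mulr1.
by rewrite mderivZ mderivXU (negPf ne) scaler0.
Qed.

Lemma mderiv_lsubst i F g :
  mderiv i (F \mPo lsubst g) = \sum_j g j i *: (mderiv j F \mPo lsubst g).
Proof.
rewrite mderiv_comp; apply: eq_bigr => j _.
by rewrite tnth_mktuple mderiv_linear_poly !mxE mulrC mul_mpolyC.
Qed.

End Substitution.

Section ContactClosure.
Variables (C : numFieldType) (d n : nat).
Hypothesis d_gt0 : (0 < d)%N.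
Hypothesis C_roots : forall c : C, exists z, z ^+ d = c.

Lemma form_poly_homog (f : Pol C d n) : form_poly f \is d.-homog.
Proof.
by apply: rpred_sum => m _; rewrite rpredZ // dhomogX; exact: (valP m).
Qed.

Lemma mcoeff_jet_poly (h : jet C d n 1) (i : jet_index d n 1) :
  (jet_poly h ord0)@_(bmnm (val i.1)) = h i.
Proof.
case: i => m i; rewrite /= (ord1 i) raddf_sum (bigD1 m) //= mcoeffZ mcoeffX eqxx mulr1.
rewrite big1 ?addr0 // => m' ne; rewrite mcoeffZ mcoeffX; case: eqP => [E|]; rewrite ?mulr0 //.
by case/eqP: ne; apply/val_inj/val_inj.
Qed.

Lemma mcoeff_jet_poly0 (h : jet C d n 1) (m : 'X_{1..n}) j :
  ~~ (0 < mdeg m < d.+1)%N -> (jet_poly h j)@_m = 0.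
Proof.
move=> ne; rewrite raddf_sum big1 // => m' _ /=; rewrite mcoeffZ mcoeffX.
case: eqP => [E|]; rewrite ?mulr0 //; case/negP: ne; rewrite -E.
by rewrite (valP m') /= bmdeg.
Qed.

Lemma jet_poly_form_jet (f : Pol C d n) j : jet_poly (form_jet f) j = form_poly f.
Proof.
rewrite (ord1 j); apply/mpolyP => m; case: (boolP (0 < mdeg m < d.+1)%N) => [/andP[m_gt0 lt_m]|ne].
  pose i : jet_index d n 1 :=
    (exist (fun m : 'X_{1..n < d.+1} => (0 < mdeg m)%N) (BMultinom lt_m) m_gt0, ord0).
  by have := mcoeff_jet_poly (form_jet f) i; rewrite /= => ->; rewrite ffunE.
rewrite mcoeff_jet_poly0 //; case: (eqVneq (mdeg m) d) => [E|ne']; last by rewrite mcoeff_form_poly0.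
by case/negP: ne; rewrite E d_gt0 /=.
Qed.

Lemma form_poly_subst (g : 'M[C]_n) (f : Pol C d n) :
  form_poly (form_subst g f) = form_poly f \mPo lsubst g.
Proof.
have hom := lsubst_homog g (form_poly_homog f).
apply/mpolyP => m; case: (eqVneq (mdeg m) d) => [E|ne].
  have lt : (mdeg m < d.+1)%N by rewrite E.
  have := mcoeff_form_poly (form_subst g f) (exist _ (BMultinom lt) (introT eqP E)).
  by rewrite /= ffunE.
rewrite mcoeff_form_poly0 //; apply/esym/memN_msupp_eq0/negP => /(dhomog_mf hom) /eqP.
by rewrite (negPf ne).
Qed.

Definition linear_part (phi : n.-tuple {mpoly C[n]}) : 'M[C]_n :=
  \matrix_(i, j) (tnth phi i)@_U_(j)%MM.

Lemma same_part_linear (phi : n.-tuple {mpoly C[n]}) i : (tnth phi i)@_0%MM = 0 ->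
  same_part 1 (tnth phi i) (tnth (lsubst (linear_part phi)) i).
Proof.
move=> phi0.
have linE (m : 'X_{1..n}) : (tnth (lsubst (linear_part phi)) i)@_m
    = \sum_j linear_part phi i j * (U_(j)%MM == m)%:R.
  rewrite tnth_mktuple /linear_poly raddf_sum; apply: eq_bigr => j _ /=.
  by rewrite mcoeffZ mcoeffX !mxE.
have lin0 : (tnth (lsubst (linear_part phi)) i)@_0%MM = 0.
  by rewrite linE big1 // => j _; rewrite mnm1_eq0 mulr0.
split.
- by move=> m; rewrite ltnS leqn0 mdeg_eq0 => /eqP ->.
- by move=> m; rewrite ltnS leqn0 mdeg_eq0 => /eqP ->.
move=> m; rewrite ltnS leq_eqVlt => /orP[|].
  rewrite mdeg_eq1 => /existsP[j /eqP ->]; rewrite mcoeffB linE (bigD1 j) //= eqxx mulr1.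
  rewrite big1 ?addr0 => [|l ne]; first by rewrite mxE subrr.
  by rewrite eq_mnm1 (negPf ne) mulr0.
by rewrite ltnS leqn0 mdeg_eq0 => /eqP ->; rewrite mcoeffB phi0 lin0 subrr.
Qed.

(** Only the linear part of a coordinate change acts on the lowest degree
    part. *)
Lemma same_part_comp F (phi : n.-tuple {mpoly C[n]}) :
  F \is d.-homog -> (forall i, (tnth phi i)@_0%MM = 0) ->
  same_part d (F \mPo phi) (F \mPo lsubst (linear_part phi)).
Proof.
move=> /dhomogP hF phi0; rewrite [F \mPo phi]comp_mpolyEX [F \mPo lsubst _]comp_mpolyEX.
rewrite big_seq [X in same_part _ _ X]big_seq.
elim/big_rec2: _ => [|m p q /hF mE hpq]; first exact: same_part0.
apply: same_partD => //; apply: same_partZ; rewrite !comp_mpolyX.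
have <- : (\sum_i m i)%N = d by rewrite -mdegE; exact: mE.
elim/big_ind3: _ => [|k p' q' k' p'' q'' hp' hp''|i _]; first exact: same_part1.
  exact: same_partM.
by have := same_partX (m i) (same_part_linear (phi0 i)); rewrite mul1n.
Qed.

(** Modulo higher order, the contact group acts on forms of degree d through the
    linear part of phi and the constant c of M; a d-th root of c can be
    absorbed in the linear part, so orbits of forms stay in an invariant
    cone. *)
Lemma contact_equiv_eta (X : Pol C d n -> Prop) f g :
  GL_invariant X -> X f -> contact_equiv (form_jet f) g ->
  exists2 f', X f' & g = form_jet f'.
Proof.
move=> inv Xf [phi [M [phi0 lin_unit M_unit ->]]].
set c := (M ord0 ord0)@_0%MM.
have c_nz : c != 0.
  by move: M_unit; rewrite unitmxE det_mx11 mxE unitfE.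
have [z zE] := C_roots c.
have z_nz : z != 0 by apply: contraNneq c_nz => E; rewrite -zE E expr0n eqn0Ngt d_gt0.
have z_unit : z *: linear_part phi \in unitmx by rewrite unitmxZ ?unitfE.
(* z ^ d = c turns the target scalar into a source scalar *)
exists (form_subst (z *: linear_part phi) f); first exact: inv.
apply/ffunP => i; rewrite !ffunE big_ord1 (ord1 i.2) form_poly_subst.
rewrite (lsubst_scale _ _ (form_poly_homog f)) zE jet_poly_form_jet.
have [_ _ sp] := same_part_comp (form_poly_homog f) phi0.
have spM : same_part 0 (M ord0 ord0) c%:MP.
  split=> // m; rewrite ltnS leqn0 mdeg_eq0 => /eqP ->.
  by rewrite mcoeffB mcoeffC eqxx mulr1 subrr.
have [_ _] := same_partM spM (same_part_comp (form_poly_homog f) phi0).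
rewrite add0n => /(_ (bmnm (val i.1))); rewrite bmdeg => /(_ isT) /eqP.
by rewrite mcoeffB subr_eq0 mul_mpolyC => /eqP.
Qed.

Lemma contact_equiv_refl (h : jet C d n 1) : contact_equiv h h.
Proof.
exists [tuple 'X_i | i < n], 1%:M; split.
- by move=> i; rewrite tnth_mktuple mcoeffX mnm1_eq0.
- suff -> : \matrix_(i, j) (tnth [tuple 'X_i | i < n] i)@_U_(j)%MM = 1%:M :> 'M[C]_n.
    exact: unitmx1.
  by apply/matrixP => i j; rewrite !mxE tnth_mktuple mcoeffXU.
- suff -> : \matrix_(i, j) ((1%:M : 'M[{mpoly C[n]}]_1) i j)@_0%MM = 1%:M :> 'M[C]_1.
    exact: unitmx1.
  by apply/matrixP => i j; rewrite !mxE !(ord1 i) !(ord1 j) eqxx mcoeff1 eqxx.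
apply/ffunP => i; rewrite ffunE big_ord1 mxE (ord1 i.2) eqxx mul1r comp_mpoly_id.
by rewrite mcoeff_jet_poly.
Qed.

Lemma zclosure_mono (I : finType) (X Y : {ffun I -> C} -> Prop) x :
  (forall x, X x -> Y x) -> zclosure X x -> zclosure Y x.
Proof. by move=> XY Hx p Yp; apply: Hx => y /XY /Yp. Qed.

Lemma sub_zclosure (I : finType) (X : {ffun I -> C} -> Prop) x : X x -> zclosure X x.
Proof. by move=> Xx p; exact. Qed.

End ContactClosure.

Section TernaryClosure.
Variable C : numFieldType.
Hypothesis C_roots : forall c : C, exists z, z ^+ 3 = c.

Lemma add_squares0 (h : jet C 3 3 1) : add_squares 0 h = h :> jet C 3 3 1.
Proof.
apply/ffunP => i; rewrite ffunE big_ord0 addr0.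
have -> : [tuple 'X_(lshift 0 l) | l < 3] = [tuple 'X_l | l < 3] :> 3.-tuple {mpoly C[3]}.
  apply: eq_from_tnth => l; rewrite !tnth_mktuple.
  by congr 'X_[U_(_)]; apply: val_inj.
by rewrite comp_mpoly_id (ord1 i.2) mcoeff_jet_poly.
Qed.

(** For zero added squares, the closure of contact orbits is already reached:
    [eta X] is closed and stable under contact equivalence. *)
Lemma quad_unfolding0 (X : Pol C 3 3 -> Prop) : zclosed X -> GL_invariant X ->
  quad_unfolding 0 (eta X) = eta X :> (jet C 3 3 1 -> Prop).
Proof.
move=> closedX inv; apply: functional_extensionality => g.
apply: propositional_extensionality.
have d_gt0 : (0 < 3)%N by [].
split; last first.
  move=> Xg; apply: sub_zclosure; exists g; last exact: contact_equiv_refl.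
  by exists g => //; rewrite -[LHS]add_squares0.
have closed_eta : zclosed (ext_set (@form_jet C 3 3) X).
  exact: (zclosed_ext (@form_jetE 3 3 d_gt0 C) (@form_jet0 3 3 d_gt0 C) closedX).
move=> Hg; apply: closed_eta; apply: zclosure_mono Hg => g' [h [h0 [f Xf ->]]].
rewrite -[add_squares 0 _]/(add_squares 0 (form_jet f) : jet C 3 3 1) add_squares0 => -> eqv.
exact: contact_equiv_eta eqv.
Qed.

End TernaryClosure.

(** * Invariance of the strata *)

Section ClosureInvariant.
Variables (C : numFieldType) (d n : nat).
Hypothesis d_gt0 : (0 < d)%N.

(** A polynomial in the coefficients of g.h is a polynomial in the coefficients
    of h, so that functions vanishing on X pull back along g. *)
Lemma zclosure_GL_invariant (X : Pol C d n -> Prop) :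
  GL_invariant X -> GL_invariant (zclosure X).
Proof.
move=> inv g f gu clf p Xp.
pose lq := [tuple \sum_(j < #|form_index d n|)
   ('X_[bmnm (val (enum_val j))] \mPo lsubst g)@_(bmnm (val (enum_val i))) *: 'X_j
   | i < #|form_index d n|] : _.-tuple {mpoly C[#|form_index d n|]}.
have lqE h : peval h (p \mPo lq) = peval (form_subst g h) p.
  rewrite /peval comp_mpoly_meval; apply: meval_eq => i.
  rewrite tnth_mktuple ffunE -/(lsubst g).
  have -> : form_poly h
      = \sum_(j < #|form_index d n|) h (enum_val j) *: 'X_[bmnm (val (enum_val j))].
    rewrite /form_poly (reindex_onto (fun j : 'I_#|form_index d n| => enum_val j) enum_rank) /=.
      by apply: eq_bigl => j; rewrite enum_valK eqxx.
    by move=> m _; rewrite enum_rankK.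
  rewrite (raddf_sum (comp_mpoly (lsubst g))) !raddf_sum /=; apply: eq_bigr => j _.
  by rewrite mevalZ mevalXU comp_mpolyZ mcoeffZ mulrC.
by rewrite -lqE; apply: clf => h Xh; rewrite lqE; apply: Xp; exact: inv.
Qed.

End ClosureInvariant.

Lemma zclosed_zclosure (C : fieldType) (I : finType) (X : {ffun I -> C} -> Prop) :
  zclosed (zclosure X).
Proof. by move=> x Hx p Xp; apply: Hx => y; apply. Qed.

Section StrataInvariant.
Variable C : numFieldType.
Local Notation form := {mpoly C[3]}.
Local Notation eval_at F v := (F.@[fun i => (v : 'rV[C]_3) 0 i]).
Variable g : 'M[C]_3.
Hypothesis gu : g \in unitmx.
Implicit Types (F q : form) (v a : 'rV[C]_3).

Let gtu : g^T \in unitmx. Proof. by rewrite unitmx_tr. Qed.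

Lemma singular_point_lsubst F v :
  singular_point (F \mPo lsubst g) v <-> singular_point F (v *m g^T).
Proof.
have v0 : (v *m g^T == 0) = (v == 0).
  apply/eqP/eqP => [E|->]; last by rewrite mul0mx.
  by rewrite -[v](mulmxK gtu) E mul0mx.
pose D := \row_j eval_at (mderiv j F) (v *m g^T).
have dE i : eval_at (mderiv i (F \mPo lsubst g)) v = (D *m g) 0 i.
  rewrite mderiv_lsubst (raddf_sum (meval _)) mxE /=; apply: eq_bigr => j _.
  by rewrite mevalZ eval_lsubst mxE mulrC.
rewrite /singular_point v0 eval_lsubst.
split=> -[-> -> Hd]; split=> //.
  have D0 : D = 0.
    rewrite -[D](mulmxK gu); suff -> : D *m g = 0 by rewrite mul0mx.
    by apply/rowP => i; rewrite -dE Hd mxE.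
  by move=> i; have /rowP/(_ i) := D0; rewrite !mxE.
move=> i; rewrite dE; suff -> : D = 0 by rewrite mul0mx mxE.
by apply/rowP => j; rewrite !mxE Hd.
Qed.

(** The Hessian of a form transforms by congruence. *)
Lemma rank_hessian_lsubst F v :
  \rank (hessian (F \mPo lsubst g) v) = \rank (hessian F (v *m g^T)).
Proof.
suff -> : hessian (F \mPo lsubst g) v = g^T *m hessian F (v *m g^T) *m g.
  by rewrite mxrankMfree ?row_free_unit // eqmxMfull // row_full_unit.
apply/matrixP => i j; rewrite [LHS]mxE mderiv_lsubst (raddf_sum (mderiv i)) (raddf_sum (meval _)) [RHS]mxE /=.
apply: eq_bigr => k _; rewrite mderivZ mevalZ mderiv_lsubst (raddf_sum (meval _)) /= mxE mulrC.
congr (_ * _); apply: eq_bigr => l _.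
by rewrite mevalZ eval_lsubst !mxE.
Qed.

Lemma msize_lsubst F : (msize (F \mPo lsubst g) <= 1)%N = (msize F <= 1)%N.
Proof.
have const (G : form) (h : 'M[C]_3) : (msize G <= 1)%N -> (msize (G \mPo lsubst h) <= 1)%N.
  by move=> /msize1_polyC ->; rewrite comp_mpolyC msizeC leq_b1.
by apply/idP/idP => [/(const _ (invmx g))|]; [rewrite lsubstK|exact: const].
Qed.

Lemma mirreducible_lsubst F : mirreducible F -> mirreducible (F \mPo lsubst g).
Proof.
move=> [F1 irr]; split; first by rewrite ltnNge msize_lsubst -ltnNge.
move=> G H E; have := irr (G \mPo lsubst (invmx g)) (H \mPo lsubst (invmx g)).
rewrite -rmorphM /= -E lsubstK // => /(_ erefl).
by rewrite -(msize_lsubst (G \mPo _)) -(msize_lsubst (H \mPo _)) !lsubstVK.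
Qed.

Lemma rank_mul_unit m (A : 'M[C]_(m, 3)) (h : 'M[C]_3) :
  h \in unitmx -> \rank (A *m h) = \rank A.
Proof. by move=> hu; rewrite mxrankMfree ?row_free_unit. Qed.

Lemma conic_and_line_lsubst F a q : conic_and_line F a q ->
  conic_and_line (F \mPo lsubst g) (a *m g) (q \mPo lsubst g).
Proof.
move=> [a_nz q2 irr ->]; split.
- by apply: contraNneq a_nz => E; rewrite -[a](mulmxK gu) E mul0mx.
- exact: lsubst_homog.
- exact: mirreducible_lsubst.
by rewrite rmorphM /= linear_poly_lsubst.
Qed.

(** The two points move by the inverse transpose of the change of variables of
    forms. *)
Lemma meet_lsubst a q :
  meet_in_two_points (a *m g) (q \mPo lsubst g) <-> meet_in_two_points a q.
Proof.
have rk (v1 v2 : 'rV[C]_3) h : h \in unitmx ->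
    \rank (col_mx (v1 *m h) (v2 *m h)) = \rank (col_mx v1 v2).
  by move=> hu; rewrite -mul_col_mx rank_mul_unit.
split=> -[v1 [v2 [rk12 ls qs]]].
  exists (v1 *m g^T), (v2 *m g^T); split; first by rewrite rk.
    by move: ls; rewrite -linear_poly_lsubst !eval_lsubst.
  by move: qs; rewrite !eval_lsubst.
exists (v1 *m invmx g^T), (v2 *m invmx g^T); split; first by rewrite rk ?unitmx_inv.
  by rewrite -linear_poly_lsubst !eval_lsubst !mulmxKV.
by rewrite !eval_lsubst !mulmxKV.
Qed.

Lemma lines_lsubst F (A : 'M[C]_3) : lines F A -> lines (F \mPo lsubst g) (A *m g).
Proof.
move=> [rk ->]; split=> [i j ne|]; last first.
  rewrite rmorph_prod /=; apply: eq_bigr => i _.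
  by rewrite linear_poly_lsubst row_mul.
by rewrite !row_mul -mul_col_mx rank_mul_unit // rk.
Qed.

Lemma in_stratum_lsubst s F : in_stratum s F -> in_stratum s (F \mPo lsubst g).
Proof.
have sing v : singular_point F v -> singular_point (F \mPo lsubst g) (v *m invmx g^T).
  by move=> Fv; apply/singular_point_lsubst; rewrite mulmxKV.
case: s => /=.
- by move=> H v /singular_point_lsubst; exact: H.
- move=> [/mirreducible_lsubst irr [v /sing Fv rk]]; split=> //.
  by exists (v *m invmx g^T); rewrite // rank_hessian_lsubst mulmxKV.
- move=> [/mirreducible_lsubst irr [v /sing Fv rk]]; split=> //.
  by exists (v *m invmx g^T); rewrite // rank_hessian_lsubst mulmxKV.
- move=> [a [q [/conic_and_line_lsubst H /meet_lsubst meet]]].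
  by exists (a *m g), (q \mPo lsubst g).
- move=> [a [q [/conic_and_line_lsubst H nmeet]]].
  by exists (a *m g), (q \mPo lsubst g); split=> // /meet_lsubst.
- by move=> [A /lines_lsubst H rk]; exists (A *m g); rewrite // rank_mul_unit.
by move=> [A /lines_lsubst H rk]; exists (A *m g); rewrite // rank_mul_unit.
Qed.

End StrataInvariant.

Lemma stratum_closure_invariant (C : numFieldType) s :
  GL_invariant (@stratum_closure C s).
Proof.
apply: zclosure_GL_invariant => g f gu Hf.
by rewrite form_poly_subst; exact: in_stratum_lsubst.
Qed.

(** * Generating series of Q-polynomials *)

Section Truncation.
Variable A : comNzRingType.
Implicit Types p q : {poly A}.

(** Computations with power series are done with polynomials up to a degree. *)
Definition eq_upto d p q := forall k, (k <= d)%N -> p`_k = q`_k.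

Lemma eq_upto_refl d p : eq_upto d p p.
Proof. by []. Qed.

Lemma eq_uptoM d p p' q q' : eq_upto d p q -> eq_upto d p' q' -> eq_upto d (p * p') (q * q').
Proof.
move=> h h' k lek; rewrite !coefM; apply: eq_bigr => i _.
have lei : (i <= k)%N by rewrite -ltnS.
by rewrite h ?h' //; apply: leq_trans lek => //; exact: leq_subr.
Qed.

Lemma eq_upto_prod (I : Type) (s : seq I) d (F G : I -> {poly A}) :
  (forall i, eq_upto d (F i) (G i)) -> eq_upto d (\prod_(i <- s) F i) (\prod_(i <- s) G i).
Proof.
by move=> h; elim/big_rec2: _ => [|i p q _ hpq]; [exact: eq_upto_refl|exact: eq_uptoM].
Qed.

Definition geom (y : A) N : {poly A} := \sum_(k < N.+1) y ^+ k *: 'X^k.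

Lemma coef_geom y N k : (geom y N)`_k = if (k <= N)%N then y ^+ k else 0.
Proof.
rewrite coef_sum; under eq_bigr do rewrite coefZ coefXn.
case: leqP => [lek|ltk].
  rewrite (bigD1 (Ordinal (lek : (k < N.+1)%N))) //= eqxx mulr1 big1 ?addr0 // => i.
  by rewrite -val_eqE eq_sym /= => /negPf ->; rewrite mulr0.
rewrite big1 // => i _; rewrite gtn_eqF ?mulr0 //.
by apply: leq_ltn_trans ltk; rewrite -ltnS.
Qed.

Lemma geom_inv y N : eq_upto N (geom y N * (1 - y *: 'X)) 1.
Proof.
move=> k lek; rewrite mulrBr mulr1 -scalerAr coefB coefZ coefMX coef1 !coef_geom lek.
case: k lek => [|k] lek /=; first by rewrite mulr0 subr0 expr0.
by rewrite (ltnW lek) exprS subrr.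
Qed.

Variables (n : nat) (y : 'I_n -> A).

(** The series prod (1 + y_j z) / (1 - y_j z), each geometric series being
    truncated after degree N. *)
Definition qser N : {poly A} := \prod_(j < n) ((1 + y j *: 'X) * geom (y j) N).

Definition qcoef d := (qser d)`_d.

Lemma qserE N d : (d <= N)%N -> (qser N)`_d = qcoef d.
Proof.
move=> led; apply: (@eq_upto_prod _ _ d) => // j; apply: eq_uptoM => // k lek.
by rewrite !coef_geom lek (leq_trans lek led).
Qed.

Lemma qser_recurrence N :
  eq_upto N (qser N * \prod_(j < n) (1 - y j *: 'X)) (\prod_(j < n) (1 + y j *: 'X)).
Proof.
rewrite -big_split /=; apply: eq_upto_prod => j; rewrite -mulrA.
rewrite -[X in eq_upto _ _ X]mulr1; apply: eq_uptoM => //; exact: geom_inv.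
Qed.

Lemma qcoef0 : qcoef 0 = 1.
Proof.
rewrite /qcoef coef0_prod big1 // => j _.
by rewrite coef0M coefD coef1 coefZ coefX mulr0 addr0 coef_geom expr0 mulr1.
Qed.

Definition reflected p q := forall k, q`_k = (-1) ^+ k * p`_k.

Lemma reflectedM p p' q q' : reflected p q -> reflected p' q' -> reflected (p * p') (q * q').
Proof.
move=> h h' k; rewrite !coefM mulr_sumr; apply: eq_bigr => i _.
rewrite h h' mulrACA -exprD subnKC //; by rewrite -ltnS.
Qed.

(** The relation q(z) q(-z) = 1. *)
Lemma qcoef_reflection m : (0 < m)%N ->
  \sum_(i < m.+1) (-1) ^+ i * qcoef i * qcoef (m - i) = 0.
Proof.
move=> m_gt0.
pose q' := \prod_(j < n) ((1 + (- y j) *: 'X) * geom (- y j) m).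
have refl : reflected (qser m) q'.
  rewrite /qser /q'; elim/big_rec2: _ => [|j p q _ hpq].
    by move=> k; rewrite coef1; case: k => [|k]; rewrite ?mulr0 ?mulr1 ?expr0.
  apply: reflectedM => //; apply: reflectedM => k.
    by rewrite !coefD !coefZ coef1 coefX; case: k => [|[|k]] /=; ring.
  by rewrite !coef_geom; case: leqP => _; rewrite ?mulr0 // -[- y j]mulN1r exprMn.
have prod1 : eq_upto m (q' * qser m) 1.
  rewrite /q' /qser -big_split /=.
  have E1 : 1 = \prod_(j < n) (1 : {poly A}) by rewrite big1.
  rewrite [X in eq_upto _ _ X]E1; apply: eq_upto_prod => j.
  have -> : (1 + - y j *: 'X) * geom (- y j) m * ((1 + y j *: 'X) * geom (y j) m)
      = geom (y j) m * (1 - y j *: 'X) * (geom (- y j) m * (1 - (- y j) *: 'X)).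
    by rewrite !scaleNr opprK; ring.
  by rewrite -[X in eq_upto _ _ X]mulr1; apply: eq_uptoM; exact: geom_inv.
have := prod1 m (leqnn m); rewrite coef1 (gtn_eqF m_gt0) coefM => E; apply: etrans (E).
apply: eq_bigr => i _; have lei : (i <= m)%N by rewrite -ltnS.
by rewrite refl !qserE // leq_subr.
Qed.

End Truncation.

Lemma map_qcoef (A B : comNzRingType) (f : {rmorphism A -> B}) n (y : 'I_n -> A) d :
  f (qcoef y d) = qcoef (fun j => f (y j)) d.
Proof.
suff E : map_poly f (qser y d) = qser (fun j => f (y j)) d by rewrite /qcoef -E coef_map.
rewrite /qser rmorph_prod; apply: eq_bigr => j _ /=; rewrite rmorphM rmorphD rmorph1 /= map_polyZ map_polyX; congr (_ * _).
rewrite /geom rmorph_sum /=; apply: eq_bigr => k _.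
by rewrite map_polyZ /= rmorphXn map_polyXn.
Qed.

Lemma Qgen_qcoef (R : comNzRingType) n d : Qgen R n d = qcoef (fun j => 'X_j) d.
Proof. by []. Qed.

(** Stability: variables set to 0 contribute the factor 1. *)
Lemma qcoef_restrict (A : comNzRingType) m n (y : 'I_m -> A) (z : 'I_n -> A) d
    (le_nm : (n <= m)%N) :
  (forall i, y (widen_ord le_nm i) = z i) ->
  (forall j : 'I_m, (n <= j)%N -> y j = 0) ->
  qcoef y d = qcoef z d.
Proof.
move=> yz y0; rewrite /qcoef /qser.
have -> : \prod_(j < m) ((1 + y j *: 'X) * geom (y j) d)
    = \prod_(j < m | (j < n)%N) ((1 + y j *: 'X) * geom (y j) d).
  rewrite (bigID (fun j : 'I_m => (j < n)%N)) /= [X in _ * X]big1 ?mulr1 // => j.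
  rewrite -leqNgt => /y0 ->; rewrite scale0r addr0 mul1r.
  apply/polyP => k; rewrite coef_geom coef1.
  by case: k => [|k]; rewrite ?expr0 // expr0n; case: ifP.
by rewrite (big_ord_narrow le_nm); under eq_bigr do rewrite yz.
Qed.

Section Pairing.
Variables (A : comNzRingType) (q : nat -> A).
Hypothesis q0 : q 0%N = 1.

(** Q_(i, j) for an arbitrary sequence q in place of the Q_i. *)
Definition pairing (i j : nat) : A :=
  q i * q j + (\sum_(1 <= s < j.+1) (-1) ^+ s * q (i + s)%N * q (j - s)%N) *+ 2.

Lemma pairing0 a : pairing a 0 = q a.
Proof. by rewrite /pairing q0 mulr1 big_geq ?mul0rn ?addr0. Qed.

Lemma pairingS a b : pairing a b.+1 = q a * q b.+1 - q a.+1 * q b - pairing a.+1 b.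
Proof.
rewrite /pairing big_ltn // big_add1 /= expr1 addn1 subn1 /=.
have -> : \sum_(1 <= i < b.+1) (-1) ^+ i.+1 * q (a + i.+1)%N * q (b.+1 - i.+1)%N
    = - \sum_(1 <= s < b.+1) (-1) ^+ s * q (a.+1 + s)%N * q (b - s)%N.
  rewrite -sumrN; apply: eq_bigr => i _.
  by rewrite addSnnS subSS exprS !mulN1r !mulNr.
set S := \sum_(_ <= _ < _) _; rewrite !mulr2n; ring.
Qed.

(** The relation in degree 2 m coming from q(z) q(-z) = 1, halved. *)
Lemma pairing_diag m :
  \sum_(i < (m + m).+1) (-1) ^+ i * q i * q (m + m - i)%N = 0 -> pairing m m = 0.
Proof.
rewrite -(big_mkord xpredT (fun i => (-1) ^+ i * q i * q (m + m - i)%N)).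
rewrite (big_cat_nat (n := m)) //=; last by rewrite leqW // leq_addr.
rewrite [X in _ + X]big_ltn ?ltnS ?leq_addr // addKn.
have -> : \sum_(0 <= i < m) (-1) ^+ i * q i * q (m + m - i)%N
    = (-1) ^+ m * \sum_(1 <= s < m.+1) (-1) ^+ s * q (m + s)%N * q (m - s)%N.
  rewrite big_nat_rev /= add0n [in RHS]big_add1 /= mulr_sumr.
  rewrite big_nat [RHS]big_nat; apply: eq_bigr => i /= lt_im.
  have -> : (m + m - (m - i.+1) = m + i.+1)%N by lia.
  rewrite !mulrA -exprD.
  have -> : (-1) ^+ (m - i.+1) = (-1) ^+ (m + i.+1) :> A.
    by rewrite -signr_odd -[RHS]signr_odd oddB // oddD.
  by rewrite mulrAC.
have -> : \sum_(m.+1 <= i < (m + m).+1) (-1) ^+ i * q i * q (m + m - i)%N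
    = (-1) ^+ m * \sum_(1 <= s < m.+1) (-1) ^+ s * q (m + s)%N * q (m - s)%N.
  rewrite (big_addn 1 (m + m).+1 m) -addSn addnK mulr_sumr; apply: eq_bigr => i _.
  by rewrite [(i + m)%N]addnC subnDl !mulrA -exprD.
rewrite /pairing; set S := \sum_(_ <= _ < _) _ => E.
have sq : (-1) ^+ m * (-1) ^+ m = 1 :> A by rewrite -exprD addnn -mul2n exprM sqrrN !expr1n.
have : (-1) ^+ m * ((-1) ^+ m * S + ((-1) ^+ m * q m * q m + (-1) ^+ m * S)) = 0.
  by rewrite E mulr0.
by rewrite !mulrDr !mulrA sq !mul1r => <-; rewrite mulr2n; ring.
Qed.

Lemma square_pairing m : pairing m m = 0 ->
  q m * q m = \sum_(1 <= s < m.+1) ((-1) ^+ s.+1 *+ 2) * (q (m + s)%N * q (m - s)%N).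
Proof.
rewrite /pairing => /eqP; rewrite addr_eq0 => /eqP ->.
rewrite -sumrMnl -sumrN; apply: eq_bigr => s _.
by rewrite exprS !mulr2n; ring.
Qed.

End Pairing.

Lemma Qgen0 (R : comNzRingType) n : Qgen R n 0 = 1.
Proof. exact: qcoef0. Qed.

(** A repeated index is the obstruction to strictness: this rewrites it as a
    combination of products of two factors that are further apart. *)
Lemma Qgen_square (R : comNzRingType) n m : (0 < m)%N ->
  Qgen R n m * Qgen R n m
  = \sum_(1 <= s < m.+1) ((-1) ^+ s.+1 *+ 2) * (Qgen R n (m + s) * Qgen R n (m - s)).
Proof.
move=> m_gt0; apply: square_pairing; apply: pairing_diag.
by apply: qcoef_reflection; rewrite addn_gt0 m_gt0.
Qed.

(** * Q-polynomials of strict partitions span *)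

Definition sumsq (la : seq nat) : nat := sumn [seq i ^ 2 | i <- la]%N.

Lemma sumsq_cat la mu : sumsq (la ++ mu) = (sumsq la + sumsq mu)%N.
Proof. by rewrite /sumsq map_cat sumn_cat. Qed.

Lemma sumsq_le la : (sumsq la <= sumn la ^ 2)%N.
Proof.
elim: la => //= x la IH; rewrite /sumsq /= sqrnD; apply: leq_trans (leq_addr _ _).
by rewrite leq_add2l.
Qed.

Lemma geq_trans : transitive geq.
Proof. by move=> y x z /= h h'; exact: leq_trans h' h. Qed.

Lemma perm_sumn la mu : perm_eq la mu -> sumn la = sumn mu.
Proof. by move=> h; rewrite !sumnE; apply: perm_big. Qed.

Lemma perm_sumsq la mu : perm_eq la mu -> sumsq la = sumsq mu.
Proof. by move=> h; apply: perm_sumn; exact: perm_map. Qed.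

Section MonomialFiltration.
Local Notation family := (forall n, {mpoly {poly int}[n]}).

Definition qmon (la : seq nat) : family := fun n => \prod_(i <- la) Qgen _ n i.

Lemma qmon_perm la mu n : perm_eq la mu -> qmon la n = qmon mu n.
Proof. by move=> h; apply: perm_big. Qed.

Lemma qmon_cat la mu n : qmon (la ++ mu) n = qmon la n * qmon mu n.
Proof. exact: big_cat. Qed.

Lemma qmon_nz la n : qmon [seq i <- la | i != 0%N] n = qmon la n.
Proof.
rewrite /qmon big_filter [RHS](bigID (fun i => i != 0%N)) /=.
by rewrite [X in _ * X]big1 ?mulr1 // => i /negPn /eqP ->; exact: Qgen0.
Qed.

(** The step (N, S) of a filtration by the sum of the squares of the indices,
    uniform in the number n of variables. That sum grows under straightening and
    is bounded by N ^ 2, which makes the straightening terminate. *)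
Definition combo (N S : nat) (F : family) : Prop :=
  exists t : seq ({poly int} * seq nat),
    all (fun c => (sumn c.2 == N) && (S <= sumsq c.2)%N) t /\
    forall n, F n = \sum_(c <- t) c.1 *: qmon c.2 n.

Lemma combo_ext N S F G : combo N S F -> (forall n, F n = G n) -> combo N S G.
Proof. by move=> [t [ht E]] EFG; exists t; split=> // n; rewrite -EFG E. Qed.

Lemma combo_qmon la : combo (sumn la) (sumsq la) (qmon la).
Proof.
by exists [:: (1, la)]; rewrite /= eqxx leqnn; split=> // n; rewrite big_seq1 scale1r.
Qed.

Lemma combo_weaken N S S' F : (S' <= S)%N -> combo N S F -> combo N S' F.
Proof.
move=> le [t [/allP ht E]]; exists t; split=> //; apply/allP => c /ht /andP[-> /=].
exact: leq_trans.
Qed.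

Lemma combo0 N S : combo N S (fun n => 0).
Proof. by exists [::]; split=> // n; rewrite big_nil. Qed.

Lemma comboD N S F G : combo N S F -> combo N S G -> combo N S (fun n => F n + G n).
Proof.
move=> [t [ht E]] [u [hu EG]]; exists (t ++ u); rewrite all_cat ht; split=> // n.
by rewrite E EG big_cat.
Qed.

Lemma comboZ N S c F : combo N S F -> combo N S (fun n => c *: F n).
Proof.
move=> [t [ht E]]; exists [seq (c * x.1, x.2) | x <- t]; split; first by rewrite all_map.
by move=> n; rewrite E big_map scaler_sumr; apply: eq_bigr => x _; rewrite scalerA.
Qed.

Lemma combo_sum (I : Type) (s : seq I) N S (F : I -> family) :
  (forall i, combo N S (F i)) -> combo N S (fun n => \sum_(i <- s) F i n).
Proof.
move=> h; elim: s => [|i s IH].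
  by apply: combo_ext (combo0 N S) _ => n; rewrite big_nil.
by apply: combo_ext (comboD (h i) IH) _ => n; rewrite big_cons.
Qed.

Lemma combo_big_nat a b N S (F : nat -> family) :
  (forall i, (a <= i < b)%N -> combo N S (F i)) ->
  combo N S (fun n => \sum_(a <= i < b) F i n).
Proof.
move=> h; pose G i : family := fun n => if (a <= i < b)%N then F i n else 0.
have hG : combo N S (fun n => \sum_(i <- index_iota a b) G i n).
  apply: combo_sum => i; rewrite /G; case E: (a <= i < b)%N; [exact: h|exact: combo0].
by apply: combo_ext hG _ => n; rewrite -big_mkcond [RHS]big_nat.
Qed.

Lemma comboM N S N' S' F G : combo N S F -> combo N' S' G ->
  combo (N + N') (S + S') (fun n => F n * G n).
Proof.
move=> [t [/allP ht E]] [u [/allP hu EG]].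
exists [seq (x.1 * y.1, x.2 ++ y.2) | x <- t, y <- u]; split.
  apply/allP => _ /allpairsP[[x y] [/= xt yu ->]] /=.
  have /andP[/eqP <- le] := ht x xt; have /andP[/eqP <- le'] := hu y yu.
  by rewrite sumn_cat eqxx sumsq_cat leq_add.
move=> n; rewrite E EG big_allpairs_dep mulr_suml; apply: eq_bigr => x _.
rewrite mulr_sumr; apply: eq_bigr => y _.
by rewrite qmon_cat -scalerAl -scalerAr scalerA.
Qed.

Definition same_lead N S F G :=
  [/\ combo N S F, combo N S G & combo N S.+1 (fun n => F n - G n)].

Lemma same_leadM N S N' S' F G F' G' : same_lead N S F G -> same_lead N' S' F' G' ->
  same_lead (N + N') (S + S') (fun n => F n * F' n) (fun n => G n * G' n).
Proof.
move=> [hF hG h] [hF' hG' h']; split; try exact: comboM.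
have h2 := comboM hG h'; rewrite addnS -addSn in h2.
apply: combo_ext (comboD (comboM h hF') h2) _ => n /=.
by rewrite mulrBl mulrBr addrA subrK.
Qed.

Lemma same_lead_ext N S F G F' G' : same_lead N S F G ->
  (forall n, F n = F' n) -> (forall n, G n = G' n) -> same_lead N S F' G'.
Proof.
move=> [hF hG h] EF EG; split; [exact: combo_ext hF _|exact: combo_ext hG _|].
by apply: combo_ext h _ => n; rewrite EF EG.
Qed.

(** The corrections Q_(a + s) Q_(b - s), s > 0, of Q_a Q_b have a larger sum of
    squares since b <= a. *)
Lemma Qpair_lead a b : (b <= a)%N ->
  same_lead (a + b) (a ^ 2 + b ^ 2) (fun n => Qpair _ n a b) (qmon [:: a; b]).
Proof.
move=> le_ba.
have Emon n : qmon [:: a; b] n = Qgen _ n a * Qgen _ n b.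
  by rewrite /qmon !big_cons big_nil mulr1.
have hi : combo (a + b) (a ^ 2 + b ^ 2).+1 (fun n => Qpair _ n a b - qmon [:: a; b] n).
  apply: (@combo_ext _ _ (fun n => \sum_(1 <= s < b.+1)
      ((-1) ^+ s *+ 2) *: qmon [:: (a + s)%N; (b - s)%N] n)).
    apply: combo_big_nat => s /andP[s_gt0 les]; apply: comboZ.
    have := combo_qmon [:: (a + s)%N; (b - s)%N]; rewrite /sumsq /= !addn0.
    have -> : (a + s + (b - s) = a + b)%N by lia.
    by apply: combo_weaken; nia.
  move=> n; rewrite Emon /Qpair addrAC subrr add0r -sumrMnl; apply: eq_bigr => s _.
  rewrite /qmon !big_cons big_nil mulr1 -mulrA mulr2n mulr2n scalerDl.
  by rewrite -!mul_mpolyC rmorphXn rmorphN1.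
have mon : combo (a + b) (a ^ 2 + b ^ 2) (qmon [:: a; b]).
  by have := combo_qmon [:: a; b]; rewrite /sumsq /= !addn0.
split=> //; apply: combo_ext (comboD (combo_weaken (leqnSn _) hi) mon) _.
by move=> n; rewrite subrK.
Qed.

Lemma signed_sum_odd (R : pzRingType) k : \sum_(j < k) (-1) ^+ j = (odd k)%:R :> R.
Proof.
elim: k => [|k IH]; first by rewrite big_ord0.
by rewrite big_ord_recr /= IH -signr_odd; case: odd; rewrite ?subrr ?add0r.
Qed.

Lemma take_nth_drop (la : seq nat) j : (j < size la)%N ->
  perm_eq la (nth 0%N la j :: (take j la ++ drop j.+1 la)).
Proof.
move=> lt; rewrite -{1}(cat_take_drop j la) (drop_nth 0%N lt).
by rewrite -cat1s perm_catCA.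
Qed.

(** Each term of the expansion along the first row has leading monomial that of
    all of la by induction; there is an odd number of terms, with alternating
    signs, so exactly one copy survives. *)
Lemma pfaffian_lead fuel la : (size la <= fuel)%N -> ~~ odd (size la) -> sorted geq la ->
  same_lead (sumn la) (sumsq la) (fun n => pfaffian (Qpair _ n) fuel la) (qmon la).
Proof.
elim: fuel la => [|fuel IH] [|x la] //=.
  1,2: move=> _ _ _; have h := combo_qmon [::].
  1,2: have E n : 1 = qmon [::] n by rewrite /qmon big_nil.
  1,2: have h1 : combo 0 0 (fun n => 1) by apply: combo_ext h _ => n; rewrite E.
  1,2: by split=> //; apply: combo_ext (combo0 _ _) _ => n; rewrite E subrr.
rewrite ltnS negbK => le_la odd_la sorted_la.
have term j : (j < size la)%N -> same_lead (sumn (x :: la)) (sumsq (x :: la))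
    (fun n => Qpair _ n x (nth 0%N la j) * pfaffian (Qpair _ n) fuel (take j la ++ drop j.+1 la))
    (qmon (x :: la)).
  move=> ltj; have perm := take_nth_drop ltj.
  set y := nth 0%N la j in perm *; set rest := take j la ++ drop j.+1 la in perm *.
  have size_la : size la = (size rest).+1 by rewrite (perm_size perm).
  have sub_rest : subseq rest la.
    rewrite /rest -[X in subseq _ X](cat_take_drop j la) (drop_nth 0%N ltj).
    by apply: cat_subseq; [exact: subseq_refl|exact: subseq_cons].
  have le_yx : (y <= x)%N.
    by have /allP/(_ y (mem_nth 0%N ltj)) := order_path_min geq_trans sorted_la.
  have := same_leadM (Qpair_lead le_yx) (IH rest _ _ _).
  have -> : (sumn (x :: la) = x + y + sumn rest)%N by rewrite /= (perm_sumn perm) /= addnA.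
  have -> : (sumsq (x :: la) = x ^ 2 + y ^ 2 + sumsq rest)%N.
    by rewrite /sumsq /= (perm_sumn (perm_map _ perm)) /= addnA.
  move=> H; apply: same_lead_ext (H _ _ _) _ _ => //.
  - by rewrite -ltnS -size_la leqW.
  - by move: odd_la; rewrite size_la /=.
  - have srt : sorted geq la := path_sorted sorted_la.
    exact: (subseq_sorted geq_trans sub_rest srt).
  by move=> n; rewrite -qmon_cat; apply: qmon_perm; rewrite /= perm_cons perm_sym.
have hmon := combo_qmon (x :: la).
have hi : combo (sumn (x :: la)) (sumsq (x :: la)).+1
    (fun n => \sum_(j < size la) (-1) ^+ j * Qpair _ n x (nth 0%N la j)
       * pfaffian (Qpair _ n) fuel (take j la ++ drop j.+1 la) - qmon (x :: la) n).
  apply: (@combo_ext _ _ (fun n => \sum_(0 <= j < size la) (-1) ^+ j *: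
      (Qpair _ n x (nth 0%N la j) * pfaffian (Qpair _ n) fuel (take j la ++ drop j.+1 la)
        - qmon (x :: la) n))).
    by apply: combo_big_nat => j /term [_ _ h]; exact: comboZ.
  move=> n; rewrite big_mkord; under eq_bigr do rewrite scalerBr.
  rewrite sumrB -scaler_suml signed_sum_odd odd_la scale1r; congr (_ - _).
  by apply: eq_bigr => j _; rewrite -mul_mpolyC rmorphXn rmorphN1 mulrA.
split=> //; apply: combo_ext (comboD (combo_weaken (leqnSn _) hi) hmon) _.
by move=> n; rewrite subrK.
Qed.

Definition Q_span (F : family) : Prop :=
  exists s : seq ({poly int} * seq nat),
    all (fun c => is_strict c.2) s /\
    forall n, F n = \sum_(c <- s) c.1 *: Qfun _ n c.2.

Lemma Q_span_ext F G : Q_span F -> (forall n, F n = G n) -> Q_span G.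
Proof. by move=> [t [ht E]] EFG; exists t; split=> // n; rewrite -EFG E. Qed.

Lemma Q_spanD F G : Q_span F -> Q_span G -> Q_span (fun n => F n + G n).
Proof.
move=> [t [ht E]] [u [hu EG]]; exists (t ++ u); rewrite all_cat ht; split=> // n.
by rewrite E EG big_cat.
Qed.

Lemma Q_spanZ c F : Q_span F -> Q_span (fun n => c *: F n).
Proof.
move=> [t [ht E]]; exists [seq (c * x.1, x.2) | x <- t]; split; first by rewrite all_map.
by move=> n; rewrite E big_map scaler_sumr; apply: eq_bigr => x _; rewrite scalerA.
Qed.

Lemma Q_span_sum (I : eqType) (s : seq I) (F : I -> family) :
  (forall i, i \in s -> Q_span (F i)) -> Q_span (fun n => \sum_(i <- s) F i n).
Proof.
elim: s => [|i s IH] h.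
  by exists [::]; split=> // n; rewrite !big_nil.
apply: Q_span_ext (Q_spanD (h i (mem_head _ _)) (IH _)) _.
  by move=> j js; apply: h; rewrite inE js orbT.
by move=> n; rewrite big_cons.
Qed.

Lemma Q_span_strict la : is_strict la -> Q_span (fun n => Qfun _ n la).
Proof. by move=> h; exists [:: (1, la)]; rewrite /= h; split=> // n; rewrite big_seq1 scale1r. Qed.

Lemma Qfun_lead la : sorted geq la ->
  same_lead (sumn la) (sumsq la) (fun n => Qfun _ n la) (qmon la).
Proof.
move=> sorted_la; rewrite /Qfun; set la' := if _ then _ else _.
have [sorted' even' E1 [E2 E3]] : [/\ sorted geq la', ~~ odd (size la'), sumn la' = sumn la &
    sumsq la' = sumsq la /\ forall n, qmon la' n = qmon la n].
  rewrite /la'; case: ifP => odd_la; last by rewrite odd_la.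
  split.
  - by case: (la) sorted_la => //= x s srt; rewrite rcons_path srt.
  - by rewrite size_rcons /= odd_la.
  - by rewrite sumn_rcons addn0.
  split; first by rewrite /sumsq map_rcons sumn_rcons addn0.
  by move=> n; rewrite /qmon big_rcons /= Qgen0 mulr1.
have := pfaffian_lead (leqnn _) even' sorted'; rewrite E1 E2 => h.
by apply: same_lead_ext h _ E3.
Qed.

Lemma not_strict_repeat la : sorted geq la -> ~~ sorted gtn la ->
  exists m rest, perm_eq la [:: m, m & rest].
Proof.
elim: la => [|x [|y la] IH] //= /andP[le_yx sorted_la].
rewrite negb_and; case: (ltnP y x) => [lt_yx|ge_yx] /=.
  move=> /(IH sorted_la) [m [rest perm]]; exists m, (x :: rest).
  rewrite -(perm_cons x) in perm; apply: perm_trans perm _.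
  by apply/seq.permP => a /=; lia.
move=> _; exists x, la; suff -> : x = y by [].
by apply/eqP; rewrite eqn_leq ge_yx.
Qed.

(** Descending induction on N ^ 2 minus the sum of squares: a strict monomial is
    its Q-polynomial up to higher terms, a repeated index is removed by
    [Qgen_square]. *)
Lemma qmon_span la : Q_span (qmon la).
Proof.
have [k] := ubnP (sumn la ^ 2 - sumsq la); elim: k la => // k IH la; rewrite ltnS => le_k.
wlog [sorted_la nz_la] : la le_k / sorted geq la /\ 0%N \notin la.
  move=> H; pose mu := sort geq [seq i <- la | i != 0%N].
  have perm : perm_eq mu [seq i <- la | i != 0%N] by rewrite perm_sort.
  have sumn0 : sumn [seq i <- la | i != 0%N] = sumn la.
    rewrite !sumnE big_filter [RHS](bigID (fun i => i != 0%N)) /=.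
    by rewrite [X in (_ + X)%N]big1 ?addn0 // => i /negPn /eqP.
  have sumsq0 : sumsq [seq i <- la | i != 0%N] = sumsq la.
    rewrite /sumsq !sumnE !big_map big_filter [RHS](bigID (fun i => i != 0%N)) /=.
    by rewrite [X in (_ + X)%N]big1 ?addn0 // => i /negPn /eqP ->.
  apply: Q_span_ext (H mu _ _) _.
  - by rewrite (perm_sumn perm) (perm_sumsq perm) sumn0 sumsq0.
  - split; first by apply: sort_sorted => x y; exact: leq_total.
    by rewrite (perm_mem perm) mem_filter.
  by move=> n; rewrite (qmon_perm _ perm) qmon_nz.
have higher F : combo (sumn la) (sumsq la).+1 F -> Q_span F.
  move=> [t [/allP ht E]]; apply: (@Q_span_ext (fun n => \sum_(c <- t) c.1 *: qmon c.2 n)).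
    apply: Q_span_sum => c /ht /andP[/eqP E1 lt]; apply: Q_spanZ; apply: IH.
    apply: leq_trans le_k; rewrite E1; apply: ltn_sub2l => //.
    by apply: leq_trans lt _; rewrite -E1; exact: sumsq_le.
  by move=> n; rewrite E.
case: (boolP (sorted gtn la)) => [strict_la|/(not_strict_repeat sorted_la)].
  have [_ _ h] := Qfun_lead sorted_la.
  have hla : is_strict la by rewrite /is_strict strict_la.
  apply: Q_span_ext (Q_spanD (Q_span_strict hla) (Q_spanZ (-1) (higher _ h))) _ => n.
  by rewrite scaleN1r opprB addrC subrK.
move=> [m [rest perm]].
have m_gt0 : (0 < m)%N.
  by rewrite lt0n; apply: contraNneq nz_la => <-; rewrite (perm_mem perm) mem_head.
apply: higher; apply: (@combo_ext _ _ (fun n => \sum_(1 <= s < m.+1)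
    ((-1) ^+ s.+1 *+ 2) *: qmon [:: (m + s)%N, (m - s)%N & rest] n)).
  apply: combo_big_nat => s /andP[s_gt0 les]; apply: comboZ.
  have := combo_qmon [:: (m + s)%N, (m - s)%N & rest].
  have -> : sumn [:: (m + s)%N, (m - s)%N & rest] = sumn la by rewrite (perm_sumn perm) /=; lia.
  by apply: combo_weaken; rewrite (perm_sumsq perm) /sumsq /=; nia.
move=> n; rewrite (qmon_perm n perm) /qmon !big_cons mulrA Qgen_square // mulr_suml.
apply: eq_bigr => s _; rewrite !big_cons !mulrA -mul_mpolyC !mulrA.
by rewrite !mulr2n rmorphD /= rmorphXn rmorphN1.
Qed.

End MonomialFiltration.

(** * Q-polynomials in three variables *)

Section ThreeVariables.
Variables (A : idomainType) (y : 'I_3 -> A).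
Let x1 := y ord0.
Let x2 := y (lift ord0 ord0).
Let x3 := y (lift ord0 (lift ord0 ord0)).
Local Notation q := (qcoef y).
Let e1 := x1 + x2 + x3.
Let e2 := x1 * x2 + x1 * x3 + x2 * x3.
Let e3 := x1 * x2 * x3.

Definition vdm : A := (x1 - x2) * (x1 - x3) * (x2 - x3).
Definition pairsums : A := (x1 + x2) * (x1 + x3) * (x2 + x3).

Lemma prod3E (z : 'I_3 -> A) :
  \prod_(j < 3) (1 + z j *: 'X)
  = 1 + (z ord0 + z (lift ord0 ord0) + z (lift ord0 (lift ord0 ord0)))%:P * 'X
    + (z ord0 * z (lift ord0 ord0) + z ord0 * z (lift ord0 (lift ord0 ord0))
       + z (lift ord0 ord0) * z (lift ord0 (lift ord0 ord0)))%:P * 'X^2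
    + (z ord0 * z (lift ord0 ord0) * z (lift ord0 (lift ord0 ord0)))%:P * 'X^3 :> {poly A}.
Proof. by rewrite !big_ord_recl big_ord0 -!mul_polyC !polyCD !polyCM; ring. Qed.

Lemma coef_mul_cubic (p : {poly A}) a b c d :
  (p * (1 + a%:P * 'X + b%:P * 'X^2 + c%:P * 'X^3))`_d
  = p`_d + a * (if d is d1.+1 then p`_d1 else 0) + b * (if d is d2.+2 then p`_d2 else 0)
    + c * (if d is d3.+3 then p`_d3 else 0).
Proof.
rewrite !mulrDr mulr1 !coefD (mulrCA p a%:P) (mulrCA p b%:P) (mulrCA p c%:P).
rewrite !coefCM coefMX !coefMXn.
by case: d => [|[|[|d]]] /=; rewrite ?subSS ?subn0.
Qed.

Lemma qcoef3_rec d :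
  q d - e1 * (if d is d1.+1 then q d1 else 0) + e2 * (if d is d2.+2 then q d2 else 0)
    - e3 * (if d is d3.+3 then q d3 else 0)
  = (1 : {poly A})`_d + e1 * (if d is d1.+1 then (1 : {poly A})`_d1 else 0)
    + e2 * (if d is d2.+2 then (1 : {poly A})`_d2 else 0)
    + e3 * (if d is d3.+3 then (1 : {poly A})`_d3 else 0).
Proof.
rewrite -coef_mul_cubic mul1r.
have := qser_recurrence y (leqnn d); rewrite (prod3E y) => <-.
have -> : \prod_(j < 3) (1 - y j *: 'X) = \prod_(j < 3) (1 + (- y j) *: 'X).
  by apply: eq_bigr => j _; rewrite scaleNr.
rewrite (prod3E (fun j => - y j)) coef_mul_cubic /e1 /e2 /e3 /x1 /x2 /x3.
have qE k : (k <= d)%N -> (qser y d)`_k = q k by exact: qserE.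
case: d qE => [|[|[|d]]] qE; rewrite /= !qE; try lia; move: (qcoef y) => q'; ring.
Qed.

Let a1 := 2%:R * (x1 + x2) * (x1 + x3) * (x2 - x3).
Let a2 := - (2%:R * (x1 + x2) * (x2 + x3) * (x1 - x3)).
Let a3 := 2%:R * (x1 + x3) * (x2 + x3) * (x1 - x2).

Lemma eq_from_difference (a b c d : A) : a = b -> c - d = a - b -> c = d.
Proof. by move=> ->; rewrite subrr => /eqP; rewrite subr_eq0 => /eqP. Qed.

(** Partial fractions of the generating series: for d > 0 the coefficient of
    z ^ d is a combination of the x_i ^ d. It is proved from the recurrence of order
    three that the denominator imposes, after three initial values. *)
Lemma vdm_qcoef d : vdm * q d.+1 = a1 * x1 ^+ d.+1 + a2 * x2 ^+ d.+1 + a3 * x3 ^+ d.+1.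
Proof.
have := (qcoef3_rec 1, qcoef3_rec 2, qcoef3_rec 3, fun d => qcoef3_rec d.+4).
rewrite !coef1 /= qcoef0 => -[[[+ +] +] +].
move: (qcoef y) => f r1 r2 r3 r.
have E1 : f 1%N = 2%:R * e1 by apply: (eq_from_difference r1); ring.
have E2 : f 2%N = 2%:R * e1 ^+ 2.
  by apply: (eq_from_difference r2); rewrite E1; ring.
have E3 : f 3%N = 2%:R * (e3 + e1 ^+ 3 - e1 * e2).
  by apply: (eq_from_difference r3); rewrite E2 E1; ring.
have E d' : f d'.+4 = e1 * f d'.+3 - e2 * f d'.+2 + e3 * f d'.+1.
  by apply: (eq_from_difference (r d')); rewrite !coef1 /=; ring.
pose P k := vdm * f k.+1 = a1 * x1 ^+ k.+1 + a2 * x2 ^+ k.+1 + a3 * x3 ^+ k.+1.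
suff : [/\ P d, P d.+1 & P d.+2] by case.
elim: d => [|d [P0 P1 P2]]; rewrite /P.
  by split; rewrite ?E1 ?E2 ?E3 /vdm /a1 /a2 /a3 /e1 /e2 /e3; ring.
split=> //; rewrite E mulrDr mulrBr !(mulrCA vdm) P0 P1 P2 /e1 /e2 /e3 !exprS.
move: (x1 ^+ d) (x2 ^+ d) (x3 ^+ d) => z1 z2 z3; ring.
Qed.

(** The determinant with columns (x_i ^ a, x_i ^ b, x_i ^ c), expanded along
    its first row. *)
Definition alternant a b c : A :=
  x1 ^+ a * (x2 ^+ b * x3 ^+ c - x2 ^+ c * x3 ^+ b)
  - x2 ^+ a * (x1 ^+ b * x3 ^+ c - x1 ^+ c * x3 ^+ b)
  + x3 ^+ a * (x1 ^+ b * x2 ^+ c - x1 ^+ c * x2 ^+ b).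

Hypothesis vdm_neq0 : vdm != 0.
Local Notation T := (pairing q).

(** By the recurrence [pairingS] in the second index. Multiplying twice by the
    Vandermonde determinant leaves only powers of the x_i. *)
Lemma vdm_pairing a b : vdm * T a.+1 b.+1 = 4%:R * pairsums * alternant a.+1 b.+1 0.
Proof.
apply: (mulfI vdm_neq0); elim: b a => [|b IH] a.
  rewrite pairingS (pairing0 (qcoef0 y)).
  have -> : vdm * (vdm * (q a.+1 * q 1%N - q a.+2 * q 0%N - q a.+2))
      = (vdm * q a.+1) * (vdm * q 1%N) - 2%:R * vdm * (vdm * q a.+2).
    rewrite (qcoef0 y); move: (q a.+1) (q 1%N) (q a.+2) => u v w; ring.
  rewrite !vdm_qcoef /vdm /pairsums /alternant /a1 /a2 /a3 !exprS !expr0.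
  move: (x1 ^+ a) (x2 ^+ a) (x3 ^+ a) => z1 z2 z3; ring.
rewrite pairingS.
have -> : vdm * (vdm * (q a.+1 * q b.+2 - q a.+2 * q b.+1 - T a.+2 b.+1))
    = (vdm * q a.+1) * (vdm * q b.+2) - (vdm * q a.+2) * (vdm * q b.+1)
      - vdm * (vdm * T a.+2 b.+1).
  move: (q a.+1) (q b.+2) (q a.+2) (q b.+1) (T a.+2 b.+1) => u v w z t; ring.
rewrite IH !vdm_qcoef /vdm /pairsums /alternant /a1 /a2 /a3 !exprS !expr0.
move: (x1 ^+ a) (x2 ^+ a) (x3 ^+ a) (x1 ^+ b) (x2 ^+ b) (x3 ^+ b) => z1 z2 z3 w1 w2 w3; ring.
Qed.

Local Notation Pf := (pfaffian T).

Lemma pfaffian4 fuel a b c d :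
  Pf fuel.+2 [:: a; b; c; d] = T a b * T c d - T a c * T b d + T a d * T b c.
Proof.
case: fuel => [|fuel]; rewrite /= !big_ord_recl !big_ord0 /= ?big_ord_recl ?big_ord0 /=;
rewrite /bump /=; move: T => T'; ring.
Qed.

Lemma pfaffian3 fuel a b c :
  Pf fuel.+2 [:: a; b; c; 0%N] = T a b * q c - T a c * q b + q a * T b c.
Proof. by rewrite pfaffian4 !(pairing0 (qcoef0 y)). Qed.

(** In three variables Q-polynomials of length 3 are quotients of alternants, as
    Schur polynomials are, times the factor 8 prod_(i < j) (x_i + x_j). *)
Lemma vdm_pfaffian3 fuel a b c :
  vdm * Pf fuel.+2 [:: a.+1; b.+1; c.+1; 0%N]
  = 8%:R * pairsums * alternant a.+1 b.+1 c.+1.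
Proof.
apply: (mulfI vdm_neq0); rewrite pfaffian3.
have -> : vdm * (vdm * (T a.+1 b.+1 * q c.+1 - T a.+1 c.+1 * q b.+1 + q a.+1 * T b.+1 c.+1))
  = (vdm * T a.+1 b.+1) * (vdm * q c.+1) - (vdm * T a.+1 c.+1) * (vdm * q b.+1)
    + (vdm * q a.+1) * (vdm * T b.+1 c.+1).
  move: (T _ _) (T _ _) (T _ _) (q a.+1) (q b.+1) (q c.+1) => t1 t2 t3 u v w; ring.
rewrite !vdm_pairing !vdm_qcoef /vdm /pairsums /alternant /a1 /a2 /a3 !expr0.
move: (x1 ^+ a.+1) (x2 ^+ a.+1) (x3 ^+ a.+1) => z1 z2 z3.
move: (x1 ^+ b.+1) (x2 ^+ b.+1) (x3 ^+ b.+1) => w1 w2 w3.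
move: (x1 ^+ c.+1) (x2 ^+ c.+1) (x3 ^+ c.+1) => v1 v2 v3; ring.
Qed.

(** In three variables, a 4 x 4 Pfaffian with entries that are alternants of
    two exponents is a Pluecker relation. *)
Lemma pfaffian4_zero fuel a b c d : Pf fuel.+2 [:: a.+1; b.+1; c.+1; d.+1] = 0.
Proof.
apply: (mulfI vdm_neq0); apply: (mulfI vdm_neq0); rewrite !mulr0 pfaffian4.
have -> : vdm * (vdm * (T a.+1 b.+1 * T c.+1 d.+1 - T a.+1 c.+1 * T b.+1 d.+1
      + T a.+1 d.+1 * T b.+1 c.+1))
  = (vdm * T a.+1 b.+1) * (vdm * T c.+1 d.+1) - (vdm * T a.+1 c.+1) * (vdm * T b.+1 d.+1)
    + (vdm * T a.+1 d.+1) * (vdm * T b.+1 c.+1).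
  move: (T a.+1 b.+1) (T c.+1 d.+1) (T a.+1 c.+1) (T b.+1 d.+1) (T a.+1 d.+1) (T b.+1 c.+1).
  move=> t1 t2 t3 t4 t5 t6; ring.
rewrite !vdm_pairing /alternant !expr0; move: pairsums => p.
move: (x1 ^+ a.+1) (x2 ^+ a.+1) (x3 ^+ a.+1) => z1 z2 z3.
move: (x1 ^+ b.+1) (x2 ^+ b.+1) (x3 ^+ b.+1) => w1 w2 w3.
move: (x1 ^+ c.+1) (x2 ^+ c.+1) (x3 ^+ c.+1) => v1 v2 v3.
move: (x1 ^+ d.+1) (x2 ^+ d.+1) (x3 ^+ d.+1) => u1 u2 u3; ring.
Qed.

Lemma pfaffian6 fuel a b c d e f :
  Pf fuel.+1 [:: a; b; c; d; e; f]
  = T a b * Pf fuel [:: c; d; e; f] - T a c * Pf fuel [:: b; d; e; f]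
    + T a d * Pf fuel [:: b; c; e; f] - T a e * Pf fuel [:: b; c; d; f]
    + T a f * Pf fuel [:: b; c; d; e].
Proof.
rewrite /= !big_ord_recl big_ord0 /bump /=.
move: (pfaffian T fuel) T => P T'. ring.
Qed.

(** Cramer's relation between alternants of three exponents and of two. *)
Lemma pfaffian5_zero fuel a b c d e :
  Pf fuel.+3 [:: a.+1; b.+1; c.+1; d.+1; e.+1; 0%N] = 0.
Proof.
apply: (mulfI vdm_neq0); apply: (mulfI vdm_neq0); rewrite !mulr0.
rewrite pfaffian6 pfaffian4_zero mulr0 addr0.
move: (vdm_pfaffian3 fuel c d e) (vdm_pfaffian3 fuel b d e)
  (vdm_pfaffian3 fuel b c e) (vdm_pfaffian3 fuel b c d).
move: (Pf _ _) (Pf _ _) (Pf _ _) (Pf _ _) => p4 p3 p2 p1 E1 E2 E3 E4.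
set lhs := (X in X = _).
have -> : lhs = (vdm * T a.+1 b.+1) * (vdm * p1) - (vdm * T a.+1 c.+1) * (vdm * p2)
    + (vdm * T a.+1 d.+1) * (vdm * p3) - (vdm * T a.+1 e.+1) * (vdm * p4).
  rewrite /lhs; move: (T _ _) (T _ _) (T _ _) (T _ _) => t1 t2 t3 t4; ring.
rewrite E1 E2 E3 E4 !vdm_pairing /alternant !expr0; move: pairsums => p.
move: (x1 ^+ a.+1) (x2 ^+ a.+1) (x3 ^+ a.+1) => z1 z2 z3.
move: (x1 ^+ b.+1) (x2 ^+ b.+1) (x3 ^+ b.+1) => w1 w2 w3.
move: (x1 ^+ c.+1) (x2 ^+ c.+1) (x3 ^+ c.+1) => v1 v2 v3.
move: (x1 ^+ d.+1) (x2 ^+ d.+1) (x3 ^+ d.+1) => u1 u2 u3.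
move: (x1 ^+ e.+1) (x2 ^+ e.+1) (x3 ^+ e.+1) => s1 s2 s3; ring.
Qed.

Lemma size_delete (la : seq nat) j : (j < size la)%N ->
  size (take j la ++ drop j.+1 la) = (size la).-1.
Proof. by move=> lt; rewrite (perm_size (take_nth_drop lt)). Qed.

Lemma all_delete (p : pred nat) (la : seq nat) j :
  all p la -> all p (take j la ++ drop j.+1 la).
Proof.
move=> /allP h; apply/allP => x; rewrite mem_cat => /orP[/mem_take|/mem_drop]; exact: h.
Qed.

(** All longer Pfaffians vanish by expansion down to length 4. *)
Lemma pfaffian_even_zero fuel la : (size la <= fuel)%N -> all (leq 1) la ->
  ~~ odd (size la) -> (3 < size la)%N -> Pf fuel la = 0.
Proof.
elim: fuel la => [|fuel IH] [|x la] //= le_la /andP[x_gt0 pos_la] odd_la lt_la.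
have [size3|ne3] := eqVneq (size la) 3%N.
  case: fuel la size3 le_la pos_la {IH odd_la lt_la} => [|fuel] [|b [|c [|d []]]] //= _ _.
  case: x x_gt0 => [//|x] _; case: b => [//|b]; case: c => [//|c]; case: d => [//|d] _.
  exact: pfaffian4_zero.
rewrite big1 // => j _; rewrite IH ?mulr0 ?all_delete ?size_delete //; lia.
Qed.

Lemma pfaffian_odd_zero fuel la : (size la < fuel)%N -> all (leq 1) la ->
  odd (size la) -> (3 < size la)%N -> Pf fuel (rcons la 0%N) = 0.
Proof.
elim: fuel la => [|fuel IH] [|x la] //= lt_la /andP[x_gt0 pos_la] odd_la size_la.
have [size4|ne4] := eqVneq (size la) 4%N.
  case: fuel la size4 lt_la pos_la {IH odd_la size_la} => [|[|fuel]] [|b [|c [|d [|e []]]]] //= _ _.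
  case: x x_gt0 => [//|x] _; case: b => [//|b]; case: c => [//|c]; case: d => [//|d].
  case: e => [//|e] _; exact: pfaffian5_zero.
rewrite big1 // => -[j /=]; rewrite size_rcons ltnS leq_eqVlt => /orP[/eqP ->|lt_j] _.
  rewrite -cats1 take_size_cat // drop_oversize ?size_cat ?addn1 // cats0.
  by rewrite (@pfaffian_even_zero fuel) ?mulr0 //; lia.
have -> : take j (rcons la 0%N) ++ drop j.+1 (rcons la 0%N)
    = rcons (take j la ++ drop j.+1 la) 0%N.
  rewrite -!cats1 take_cat drop_cat lt_j -catA; case: ltnP => // h.
  have -> : (j.+1 = size la)%N by lia.
  by rewrite subnn drop0 drop_size.
rewrite IH ?mulr0 ?all_delete ?size_delete //; lia.
Qed.

End ThreeVariables.

(** * Linear independence of Q-polynomials in three variables *)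

Section AlternantMonomials.
Variable R : idomainType.
Local Notation y := (fun j : 'I_3 => 'X_j : {mpoly R[3]}).
Let i1 : 'I_3 := ord0.
Let i2 : 'I_3 := lift ord0 ord0.
Let i3 : 'I_3 := lift ord0 (lift ord0 ord0).

Definition mono3 a b c : 'X_{1..3} := (U_(i1) *+ a + U_(i2) *+ b + U_(i3) *+ c)%MM.

Lemma mono3E a b c : 'X_i1 ^+ a * ('X_i2 ^+ b * 'X_i3 ^+ c) = 'X_[mono3 a b c] :> {mpoly R[3]}.
Proof. by rewrite !mpolyXD !mpolyXn mulrA. Qed.

Lemma mono3_eq a b c a' b' c' :
  (mono3 a b c == mono3 a' b' c') = [&& a == a', b == b' & c == c'].
Proof.
apply/eqP/and3P => [/mnmP E|[/eqP -> /eqP -> /eqP ->//]].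
have := (E i1, E i2, E i3); rewrite !mnmDE !mulmnE !mnm1E /=.
by rewrite !mul1n !mul0n !addn0 !add0n => -[[-> ->] ->].
Qed.

Lemma mcoeff_alternant a b c a' b' c' :
  (c < b < a)%N -> (c' < b' < a')%N ->
  (alternant y a b c)@_(mono3 a' b' c') = [&& a == a', b == b' & c == c']%:R.
Proof.
move=> /andP[lt1 lt2] /andP[lt1' lt2'].
have -> : alternant y a b c = 'X_[mono3 a b c] - 'X_[mono3 a c b] - 'X_[mono3 b a c]
    + 'X_[mono3 c a b] + 'X_[mono3 b c a] - 'X_[mono3 c b a].
  by rewrite -!mono3E /alternant; ring.
rewrite !mcoeffD !mcoeffN !mcoeffX !mono3_eq.
have -> : [&& a == a', c == b' & b == c'] = false by lia.
have -> : [&& b == a', a == b' & c == c'] = false by lia.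
have -> : [&& c == a', a == b' & b == c'] = false by lia.
have -> : [&& b == a', c == b' & a == c'] = false by lia.
have -> : [&& c == a', b == b' & a == c'] = false by lia.
by rewrite !subr0 !addr0.
Qed.

(** With decreasing exponents, the monomial x_1 ^ a x_2 ^ b x_3 ^ c occurs in one
    alternant only. *)
Lemma alternant_independent (L : seq (nat * nat * nat)) (F : nat * nat * nat -> R) :
  uniq L -> all (fun t => t.2 < t.1.2 < t.1.1)%N L ->
  \sum_(t <- L) F t *: alternant y t.1.1 t.1.2 t.2 = 0 ->
  forall t, t \in L -> F t = 0.
Proof.
move=> uL /allP strictL E t tL.
have := congr1 (mcoeff (mono3 t.1.1 t.1.2 t.2)) E.
rewrite raddf_sum mcoeff0 (bigD1_seq t) //= mcoeffZ mcoeff_alternant ?strictL //.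
rewrite !eqxx mulr1 big_seq_cond big1 ?addr0 // => t' /andP[t'L ne].
rewrite mcoeffZ mcoeff_alternant ?strictL //; case: and3P => [[/eqP h1 /eqP h2 /eqP h3]|_].
  by case/eqP: ne; move: t t' h1 h2 h3 {tL t'L} => [[? ?] ?] [[? ?] ?] /= -> -> ->.
by rewrite mulr0.
Qed.

Lemma sumX_neq0 (i j : 'I_3) : i != j -> 'X_i + 'X_j != 0 :> {mpoly R[3]}.
Proof.
move=> ne; apply/eqP => /(congr1 (mcoeff U_(i)%MM)).
by rewrite mcoeffD !mcoeffXU eqxx eq_sym (negPf ne) addr0 mcoeff0 => /eqP; rewrite oner_eq0.
Qed.

Lemma subX_neq0 (i j : 'I_3) : i != j -> 'X_i - 'X_j != 0 :> {mpoly R[3]}.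
Proof.
move=> ne; apply/eqP => /(congr1 (mcoeff U_(i)%MM)).
by rewrite mcoeffB !mcoeffXU eqxx eq_sym (negPf ne) subr0 mcoeff0 => /eqP; rewrite oner_eq0.
Qed.

Lemma vdm_X_neq0 : vdm y != 0.
Proof. by rewrite !mulf_neq0 // subX_neq0. Qed.

Lemma pairsums_X_neq0 : pairsums y != 0.
Proof. by rewrite !mulf_neq0 // sumX_neq0. Qed.

End AlternantMonomials.

(** Q_la for an arbitrary sequence q in place of the Q_i. *)
Definition Qseq (A : comNzRingType) (q : nat -> A) (la : seq nat) : A :=
  let la' := if odd (size la) then rcons la 0%N else la in
  pfaffian (pairing q) (size la') la'.

Lemma Qfun_Qseq (R : comNzRingType) n la : Qfun R n la = Qseq (Qgen R n) la.
Proof. by []. Qed.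

Section MapQseq.
Variables (A B : comNzRingType) (f : {rmorphism A -> B}).

Lemma map_pairing q a b : f (pairing q a b) = pairing (fun i => f (q i)) a b.
Proof.
rewrite /pairing rmorphD rmorphM rmorphMn rmorph_sum; congr (_ + _ *+ _).
by apply: eq_bigr => s _; rewrite !rmorphM rmorphXn rmorphN1.
Qed.

Lemma eq_pfaffian (T : comNzRingType) (M M' : nat -> nat -> T) fuel la :
  (forall a b, M a b = M' a b) -> pfaffian M fuel la = pfaffian M' fuel la.
Proof.
move=> E; elim: fuel la => [|fuel IH] [|x la] //=.
by apply: eq_bigr => j _; rewrite E IH.
Qed.

Lemma map_pfaffian M fuel la :
  f (pfaffian M fuel la) = pfaffian (fun a b => f (M a b)) fuel la.
Proof.
elim: fuel la => [|fuel IH] [|x la] //=; rewrite ?rmorph1 // rmorph_sum.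
by apply: eq_bigr => j _; rewrite !rmorphM rmorphXn rmorphN1 /= IH.
Qed.

Lemma map_Qseq q la : f (Qseq q la) = Qseq (fun i => f (q i)) la.
Proof.
by rewrite /Qseq map_pfaffian; apply: eq_pfaffian => a b; exact: map_pairing.
Qed.

Lemma map_Qseq_qcoef n (y : 'I_n -> A) (z : 'I_n -> B) la :
  (forall j, f (y j) = z j) -> f (Qseq (qcoef y) la) = Qseq (qcoef z) la.
Proof.
move=> E; rewrite map_Qseq; apply: eq_pfaffian => a b.
have Eq i : f (qcoef y i) = qcoef z i.
  by rewrite map_qcoef /qcoef /qser; under eq_bigr => j _ do rewrite E.
by rewrite /pairing !Eq; congr (_ + _ *+ _); apply: eq_bigr => s _; rewrite !Eq.
Qed.

Lemma eq_Qseq (q q' : nat -> A) la : q =1 q' -> Qseq q la = Qseq q' la.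
Proof.
move=> E; apply: eq_pfaffian => a b; rewrite /pairing !E; congr (_ + _ *+ _).
by apply: eq_bigr => s _; rewrite !E.
Qed.

End MapQseq.

Section Qseq3.
Variables (A : idomainType) (y : 'I_3 -> A).
Hypothesis vdm_nz : vdm y != 0.
Local Notation Q := (Qseq (qcoef y)).

Lemma Qseq_nil (B : comNzRingType) (q : nat -> B) : Qseq q [::] = 1.
Proof. by []. Qed.

Lemma Qseq1 (B : comNzRingType) (q : nat -> B) a : q 0%N = 1 -> Qseq q [:: a] = q a.
Proof. by move=> q0; rewrite /Qseq /= big_ord1 /= pairing0 // expr0 mul1r mulr1. Qed.

Lemma Qseq2 (B : comNzRingType) (q : nat -> B) a b : Qseq q [:: a; b] = pairing q a b.
Proof. by rewrite /Qseq /= big_ord1 /= expr0 mul1r mulr1. Qed.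

Lemma vdm_Qseq2 a b : vdm y * Q [:: a.+1; b.+1] = 4%:R * pairsums y * alternant y a.+1 b.+1 0.
Proof. by rewrite Qseq2; exact: vdm_pairing. Qed.

Lemma vdm_Qseq3 a b c :
  vdm y * Q [:: a.+1; b.+1; c.+1] = 8%:R * pairsums y * alternant y a.+1 b.+1 c.+1.
Proof. exact: vdm_pfaffian3. Qed.

Lemma Qseq_long la : 0%N \notin la -> (3 < size la)%N -> Q la = 0.
Proof.
move=> nz_la size_la; have pos : all (leq 1) la.
  by apply/allP => i il; rewrite lt0n; apply: contraNneq nz_la => <-.
rewrite /Qseq; case: ifP => odd_la; last by apply: pfaffian_even_zero; rewrite ?odd_la.
by apply: pfaffian_odd_zero => //; rewrite size_rcons.
Qed.

End Qseq3.

Section KernelThree.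
Local Notation Qn n := (Qfun {poly int} n).

(** The point (X, 1, -1): the factor x_2 + x_3 kills every Q-polynomial of length at
    least 2, and Q_d becomes 2 X ^ d. *)
Definition ev_pt (j : 'I_3) : {poly {poly int}} :=
  if j == ord0 then 'X else if j == lift ord0 ord0 then 1 else -1.

Lemma strict_cases la : is_strict la -> (size la <= 3)%N ->
  [\/ la = [::], exists a, la = [:: a.+1],
      exists a b, la = [:: a.+1; b.+1] /\ (b < a)%N |
      exists a b c, la = [:: a.+1; b.+1; c.+1] /\ (c < b < a)%N].
Proof.
case: la => [|a [|b [|c [|? ?]]]] //; rewrite /is_strict /= ?inE ?andbT => h _.
- by constructor 1.
- have a0 : (0 < a)%N by lia.
  by constructor 2; exists a.-1; rewrite prednK.
- have [a0 b0] : (0 < a)%N /\ (0 < b)%N by lia.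
  by constructor 3; exists a.-1, b.-1; rewrite !prednK //; split=> //; lia.
have [a0 b0 c0] : [/\ (0 < a)%N, (0 < b)%N & (0 < c)%N] by split; lia.
by constructor 4; exists a.-1, b.-1, c.-1; rewrite !prednK //; split=> //; lia.
Qed.

Lemma ev_vdm_neq0 : vdm ev_pt != 0.
Proof.
rewrite /vdm /ev_pt /= !mulf_neq0 //.
- by rewrite -polyC1 polyXsubC_eq0.
- by rewrite -polyC1 -polyCN polyXsubC_eq0.
by rewrite opprK -mulr2n -polyC_natr polyC_eq0 -polyC_natr polyC_eq0.
Qed.

Let ev : {rmorphism {mpoly {poly int}[3]} -> {poly {poly int}}} := mmap (@polyC _) ev_pt.

Lemma ev_Qfun la : ev (Qn 3 la) = Qseq (qcoef ev_pt) la.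
Proof. by rewrite Qfun_Qseq; apply: map_Qseq_qcoef => j; rewrite /ev /= mmapX mmap1U. Qed.

Lemma ev_qcoef d : qcoef ev_pt d.+1 = 2%:R * 'X^(d.+1).
Proof.
apply: (mulfI ev_vdm_neq0); rewrite vdm_qcoef /vdm /ev_pt /=.
by rewrite [1 + -1]subrr; ring.
Qed.

Lemma ev_pairsums : pairsums ev_pt = 0.
Proof. by rewrite /pairsums /ev_pt /= [1 + -1]subrr mulr0. Qed.

Lemma coef_ev_Qfun la mu : is_strict la -> (size la <= 3)%N -> (size mu <= 1)%N ->
  is_strict mu -> (ev (Qn 3 la))`_(head 0%N mu) = (la == mu)%:R *+ (size mu).+1.
Proof.
rewrite ev_Qfun => strict_la size_la size_mu strict_mu.
have q0 := qcoef0 ev_pt.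
have nz (x : {poly {poly int}}) : vdm ev_pt * x = 0 -> x = 0.
  by move/eqP; rewrite mulf_eq0 (negPf ev_vdm_neq0) /= => /eqP.
case: (strict_cases strict_la size_la) => [->|[a ->]|[a [b [-> _]]]|[a [b [c [-> _]]]]].
- rewrite Qseq_nil coef1; case: mu size_mu strict_mu => [|[|m] []] //= _ _.
  by rewrite mul0rn.
- rewrite Qseq1 // ev_qcoef mulr_natl coefMn coefXn.
  case: mu size_mu strict_mu => [|m []] //= _ _; first by rewrite !mul0rn.
  by rewrite eqseq_cons andbT eq_sym.
- have -> : Qseq (qcoef ev_pt) [:: a.+1; b.+1] = 0.
    by apply: nz; rewrite (vdm_Qseq2 ev_vdm_neq0) ev_pairsums mulr0 mul0r.
  rewrite coef0.
  by case: mu size_mu strict_mu => [|m []] //= _ _; rewrite ?eqseq_cons ?andbF mul0rn.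
have -> : Qseq (qcoef ev_pt) [:: a.+1; b.+1; c.+1] = 0.
  by apply: nz; rewrite (vdm_Qseq3 ev_vdm_neq0) ev_pairsums mulr0 mul0r.
rewrite coef0.
by case: mu size_mu strict_mu => [|m []] //= _ _; rewrite ?eqseq_cons ?andbF mul0rn.
Qed.

Let X3 := (fun j : 'I_3 => 'X_j : {mpoly {poly int}[3]}).

Definition pad3 (la : seq nat) : nat * nat * nat := (nth 0 la 0, nth 0 la 1, nth 0 la 2)%N.

Lemma vdm_Qfun la : is_strict la -> (1 < size la <= 3)%N ->
  vdm X3 * Qn 3 la = pairsums X3 *
    (2%:R ^+ size la *: alternant X3 (pad3 la).1.1 (pad3 la).1.2 (pad3 la).2).
Proof.
move=> strict_la /andP[gt1 le3]; have nz : vdm X3 != 0 := vdm_X_neq0 _.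
case: (strict_cases strict_la le3) gt1 => [->|[a ->]|[a [b [-> _]]]|[a [b [c [-> _]]]]] //= _.
  rewrite Qfun_Qseq (vdm_Qseq2 nz) -mul_mpolyC rmorphXn rmorph_nat.
  by move: (pairsums _) (alternant _ _ _ _) => p t; ring.
rewrite Qfun_Qseq (vdm_Qseq3 nz) -mul_mpolyC rmorphXn rmorph_nat.
by move: (pairsums _) (alternant _ _ _ _) => p t; ring.
Qed.

(** Lengths 0 and 1 are isolated at the point [ev_pt]. In the remaining
    lengths 2 and 3 the common factor prod_(i < j) (x_i + x_j) cancels and leaves
    alternants. *)
Lemma Qfun3_independent (L : seq (seq nat)) (a : seq nat -> {poly int}) :
  uniq L -> all (fun la => is_strict la && (size la <= 3)%N) L ->
  \sum_(la <- L) a la *: Qn 3 la = 0 -> forall la, la \in L -> a la = 0.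
Proof.
move=> uL /allP HL E.
have small mu : mu \in L -> (size mu <= 1)%N -> a mu = 0.
  move=> muL size_mu; have /andP[strict_mu _] := HL mu muL.
  have := congr1 (fun p => (ev p)`_(head 0%N mu)) E.
  rewrite rmorph_sum coef_sum rmorph0 coef0.
  have termE la : la \in L -> (ev (a la *: Qn 3 la))`_(head 0%N mu)
      = a la * ((la == mu)%:R *+ (size mu).+1).
    move=> /HL /andP[strict_la size_la]; rewrite -mul_mpolyC rmorphM /= mmapC coefCM.
    by rewrite coef_ev_Qfun.
  rewrite (bigD1_seq mu) //= termE // eqxx big_seq_cond big1 => [|la /andP[laL /negPf ne]].
    rewrite addr0 -[_ *+ _]mulr_natl mulr1 => /eqP; rewrite mulf_eq0 => /orP[/eqP //|].
    by rewrite -polyC_natr polyC_eq0 pnatr_eq0.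
  by rewrite termE // ne mul0rn mulr0.
pose L' := [seq la <- L | (1 < size la)%N].
have E' : \sum_(la <- L') a la *: Qn 3 la = 0.
  rewrite -[RHS]E [RHS](bigID (fun la => 1 < size la)%N) /= big_filter [X in _ + X]big1_seq ?addr0 //.
  by move=> la /andP[]; rewrite -leqNgt => le1 laL; rewrite small ?scale0r.
have HL' la : la \in L' -> [/\ is_strict la, (1 < size la <= 3)%N & la \in L].
  by rewrite mem_filter => /andP[gt1 laL]; have /andP[-> ->] := HL la laL; rewrite gt1.
have padK la : la \in L' -> [seq i <- [:: (pad3 la).1.1; (pad3 la).1.2; (pad3 la).2] | i != 0%N] = la.
  move=> /HL' [strict_la /andP[gt1 le3] _].
  by case: (strict_cases strict_la le3) gt1 => [->|[x ->]|[x [y [-> _]]]|[x [y [z [-> _]]]]].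
pose unpad (t : nat * nat * nat) := [seq i <- [:: t.1.1; t.1.2; t.2] | i != 0%N].
pose F t := a (unpad t) * 2%:R ^+ size (unpad t).
have E2 : \sum_(t <- [seq pad3 la | la <- L']) F t *: alternant X3 t.1.1 t.1.2 t.2 = 0.
  apply: (mulfI (pairsums_X_neq0 _)); rewrite mulr0.
  rewrite -[RHS](mulr0 (vdm X3)) -[in RHS]E' big_map !mulr_sumr.
  rewrite big_seq [RHS]big_seq; apply: eq_bigr => la laL'.
  have [strict_la szla _] := HL' la laL'.
  rewrite -[RHS]scalerAr vdm_Qfun // /F /unpad padK // -scalerA.
  exact/esym/scalerAr.
move=> la laL; case: (leqP (size la) 1) => [/(small la laL) //|gt1].
have laL' : la \in L' by rewrite mem_filter gt1.
have := alternant_independent _ _ E2 (map_f _ laL'); rewrite /F /unpad padK //.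
move=> H; suff /eqP : a la * 2%:R ^+ size la = 0.
  by rewrite mulf_eq0 expf_eq0 -polyC_natr polyC_eq0 andbF orbF => /eqP.
apply: H.
  rewrite map_inj_in_uniq ?filter_uniq // => x y xL yL Exy.
  by rewrite -(padK x) // -(padK y) // Exy.
apply/allP => _ /mapP[mu /HL' [strict_mu /andP[g l] _] ->].
case: (strict_cases strict_mu l) g => [->|[x ->]|[x [y [-> lt]]]|[x [y [z [-> lt]]]]] //= _; lia.
Qed.

Lemma Qfun3_long la : is_strict la -> (3 < size la)%N -> Qn 3 la = 0.
Proof. by move=> /andP[_ nz]; exact: (Qseq_long (vdm_X_neq0 _)). Qed.

(** In three variables the strict partitions of length at least 4 give 0 and
    the others are independent, so a relation there only involves long
    partitions. *)
Theorem Q_kernel3 (s : seq ({poly int} * seq nat)) :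
  all (fun c => is_strict c.2) s -> \sum_(c <- s) c.1 *: Qn 3 c.2 = 0 ->
  forall n, \sum_(c <- s) c.1 *: Qn n c.2
    = \sum_(c <- [seq c <- s | (3 < size c.2)%N]) c.1 *: Qn n c.2.
Proof.
move=> /allP strict_s E n.
pose s' := [seq c <- s | (size c.2 <= 3)%N].
pose L := undup [seq c.2 | c <- s'].
have subL : {subset [seq c.2 | c <- s'] <= L} by move=> x; rewrite mem_undup.
have splitE m : \sum_(c <- s) c.1 *: Qn m c.2
    = \sum_(c <- s') c.1 *: Qn m c.2
      + \sum_(c <- [seq c <- s | (3 < size c.2)%N]) c.1 *: Qn m c.2.
  rewrite !big_filter (bigID (fun c => size c.2 <= 3)%N) /=; congr (_ + _).
  by apply: eq_bigl => c; rewrite ltnNge.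
rewrite splitE (big_group (Qn n) (undup_uniq _) subL) -/L.
rewrite big_seq big1 ?add0r // => la laL.
rewrite (@Qfun3_independent L (coef_at s') _ _ _ la laL) ?undup_uniq ?scale0r //.
  apply/allP => mu; rewrite mem_undup => /mapP[c]; rewrite mem_filter => /andP[le cs] ->.
  by rewrite (strict_s _ cs) le.
rewrite -(big_group (Qn 3) (undup_uniq _) subL) -[RHS]E splitE [X in _ + X]big1_seq ?addr0 //.
move=> c; rewrite mem_filter => /and3P[_ gt3 cs].
by have h := strict_s _ cs; rewrite Qfun3_long ?scaler0.
Qed.

End KernelThree.

(** * The Legendre substitution *)

Section LegendreMorphism.
Variable n : nat.

Definition half_u : {mpoly rat[n + 1]} := (1 / 2%:R : rat) *: u_class n.
Definition legendre_root (i : 'I_n) : {mpoly rat[n + 1]} := half_u - alpha 1 i.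

Definition t_value : {rmorphism {poly int} -> {mpoly rat[n + 1]}} :=
  horner_eval (- half_u) \o map_poly intr.

Definition legendre_hom : {rmorphism {mpoly {poly int}[n]} -> {mpoly rat[n + 1]}} :=
  mmap t_value legendre_root.

Lemma Legendre_hom (F : symfun_t) : Legendre n F = legendre_hom (F n).
Proof. by []. Qed.

Lemma legendre_homX i : legendre_hom 'X_i = legendre_root i.
Proof. by rewrite /legendre_hom /= mmapX mmap1U. Qed.

Lemma legendre_homC c : legendre_hom c%:MP = t_value c.
Proof. exact: mmapC. Qed.

Lemma legendre_homZ c p : legendre_hom (c *: p) = t_value c * legendre_hom p.
Proof. by rewrite -mul_mpolyC rmorphM /= legendre_homC. Qed.

Lemma t_valueX : t_value 'X = - half_u.
Proof. by rewrite /t_value /= /horner_eval map_polyX hornerX. Qed.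

Lemma t_valueC (c : int) : t_value c%:P = c%:~R.
Proof. by rewrite /t_value /= /horner_eval map_polyC hornerC. Qed.

Lemma legendre_Qfun la : legendre_hom (Qfun _ n la) = Qseq (qcoef legendre_root) la.
Proof. by rewrite Qfun_Qseq; apply: map_Qseq_qcoef => j; exact: legendre_homX. Qed.

(* u = - 2 t and alpha_i = - t - x_i invert the substitution *)
Let back_var (l : 'I_(n + 1)) : {mpoly {poly rat}[n]} :=
  match split l with
  | inl i => - ('X)%:MP - 'X_i
  | inr _ => - (2%:R * ('X)%:MP)
  end.

Let back : {rmorphism {mpoly rat[n + 1]} -> {mpoly {poly rat}[n]}} :=
  mmap (@mpolyC n {poly rat} \o @polyC rat) back_var.

Lemma back_half_u : back half_u = - ('X)%:MP.
Proof.
rewrite /half_u /u_class /beta -mul_mpolyC rmorphM /= mmapC mmapX mmap1U /= /back_var.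
rewrite (unsplitK (inr ord0)) mulrN mulrA -[RHS]mulN1r -mulNr; congr (_ * _); congr (- _).
rewrite -(rmorph_nat (@mpolyC n {poly rat})) -(rmorph_nat (@polyC rat)) -mpolyCM -polyCM.
by rewrite mul1r mulVf // polyC1 mpolyC1.
Qed.

Lemma back_root i : back (legendre_root i) = 'X_i.
Proof.
rewrite /legendre_root rmorphB back_half_u /alpha /= mmapX mmap1U /back_var.
by rewrite (unsplitK (inl i)) opprD opprK addrA addNr add0r opprK.
Qed.

Lemma back_t c : back (t_value c) = (map_poly intr c)%:MP.
Proof.
elim/poly_ind: c => [|p c IH]; first by rewrite !rmorph0.
have -> : map_poly intr (p * 'X + c%:P) = map_poly intr p * 'X + (c%:~R)%:P :> {poly rat}.
  by rewrite rmorphD rmorphM /= map_polyX map_polyC.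
rewrite mpolyCD mpolyCM (rmorphD t_value) (rmorphM t_value) (rmorphD back) (rmorphM back) IH.
rewrite t_valueX rmorphN back_half_u opprK t_valueC; congr (_ + _).
by rewrite (rmorph_int back) (rmorph_int (@polyC rat)) (rmorph_int (@mpolyC n {poly rat})).
Qed.

Lemma back_legendre p : back (legendre_hom p) = map_mpoly (map_poly intr) p.
Proof.
rewrite -[legendre_hom p]/(\sum_(m <- msupp p) t_value p@_m * mmap1 legendre_root m).
rewrite /map_mpoly /mmap (rmorph_sum back); apply: eq_bigr => m _.
rewrite (rmorphM back) back_t; congr (_ * _).
rewrite /mmap1 (rmorph_prod back); apply: eq_bigr => i _.
by rewrite (rmorphXn back) back_root.
Qed.

(** The substitution is linear and invertible over the rationals. *)
Lemma legendre_hom_inj : injective legendre_hom.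
Proof.
move=> p q E; have {}E : map_mpoly (map_poly intr) p = map_mpoly (map_poly intr) q
    :> {mpoly {poly rat}[n]} by rewrite -(back_legendre p) E back_legendre.
apply/mpolyP => m; have := congr1 (mcoeff m) E; rewrite !mcoeff_map_mpoly.
by apply: map_inj_poly => //; exact: intr_inj.
Qed.

End LegendreMorphism.

Section Restriction.
Variables (m n : nat).
Hypothesis le_nm : (n <= m)%N.

Let var (j : 'I_m) : {mpoly {poly int}[n]} :=
  if insub (j : nat) is Some i then 'X_i else 0.

Definition restrict : {rmorphism {mpoly {poly int}[m]} -> {mpoly {poly int}[n]}} :=
  mmap (@mpolyC n _) var.

Lemma restrict_Qfun la : restrict (Qfun _ m la) = Qfun _ n la.
Proof.
rewrite !Qfun_Qseq map_Qseq; apply: eq_Qseq => d.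
rewrite Qgen_qcoef map_qcoef; apply: (@qcoef_restrict _ m n _ _ d le_nm) => [i|j le_nj].
  by rewrite /restrict /= mmapX mmap1U /var /= insubT //= => lt; congr 'X_[U_(_)]; exact: val_inj.
by rewrite /restrict /= mmapX mmap1U /var /= insubF // ltnNge le_nj.
Qed.

Lemma restrict_sum (I : Type) (s : seq I) (a : I -> {poly int}) (la : I -> seq nat) :
  restrict (\sum_(c <- s) a c *: Qfun _ m (la c)) = \sum_(c <- s) a c *: Qfun _ n (la c).
Proof.
rewrite (rmorph_sum restrict); apply: eq_bigr => c _.
rewrite -mul_mpolyC (rmorphM restrict) restrict_Qfun -mul_mpolyC; congr (_ * _).
exact: mmapC.
Qed.

End Restriction.

Lemma in_Gamma_span (F : symfun_t) : in_Gamma_t F -> Q_span F.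
Proof.
move=> [G E].
pose la (m : monalg.cmonom nat) := flatten [seq nseq (m i) i.+1 | i <- finsupp m].
apply: (@Q_span_ext (fun n => \sum_(m <- monalg.msupp G) monalg.mcoeff m G *: qmon (la m) n)).
  by apply: Q_span_sum => m _; apply: Q_spanZ; exact: qmon_span.
move=> n; rewrite E /infpoly_eval /monalg.mmap; apply: eq_bigr => m _.
rewrite mul_mpolyC; congr (_ *: _); rewrite /qmon /la big_flatten big_map.
by apply: eq_bigr => i _; rewrite big_nseq iter_mulr_1.
Qed.

(** The difference vanishes in three variables, so [Q_kernel3] applies. *)
Lemma Q_span_congr (P K : symfun_t) : Q_span P -> Q_span K -> P 3 = K 3 ->
  congr_mod_long P K.
Proof.
move=> hP hK E; have [s [strict_s Es]] := Q_spanD hP (Q_spanZ (-1) hK).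
have E3 : \sum_(c <- s) c.1 *: Qfun _ 3 c.2 = 0 by rewrite -Es E scaleN1r subrr.
exists [seq c <- s | (3 < size c.2)%N]; split.
  apply/allP => c; rewrite mem_filter => /andP[gt3 cs].
  by rewrite (allP strict_s c cs) gt3.
by move=> n; rewrite -(Q_kernel3 strict_s E3) -Es scaleN1r.
Qed.

Section Homogeneous.
Variables (m n : nat) (y : 'I_n -> {mpoly rat[m]}).
Hypothesis y_homog : forall j, y j \is 1.-homog.

Let graded (p : {poly {mpoly rat[m]}}) := forall k, p`_k \is k.-homog.

Let gradedM p q : graded p -> graded q -> graded (p * q).
Proof.
move=> hp hq k; rewrite coefM; apply: rpred_sum => i _.
by have := dhomogM (hp i) (hq (k - i)%N); rewrite subnKC // -ltnS.
Qed.

Lemma qcoef_homog d : qcoef y d \is d.-homog.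
Proof.
suff : graded (qser y d) by apply.
rewrite /qser; elim/big_rec: _ => [|j p _ hp].
  by move=> [|k]; rewrite coef1 ?dhomog0 ?dhomog1.
have yX k : y j ^+ k \is k.-homog by have := dhomogMn k (y_homog j); rewrite mul1n.
apply: gradedM => //; apply: gradedM => k.
  rewrite coefD coefZ coef1 coefX.
  by case: k => [|[|k]] /=; rewrite ?mulr0 ?addr0 ?add0r ?mulr1 ?dhomog0 ?dhomog1.
by rewrite coef_geom; case: ifP; rewrite ?dhomog0.
Qed.

Lemma pairing_homog i j : pairing (qcoef y) i j \is (i + j).-homog.
Proof.
apply: rpredD; first exact: dhomogM (qcoef_homog _) (qcoef_homog _).
rewrite rpredMn // big_nat; apply: rpred_sum => s /andP[_ les]; rewrite -mulrA -signr_odd.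
have h : qcoef y (i + s) * qcoef y (j - s) \is (i + j).-homog.
  have := dhomogM (qcoef_homog (i + s)) (qcoef_homog (j - s)).
  by have -> : (i + s + (j - s) = i + j)%N by lia.
by case: odd; rewrite ?expr1 ?expr0 ?mulN1r ?rpredN ?mul1r.
Qed.

Lemma pfaffian_homog fuel la : (size la <= fuel)%N -> ~~ odd (size la) ->
  pfaffian (pairing (qcoef y)) fuel la \is (sumn la).-homog.
Proof.
elim: fuel la => [|fuel IH] [|x la] //=; rewrite ?dhomog1 // ltnS => le_la odd_la.
apply: rpred_sum => j _; rewrite -mulrA -signr_odd.
have perm := take_nth_drop (ltn_ord j).
have h : pairing (qcoef y) x (nth 0%N la j)
    * pfaffian (pairing (qcoef y)) fuel (take j la ++ drop j.+1 la)
    \is (x + sumn la).-homog.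
  rewrite (perm_sumn perm) /= addnA dhomogM ?pairing_homog // IH ?size_delete //; first by lia.
  by move: odd_la (ltn_ord j); lia.
by case: odd; rewrite ?expr1 ?expr0 ?mulN1r ?rpredN ?mul1r.
Qed.

Lemma Qseq_homog la : Qseq (qcoef y) la \is (sumn la).-homog.
Proof.
rewrite /Qseq; case: ifP => odd_la; last by rewrite pfaffian_homog // odd_la.
by rewrite -[sumn la]addn0 -sumn_rcons pfaffian_homog // size_rcons /= odd_la.
Qed.

End Homogeneous.

(** Comparing homogeneous components, a homogeneous nonzero factor forces the
    other one to be homogeneous. *)
Lemma homog_cancel r c D (A B : {mpoly rat[r]}) :
  A != 0 -> A \is c.-homog -> A * B \is D.-homog -> exists e, B \is e.-homog.
Proof.
move=> A_nz hA hAB; exists (D - c)%N.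
have part d : pihomog mdeg (c + d) (A * B) = A * pihomog mdeg d B.
  rewrite {1}[B](pihomog_partitionE (mf := mdeg) (leqnn (msize B))) mulr_sumr raddf_sum /=.
  have [lt|ge] := ltnP d (msize B).
    rewrite (bigD1 (Ordinal lt)) //= pihomog_dE ?dhomogM ?pihomogP // big1 ?addr0 // => e ne.
    rewrite (@pihomog_ne0 _ _ _ (c + e)) ?dhomogM ?pihomogP //.
    by rewrite eqn_add2l; apply: contraNneq ne => E; apply/eqP/val_inj.
  rewrite big1 => [|e _]; last first.
    rewrite (@pihomog_ne0 _ _ _ (c + e)) ?dhomogM ?pihomogP //.
    by rewrite eqn_add2l ltn_eqF // (leq_trans _ ge).
  apply/esym; suff -> : pihomog mdeg d B = 0 by rewrite mulr0.
  rewrite /pihomog big1_seq // => m /andP[/eqP E /msize_mdeg_lt]; rewrite E.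
  by move=> /(leq_trans) /(_ ge); rewrite ltnn.
rewrite {1}[B](pihomog_partitionE (mf := mdeg) (leqnn (msize B))).
apply: rpred_sum => e _; have [->|ne] := eqVneq (e : nat) (D - c)%N; first exact: pihomogP.
suff : A * pihomog mdeg e B = 0.
  by move/eqP; rewrite mulf_eq0 (negPf A_nz) => /eqP ->; exact: dhomog0.
have [|neD] := eqVneq D (c + e)%N; first by move=> E; move: ne; rewrite E addKn eqxx.
by rewrite -part (pihomog_ne0 neD).
Qed.

(** * Jacobi-Trudi determinants and conjugate partitions *)

Section JacobiTrudi.
Variables (A : comNzRingType) (c : nat -> A).

Definition jt_entry (nu : seq nat) (i j : nat) : A :=
  if (i <= nth 0%N nu i + j)%N then c (nth 0%N nu i + j - i) else 0.

(** The Jacobi-Trudi determinant of nu for an arbitrary sequence c; it is the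
    Schur polynomial of the conjugate partition. *)
Definition jt_det (nu : seq nat) : A :=
  \det (\matrix_(i < size nu, j < size nu) jt_entry nu i j).

End JacobiTrudi.

Lemma map_jt_det (A B : comNzRingType) (f : {rmorphism A -> B}) c nu :
  f (jt_det c nu) = jt_det (fun i => f (c i)) nu.
Proof.
rewrite /jt_det -det_map_mx; congr (\det _); apply/matrixP => i j.
by rewrite !mxE /jt_entry; case: ifP; rewrite ?rmorph0.
Qed.

Lemma eq_jt_det (A : comNzRingType) (c c' : nat -> A) nu : c =1 c' -> jt_det c nu = jt_det c' nu.
Proof.
by move=> E; congr (\det _); apply/matrixP => i j; rewrite !mxE /jt_entry E.
Qed.

(** A partition and its conjugate are Galois dual: the box (i, k) is in the
    diagram or not. *)
Lemma count_gt_nth nu i k : sorted geq nu ->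
  (i < count (fun x => k < x)%N nu)%N = (k < nth 0%N nu i)%N.
Proof.
elim: nu i => [|x nu IH] i /=; first by rewrite nth_nil.
rewrite (path_sortedE geq_trans) => /andP[/allP le_x /IH {}IH].
have [lt_kx|le_xk] := ltnP k x; first by case: i => [|i] /=; rewrite ?lt_kx // ltnS IH.
have -> : count (fun z => k < z)%N nu = 0%N.
  by apply/eqP; rewrite -leqn0 leqNgt -has_count; apply/hasPn => z /le_x /=; lia.
rewrite ltn0; case: i => [|i] /=; first by rewrite ltnNge le_xk.
have [lt_i|ge_i] := ltnP i (size nu); last by rewrite nth_default.
by have /= := le_x _ (mem_nth 0%N lt_i); lia.
Qed.

Lemma head_nth0 (s : seq nat) : head 0%N s = nth 0%N s 0.
Proof. by case: s. Qed.

Lemma nth_conj nu i : sorted geq nu -> nth 0%N (conj_part nu) i = count (fun x => i < x)%N nu.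
Proof.
move=> srt; have [lt|ge] := ltnP i (head 0%N nu).
  by rewrite (nth_map 0%N) ?size_iota // nth_iota.
rewrite nth_default ?size_map ?size_iota //.
apply/esym/eqP; rewrite -leqn0 leqNgt count_gt_nth // -head_nth0; lia.
Qed.

Lemma size_conj nu : size (conj_part nu) = head 0%N nu.
Proof. by rewrite size_map size_iota. Qed.

Section Conjugate.
Variable nu : seq nat.
Hypothesis part_nu : is_partition nu.

Let sorted_nu : sorted geq nu.
Proof. by case/andP: part_nu. Qed.

Lemma head_conj : head 0%N (conj_part nu) = size nu.
Proof.
rewrite head_nth0 nth_conj //; apply/eqP; rewrite -all_count; apply/allP => x xnu.
by rewrite lt0n; apply: contraTneq xnu => ->; case/andP: part_nu.
Qed.

Lemma conj_partition : is_partition (conj_part nu).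
Proof.
apply/andP; split.
  apply/(sortedP 0%N) => i _; rewrite !nth_conj //=; apply: sub_count => x /=; lia.
apply/negP => h; case/(nthP 0%N): h => i; rewrite size_conj => lt; rewrite nth_conj // => E.
by move: lt; rewrite head_nth0 -count_gt_nth // E.
Qed.

Lemma conj_partK : conj_part (conj_part nu) = nu.
Proof.
have srt : sorted geq (conj_part nu) by case/andP: conj_partition.
apply: (@eq_from_nth _ 0%N) => [|i _]; first by rewrite size_conj head_conj.
rewrite nth_conj //; apply/eqP; rewrite eqn_leq; apply/andP; split; rewrite leqNgt; apply/negP.
  by rewrite count_gt_nth // nth_conj // count_gt_nth // ltnn.
by rewrite -count_gt_nth // -nth_conj // -count_gt_nth // ltnn.
Qed.

(** A partition contains (4, 4) when its conjugate has at least four parts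
    that are at least 2. *)
Lemma conj_thick : contains (conj_part nu) [:: 4; 4]%N = (1 < nth 0%N nu 3)%N.
Proof.
rewrite /contains /= andbT !nth_conj // !count_gt_nth //.
by apply/andP/idP => [[]|h] //; split=> //; lia.
Qed.

Lemma schur_conj : schur (conj_part nu) = jt_det chern_var nu.
Proof. by rewrite /schur conj_partK head_conj. Qed.

End Conjugate.

(** sigma i is the number of j with sigma j < sigma i. Symmetrizing the double
    sum so obtained, a pair i, j contributes f i or f j, and the identity always
    picks the smaller one. *)
Lemma rearrangement n (f : 'I_n -> nat) (s : 'S_n) :
  (forall i j : 'I_n, (i <= j)%N -> (f j <= f i)%N) ->
  (\sum_i f i * i <= \sum_i f i * s i)%N.
Proof.
move=> dec.
have count_lt (m : 'I_n) : (\sum_(j < n) (j < m) = m)%N.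
  have -> : (\sum_(j < n) (j < m) = minn n m)%N.
    move: (nat_of_ord m) => k0; elim: (n) => [|k IH]; first by rewrite big_ord0 min0n.
    by rewrite big_ord_recr /= IH; lia.
  by rewrite (minn_idPr (ltnW (ltn_ord m))).
have expand (t : 'S_n) : (2 * \sum_i f i * t i
    = \sum_i \sum_j (f i * (t j < t i) + f j * (t i < t j)))%N.
  have E : (\sum_i f i * t i = \sum_i \sum_j f i * (t j < t i))%N.
    apply: eq_bigr => i _; rewrite -big_distrr /=; congr (_ * _)%N.
    by rewrite -{1}(count_lt (t i)) (reindex_inj (@perm_inj _ t)).
  rewrite mul2n -addnn {2}E exchange_big /= E -big_split; apply: eq_bigr => i _.
  by rewrite -big_split.
rewrite -(leq_pmul2l (ltn0Sn 1)) expand.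
have := expand 1%g; under eq_bigr do rewrite perm1.
move=> ->; apply: leq_sum => i _; apply: leq_sum => j _; rewrite !perm1.
case: (ltngtP i j) => [lt|lt|E].
- have := dec i j (ltnW lt); case: (ltngtP (s i) (s j)) => [_|_|/val_inj/perm_inj E] /=; try lia.
  by move: lt; rewrite E ltnn.
- have := dec j i (ltnW lt); case: (ltngtP (s i) (s j)) => [_|_|/val_inj/perm_inj E] /=; try lia.
  by move: lt; rewrite E ltnn.
by rewrite !muln0.
Qed.

(** * Schur polynomials span *)

Section SchurSpan.
Local Notation family := (forall A : comNzRingType, (nat -> A) -> A).

(** Integral combinations of Jacobi-Trudi determinants that hold for every
    sequence c in every commutative ring. Such an identity applies at once to
    the variables c_i and to their images in Chern roots. *)
Definition schur_span (F : family) : Prop :=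
  exists s : seq (int * seq nat), all (fun p => is_partition p.2) s /\
    forall (A : comNzRingType) (c : nat -> A), c 0%N = 1 ->
      F A c = \sum_(p <- s) p.1%:~R * jt_det c p.2.

Lemma schur_span_ext (F G : family) : schur_span F ->
  (forall (A : comNzRingType) (c : nat -> A), c 0%N = 1 -> F A c = G A c) -> schur_span G.
Proof. by move=> [t [ht E]] EFG; exists t; split=> // A c c0; rewrite -EFG // E. Qed.

Lemma schur_spanD (F G : family) : schur_span F -> schur_span G ->
  schur_span (fun A c => F A c + G A c).
Proof.
move=> [t [ht E]] [u [hu EG]]; exists (t ++ u); rewrite all_cat ht; split=> // A c c0.
by rewrite E // EG // big_cat.
Qed.

Lemma schur_spanZ (k : int) (F : family) : schur_span F ->
  schur_span (fun A c => k%:~R * F A c).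
Proof.
move=> [t [ht E]]; exists [seq (k * x.1, x.2) | x <- t]; split; first by rewrite all_map.
move=> A c c0; rewrite E // big_map mulr_sumr; apply: eq_bigr => x _.
by rewrite intrM mulrA.
Qed.

Lemma schur_span0 : schur_span (fun A c => 0).
Proof. by exists [::]; split=> // A c _; rewrite big_nil. Qed.

Lemma schur_span_sum (I : eqType) (s : seq I) (F : I -> family) :
  (forall i, i \in s -> schur_span (F i)) -> schur_span (fun A c => \sum_(i <- s) F i A c).
Proof.
elim: s => [|i s IH] h.
  by apply: schur_span_ext schur_span0 _ => A c _; rewrite big_nil.
apply: schur_span_ext (schur_spanD (h i (mem_head _ _)) (IH _)) _.
  by move=> j js; apply: h; rewrite inE js orbT.
by move=> A c _; rewrite big_cons.
Qed.

Lemma schur_span_jt nu : is_partition nu -> schur_span (fun A c => jt_det c nu).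
Proof.
by move=> h; exists [:: (1, nu)]; rewrite /= h; split=> // A c _; rewrite big_seq1 mul1r.
Qed.

(** The monomial of the permutation s in the Leibniz expansion of a
    Jacobi-Trudi determinant. *)
Definition jt_index (la : seq nat) (s : 'S_(size la)) : seq nat :=
  [seq (nth 0 la i + s i - i)%N | i : 'I_(size la) <- enum 'I_(size la)].

Lemma sum_perm_ord n (s : 'S_n) (f : nat -> nat) : (\sum_(i < n) f (s i) = \sum_(i < n) f i)%N.
Proof. by rewrite [RHS](reindex_inj (@perm_inj _ s)). Qed.

(** The equality case of sum i s_i <= sum (i ^ 2 + s_i ^ 2) / 2. *)
Lemma square_perm n (s : 'S_n) : s != 1%g -> (\sum_(i < n) i * s i < \sum_(i < n) i ^ 2)%N.
Proof.
move=> s_neq1; have [j sj] : exists j, s j != j.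
  apply/existsP; apply: contraR s_neq1 => /existsPn h; apply/eqP/permP => j.
  by rewrite perm1; apply/eqP/negPn.
rewrite -(ltn_pmul2l (ltn0Sn 1)).
have -> : (2 * \sum_(i < n) i ^ 2 = \sum_(i < n) (i ^ 2 + s i ^ 2))%N.
  by rewrite big_split /= (sum_perm_ord s (fun i => i ^ 2)%N) mul2n -addnn.
rewrite big_distrr (bigD1 j) //= [X in (_ < X)%N](bigD1 j) //= -addSn; apply: leq_add.
  by have [le eq] := nat_Cauchy j (s j); rewrite ltn_neqAle le eq andbT eq_sym (inj_eq val_inj).
by apply: leq_sum => i _; exact: nat_Cauchy.
Qed.

Section JtIndex.
Variables (la : seq nat) (s : 'S_(size la)).
Hypothesis fits : [forall i : 'I_(size la), i <= nth 0 la i + s i]%N.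

Let sum_nth (f : nat -> nat) : sumn [seq f i | i <- la] = (\sum_(i < size la) f (nth 0 la i))%N.
Proof. by rewrite sumnE big_map (big_nth 0%N) big_mkord. Qed.

Let sum_index (f : nat -> nat) :
  sumn [seq f i | i <- jt_index s] = (\sum_(i < size la) f (nth 0 la i + s i - i))%N.
Proof. by rewrite sumnE big_map big_map big_enum. Qed.

Let fitsE (i : 'I_(size la)) : (nth 0 la i + s i - i + i = nth 0 la i + s i)%N.
Proof. by rewrite subnK //; exact: (forallP fits). Qed.

Lemma sumn_jt_index : sumn (jt_index s) = sumn la.
Proof.
rewrite -[jt_index s]map_id -[in RHS](map_id la) sum_nth sum_index.
apply/eqP; rewrite -(eqn_add2r (\sum_(i < size la) i)) -big_split /=.
by rewrite (eq_bigr _ (fun i _ => fitsE i)) big_split (sum_perm_ord s id).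
Qed.

(** Write m_i = la_i + s_i - i. Then sum m_i ^ 2 - sum la_i ^ 2 is twice
    sum la_i (s_i - i), which is nonnegative by [rearrangement], plus
    sum (s_i - i) ^ 2, which is positive. *)
Lemma sumsq_jt_index : sorted geq la -> s != 1%g -> (sumsq la < sumsq (jt_index s))%N.
Proof.
move=> srt s_neq1; rewrite /sumsq sum_nth sum_index.
have R : (\sum_(i < size la) nth 0 la i * i <= \sum_(i < size la) nth 0 la i * s i)%N.
  apply: rearrangement => i j le_ij.
  apply: (sorted_leq_nth geq_trans leqnn 0%N srt); rewrite ?inE //.
have S := square_perm s_neq1.
have E : (\sum_(i < size la) (nth 0 la i + s i - i) ^ 2 + 2 * (\sum_(i < size la) nth 0 la i * i)
     + 2 * \sum_(i < size la) i * s i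
   = \sum_(i < size la) nth 0 la i ^ 2 + 2 * (\sum_(i < size la) nth 0 la i * s i)
     + 2 * \sum_(i < size la) i ^ 2)%N.
  have -> : (2 * \sum_(i < size la) i ^ 2
      = \sum_(i < size la) i ^ 2 + \sum_(i < size la) s i ^ 2)%N.
    by rewrite (sum_perm_ord s (fun i => i ^ 2)%N) mul2n -addnn.
  rewrite !big_distrr -!big_split /=; apply: eq_bigr => i _.
  move: (fitsE i); move: (nth 0 la i + s i - i)%N => m; move: (nth 0%N la i) (s i : nat) (i : nat).
  by move=> a p k; nia.
by move: R S E; lia.
Qed.

End JtIndex.

(** The Leibniz expansion is unitriangular for the sum of squares, which allows
    the same induction as for Q-polynomials. *)
Lemma chern_mon_span la : schur_span (fun A c => \prod_(i <- la) c i).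
Proof.
have [k] := ubnP (sumn la ^ 2 - sumsq la); elim: k la => // k IH la; rewrite ltnS => le_k.
wlog part_la : la le_k / is_partition la.
  move=> H; pose mu := sort geq [seq i <- la | i != 0%N].
  have perm : perm_eq mu [seq i <- la | i != 0%N] by rewrite perm_sort.
  have sumn0 : sumn [seq i <- la | i != 0%N] = sumn la.
    rewrite !sumnE big_filter [RHS](bigID (fun i => i != 0%N)) /=.
    by rewrite [X in (_ + X)%N]big1 ?addn0 // => i /negPn /eqP.
  have sumsq0 : sumsq [seq i <- la | i != 0%N] = sumsq la.
    rewrite /sumsq !sumnE !big_map big_filter [RHS](bigID (fun i => i != 0%N)) /=.
    by rewrite [X in (_ + X)%N]big1 ?addn0 // => i /negPn /eqP ->.
  apply: schur_span_ext (H mu _ _) _.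
  - by rewrite (perm_sumn perm) (perm_sumsq perm) sumn0 sumsq0.
  - apply/andP; split; first by apply: sort_sorted => x y; exact: leq_total.
    by rewrite (perm_mem perm) mem_filter.
  move=> A c c0; rewrite (perm_big _ perm) /= big_filter [RHS](bigID (fun i => i != 0%N)) /=.
  by rewrite [X in _ * X]big1 ?mulr1 // => i /negPn /eqP ->.
have srt : sorted geq la by case/andP: part_la.
pose G (s : 'S_(size la)) : family := fun A c =>
  ((-1) ^+ s : int)%:~R * \prod_(i < size la) jt_entry c la i (s i).
have spanG s : s != 1%g -> schur_span (G s).
  move=> s_neq1; apply: schur_spanZ.
  case: (boolP [forall i : 'I_(size la), i <= nth 0 la i + s i]%N) => [fits|].
    apply: schur_span_ext (IH (jt_index s) _) _.
      apply: leq_trans le_k; rewrite sumn_jt_index //; apply: ltn_sub2l.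
        apply: leq_trans (sumsq_jt_index fits srt s_neq1) _.
        by rewrite -(sumn_jt_index fits); exact: sumsq_le.
      exact: sumsq_jt_index.
    move=> A c _; rewrite big_map big_enum /=; apply: eq_bigr => i _.
    by rewrite /jt_entry (forallP fits).
  rewrite negb_forall => /existsP [i0 h]; apply: schur_span_ext schur_span0 _ => A c _.
  by rewrite (bigD1 i0) //= {1}/jt_entry (negPf h) mul0r.
have h : schur_span (fun A c => \sum_(s <- [seq s <- enum 'S_(size la) | s != 1%g]) G s A c).
  by apply: schur_span_sum => s; rewrite mem_filter => /andP[/spanG].
apply: schur_span_ext (schur_spanD (schur_span_jt part_la) (schur_spanZ (-1) h)) _ => A c _.
rewrite rmorphN1 mulN1r big_filter big_enum_cond /=.
rewrite /jt_det /determinant (bigD1 1%g) //= [X in _ + X - _](eq_bigr (fun s => G s A c)).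
  rewrite addrK odd_perm1 expr0 mul1r (big_nth 0%N) big_mkord; apply: eq_bigr => i _.
  by rewrite mxE perm1 /jt_entry leq_addl addnK.
move=> s _; rewrite /G rmorph_sign; congr (_ * _).
by apply: eq_bigr => i _; rewrite mxE.
Qed.

End SchurSpan.

(** * Polynomials in the Chern variables *)

Lemma malg_monomM (m1 m2 : monalg.cmonom nat) :
  monalg.mkmalgU (monalg.mmul m1 m2) 1 = monalg.mkmalgU m1 1 * monalg.mkmalgU m2 1 :> infpoly int.
Proof. by rewrite monalg.malgM_def monalg.fgmulUU mulr1. Qed.

Definition mon_word (m : monalg.cmonom nat) : seq nat :=
  flatten [seq nseq (m i) i | i <- finsupp m].

Lemma count_mon_word m j : count_mem j (mon_word m) = m j.
Proof.
rewrite /mon_word count_flatten sumnE !big_map.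
under eq_bigr do rewrite count_nseq.
case: (boolP (j \in finsupp m)) => [jm|].
  rewrite (big_fsetD1 j) //= eqxx mul1n big_seq big1 ?addn0 // => i.
  by rewrite in_fsetD1 => /andP[/negPf /= -> _].
rewrite memNfinsupp => /eqP mj; rewrite big_seq big1 => [|i /= im]; last first.
  by case: eqP => // ij; move: im; rewrite ij mem_finsupp mj eqxx.
by rewrite mj.
Qed.

Lemma chern_word (s : seq nat) :
  \prod_(i <- s) chern_var i.+1
  = monalg.mkmalgU (foldr (fun i m => monalg.mmul (monalg.ucm i) m) monalg.mone s) 1.
Proof.
elim: s => [|i s IH]; first by rewrite big_nil.
by rewrite big_cons IH /= malg_monomM.
Qed.

Lemma foldr_mon_word m :
  foldr (fun i m => monalg.mmul (monalg.ucm i) m) monalg.mone (mon_word m) = m.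
Proof.
apply/eqP/monalg.cmP => j.
rewrite -[RHS]count_mon_word; elim: (mon_word m) => [|i s IH].
  exact: monalg.onecmE.
rewrite [foldr _ _ _]/= [count_mem _ _]/= -IH -monalg.ucmE.
exact: monalg.mulcmE.
Qed.

Lemma chern_mon_word m : \prod_(i <- mon_word m) chern_var i.+1 = monalg.mkmalgU m 1.
Proof. by rewrite chern_word foldr_mon_word. Qed.

Lemma infpoly_eval_word (S : comNzRingType) (v : nat -> S) (P : infpoly int) :
  infpoly_eval intr v P = \sum_(m <- monalg.msupp P)
    (monalg.mcoeff m P)%:~R * \prod_(i <- mon_word m) v i.
Proof.
apply: eq_bigr => m _; congr (_ * _).
rewrite /mon_word big_flatten big_map; apply: eq_bigr => i _.
by rewrite big_nseq iter_mulr_1.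
Qed.

Lemma infpoly_eval_id (P : infpoly int) : infpoly_eval intr (fun i => chern_var i.+1) P = P.
Proof.
rewrite infpoly_eval_word [RHS]monalg.monalgE; apply: eq_bigr => m _.
rewrite chern_mon_word mulrzl.
have := raddfMz (@monalg.mkmalgU (monalg.cmonom nat) int m) (monalg.mcoeff m P) 1.
by rewrite intz => ->.
Qed.

(** An infinite polynomial is evaluated through finitely many monomials, each of
    which is a universal combination of Jacobi-Trudi determinants. *)
Lemma infpoly_schur (P : infpoly int) :
  exists s : seq (int * seq nat), all (fun p => is_partition p.2) s /\
    forall (A : comNzRingType) (c : nat -> A), c 0%N = 1 ->
      infpoly_eval intr (fun i => c i.+1) P = \sum_(p <- s) p.1%:~R * jt_det c p.2.
Proof.
have : schur_span (fun A c => \sum_(m <- monalg.msupp P)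
    (monalg.mcoeff m P)%:~R * \prod_(i <- [seq i.+1 | i <- mon_word m]) c i).
  by apply: schur_span_sum => m _; apply: schur_spanZ; exact: chern_mon_span.
move=> [s [hs E]]; exists s; split=> // A c c0; rewrite -E // infpoly_eval_word.
by apply: eq_bigr => m _; rewrite big_map.
Qed.

(** * Jacobi-Trudi determinants in three roots *)

Definition det3 (A : comNzRingType) (m : nat -> nat -> A) : A :=
  m 0 0 * (m 1 1 * m 2 2 - m 1 2 * m 2 1) - m 0 1 * (m 1 0 * m 2 2 - m 1 2 * m 2 0)
  + m 0 2 * (m 1 0 * m 2 1 - m 1 1 * m 2 0).

Lemma det3E (A : comNzRingType) (m : nat -> nat -> A) :
  \det (\matrix_(i < 3, j < 3) m i j) = det3 m.
Proof.
rewrite (expand_det_row _ ord0) !big_ord_recl big_ord0 /cofactor.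
rewrite !(expand_det_row _ ord0) !big_ord_recl !big_ord0 /cofactor !det_mx11 !mxE /=.
by rewrite /bump /= /det3 !addr0 !addn0 !expr0 !expr1 !expr2; move: (m) => m'; ring.
Qed.

Lemma det2E (A : comNzRingType) (m : nat -> nat -> A) :
  \det (\matrix_(i < 2, j < 2) m i j) = m 0 0 * m 1 1 - m 0 1 * m 1 0.
Proof.
rewrite (expand_det_row _ ord0) !big_ord_recl big_ord0 /cofactor !det_mx11 !mxE /=.
by rewrite /bump /= !addr0 !addn0 !expr0 !expr1; move: (m) => m'; ring.
Qed.

Lemma sum_ord_trunc (A : nmodType) m N (F : nat -> A) :
  (m <= N)%N -> (forall l, (m <= l)%N -> F l = 0) -> \sum_(l < m) F l = \sum_(l < N) F l.
Proof.
move=> le_mN F0; rewrite (big_ord_widen N F le_mN) big_mkcond; apply: eq_bigr => l _.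
by case: ltnP => // /F0.
Qed.

Section ThreeRoots.
Variables (A : idomainType) (y : 'I_3 -> A) (b : A).
Let x1 := y ord0.
Let x2 := y (lift ord0 ord0).
Let x3 := y (lift ord0 (lift ord0 ord0)).
Let e1 := x1 + x2 + x3.
Let e2 := x1 * x2 + x1 * x3 + x2 * x3.
Let e3 := x1 * x2 * x3.

(** The series (1 + b z) / prod (1 - y_i z), the geometric series being truncated
    after degree N. With y_i = - alpha_i and b = u its coefficients are the
    Chern classes of the virtual normal bundle. *)
Definition cser N : {poly A} := (1 + b *: 'X) * \prod_(i < 3) geom (y i) N.
Definition ccoef d := (cser d)`_d.
Definition croots : {poly A} := \prod_(i < 3) (1 - y i *: 'X).

Lemma cserE N d : (d <= N)%N -> (cser N)`_d = ccoef d.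
Proof.
move=> led; apply: (@eq_uptoM _ d) => //; apply: eq_upto_prod => j k lek.
by rewrite !coef_geom lek (leq_trans lek led).
Qed.

Lemma cser_roots N : eq_upto N (cser N * croots) (1 + b *: 'X).
Proof.
rewrite -mulrA -[X in eq_upto _ _ X]mulr1; apply: eq_uptoM => //.
rewrite -big_split /=; have E1 : 1 = \prod_(j < 3) (1 : {poly A}) by rewrite big1.
rewrite [X in eq_upto _ _ X]E1; apply: eq_upto_prod => j; exact: geom_inv.
Qed.

Lemma crootsE : croots = 1 + (- e1)%:P * 'X + e2%:P * 'X^2 + (- e3)%:P * 'X^3.
Proof.
have -> : croots = \prod_(j < 3) (1 + (- y j) *: 'X).
  by apply: eq_bigr => j _; rewrite scaleNr.
by rewrite (prod3E (fun j => - y j)) /e1 /e2 /e3 /x1 /x2 /x3 !(mulrN, mulNr) !opprK !polyCD !polyCN !polyCD; ring.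
Qed.

Lemma croots0 : croots`_0 = 1.
Proof.
by rewrite crootsE !coefD coef1 !coefCM coefX !coefXn !mulr0 !addr0.
Qed.

Lemma croots_ge4 l : (3 < l)%N -> croots`_l = 0.
Proof.
move=> h; rewrite crootsE !coefD coef1 !coefCM coefX !coefXn.
by case: l h => [|[|[|[|l]]]] //= _; rewrite !mulr0 !addr0.
Qed.

Lemma ccoef_conv D : \sum_(l < D.+1) ccoef (D - l) * croots`_l = (1 + b *: 'X)`_D.
Proof.
rewrite -(cser_roots (leqnn D)) coefMr; apply: eq_bigr => l _.
by rewrite cserE // leq_subr.
Qed.

Lemma coef_linear D : (1 + b *: 'X)`_D = if D is 0 then 1 else if D is 1 then b else 0 :> A.
Proof.
by rewrite coefD coef1 coefZ coefX; case: D => [|[|D]] /=; rewrite ?mulr1 ?mulr0 ?addr0 ?add0r.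
Qed.

Section Toeplitz.
Variables (nu : seq nat).
Local Notation n := (size nu).

(** A row of the Jacobi-Trudi matrix times a column of the Toeplitz matrix of
    prod (1 - y_i z) is a coefficient of 1 + b z, provided that the column index
    is at least 3, so that no term of the cubic is cut off. *)
Lemma jt_row_reduced i k : (3 <= k < n)%N ->
  \sum_(j < n) jt_entry ccoef nu i j * (if (j <= k)%N then croots`_(k - j) else 0)
  = if (i <= nth 0%N nu i + k)%N then (1 + b *: 'X)`_(nth 0%N nu i + k - i) else 0.
Proof.
case/andP=> k_ge3 lt_kn; rewrite /jt_entry; move: (nth 0%N nu i) => a.
rewrite -(@sum_ord_trunc _ k.+1 n (fun j => (if (i <= a + j)%N then ccoef (a + j - i) else 0)
  * (if (j <= k)%N then croots`_(k - j) else 0))) //; last first.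
  by move=> l lt_kl; rewrite [X in _ * X]ifF ?mulr0 // leqNgt lt_kl.
rewrite (reindex_inj rev_ord_inj) /=.
pose F D l := if (l <= D)%N then ccoef (D - l) * croots`_l else 0.
case: leqP => [le_i|lt_i]; last first.
  rewrite big1 // => l _; rewrite ifF ?mul0r //; apply/negbTE; rewrite -ltnNge.
  by apply: leq_ltn_trans lt_i; rewrite leq_add2l subSS leq_subr.
transitivity (\sum_(l < k.+1) F (a + k - i)%N l).
  apply: eq_bigr => l _; have lel : (l <= k)%N by rewrite -ltnS.
  rewrite subSS leq_subr subKn // /F.
  have -> : (i <= a + (k - l))%N = (l <= a + k - i)%N by apply/idP/idP; lia.
  case: ifP => h; last by rewrite mul0r.
  by congr (ccoef _ * _); lia.
rewrite -ccoef_conv (@sum_ord_trunc _ k.+1 (k.+1 + (a + k - i).+1)) ?leq_addr //; last first.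
  by move=> l lt_kl; rewrite /F croots_ge4 ?mulr0 ?if_same //; lia.
rewrite -(@sum_ord_trunc _ (a + k - i).+1 _ (F (a + k - i)%N)) ?leq_addl //; last first.
  by move=> l lt_kl; rewrite /F leqNgt lt_kl.
by apply: eq_bigr => l _; rewrite /F -ltnS ltn_ord.
Qed.

End Toeplitz.

(** Multiplication on the right by the unitriangular Toeplitz matrix of
    prod (1 - y_i z) clears the first three rows beyond the third column and
    makes the rest of the matrix lower triangular, with b or 0 on its
    diagonal. *)
Lemma jt_det_split p q r nu : all (leq 1) [:: p, q, r & nu] ->
  jt_det ccoef [:: p, q, r & nu]
  = jt_det ccoef [:: p; q; r] * \prod_(v <- nu) (if v == 1%N then b else 0).
Proof.
set la := [:: p, q, r & nu] => /allP pos; pose m := size nu.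
have la_pos i : (i < 3 + m)%N -> (0 < nth 0%N la i)%N.
  by move=> lt; apply: pos; rewrite mem_nth.
pose M : 'M[A]_(3 + m) := \matrix_(i, j) jt_entry ccoef la i j.
pose U : 'M[A]_(3 + m) := \matrix_(i, j) (if (i <= j)%N then croots`_(j - i) else 0).
have unitri k (V : 'M[A]_k) : (forall i j : 'I_k, (j < i)%N -> V i j = 0) ->
    (forall i, V i i = 1) -> \det V = 1.
  move=> V0 V1; rewrite -det_tr det_trig; last first.
    by apply/is_trig_mxP => i j lt; rewrite mxE V0.
  by rewrite big1 // => i _; rewrite mxE V1.
have detU : \det U = 1.
  by apply: unitri => [i j lt|i]; rewrite mxE ?leqnn ?subnn ?croots0 // leqNgt lt.
have detU1 : \det (ulsubmx U) = 1.
  by apply: unitri => [i j lt|i]; rewrite !mxE ?leqnn ?subnn ?croots0 //= leqNgt lt.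
have dlU : dlsubmx U = 0.
  apply/matrixP => i j; rewrite !mxE /= ifF //; apply/negbTE; rewrite -ltnNge.
  exact: ltn_addr (ltn_ord j).
have MU (i j : 'I_(3 + m)) : (3 <= j)%N -> (M *m U) i j
    = if (i <= nth 0%N la i + j)%N then (1 + b *: 'X)`_(nth 0%N la i + j - i) else 0.
  move=> gej; rewrite mxE -(@jt_row_reduced la i j) ?gej ?ltn_ord //.
  by apply: eq_bigr => k _; rewrite !mxE.
have entry0 (i j : 'I_(3 + m)) : (3 <= j)%N -> (i < j)%N || (i < 3)%N -> (M *m U) i j = 0.
  move=> gej h; rewrite MU // coef_linear.
  have pos_i := la_pos i (ltn_ord i).
  rewrite ifT; last by case/orP: h => h; lia.
  by case E : (nth 0%N la i + j - i)%N => [|[|d]] //; exfalso; case/orP: h => h; lia.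
have -> : jt_det ccoef la = \det (M *m U) by rewrite det_mulmx detU mulr1.
rewrite -[M *m U]submxK.
have -> : ursubmx (M *m U) = 0.
  apply/matrixP => i j; rewrite [RHS]mxE mxE mxE entry0 ?leq_addr //=.
  by rewrite ltn_ord orbT.
rewrite det_lblock; congr (_ * _).
  have -> : ulsubmx (M *m U) = ulsubmx M *m ulsubmx U.
    by rewrite -{1}[M]submxK -{1}[U]submxK dlU mulmx_block block_mxKul mulmx0 addr0.
  rewrite det_mulmx detU1 mulr1; congr (\det _); apply/matrixP => i j.
  rewrite !mxE /= /jt_entry.
  by case: i => [[|[|[|i0]]] lt].
rewrite det_trig; last first.
  apply/is_trig_mxP => i j lt; rewrite mxE mxE entry0 ?leq_addr //=.
  by rewrite ltn_add2l lt.
rewrite (big_nth 0%N) big_mkord; apply: eq_bigr => i _.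
rewrite mxE mxE MU ?leq_addr // leq_addl addnK coef_linear.
have := la_pos (3 + i)%N; rewrite ltn_add2l ltn_ord -[nth 0%N la _]/(nth 0%N nu i).
by case: (nth 0%N nu i) => [/(_ isT)|[|v]].
Qed.

(** The index is shifted by one so that c_(-1) = 0 is included, where
    [vdm_cshift] still holds. *)
Definition cshift m := if m is m'.+1 then ccoef m' else 0.

Let G1 := (x1 + b) * (x2 - x3).
Let G2 := - ((x2 + b) * (x1 - x3)).
Let G3 := (x3 + b) * (x1 - x2).

(** Partial fractions, proved through the recurrence of order three. *)
Lemma vdm_cshift m : vdm y * cshift m = G1 * x1 ^+ m + G2 * x2 ^+ m + G3 * x3 ^+ m.
Proof.
have c0 : ccoef 0 = 1.
  by have := ccoef_conv 0; rewrite big_ord1 croots0 mulr1 coef_linear.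
have rec D : ccoef D - e1 * (if D is d1.+1 then ccoef d1 else 0)
    + e2 * (if D is d2.+2 then ccoef d2 else 0) - e3 * (if D is d3.+3 then ccoef d3 else 0)
    = (1 + b *: 'X)`_D.
  rewrite -(cser_roots (leqnn D)) crootsE coef_mul_cubic !mulNr.
  by case: D => [|[|[|D]]] /=; rewrite !cserE //; lia.
have := (rec 1%N, fun d => rec d.+2); rewrite !coef_linear /= c0 => -[r1 r].
have C1 : cshift 2 = e1 + b.
  by apply: (eq_from_difference r1); rewrite /=; move: (ccoef 1) => z; ring.
have E d : cshift d.+3 = e1 * cshift d.+2 - e2 * cshift d.+1 + e3 * cshift d.
  have := r d; rewrite coef_linear => rd; apply: (eq_from_difference rd).
  case: d {rd} => [|d] /=; rewrite ?c0; [move: (ccoef 2) (ccoef 1) => z1 z2 |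
    move: (ccoef d.+3) (ccoef d.+2) (ccoef d.+1) (ccoef d) => z1 z2 z3 z4]; ring.
pose P k := vdm y * cshift k = G1 * x1 ^+ k + G2 * x2 ^+ k + G3 * x3 ^+ k.
suff : [/\ P m, P m.+1 & P m.+2] by case.
elim: m => [|d [P0 P1 P2]]; rewrite /P.
  by split; rewrite ?C1 /= ?c0 /vdm /G1 /G2 /G3 /e1 -/x1 -/x2 -/x3; ring.
split=> //; rewrite E mulrDr mulrBr !(mulrCA (vdm y)) P0 P1 P2 /e1 /e2 /e3 !exprS.
move: (x1 ^+ d) (x2 ^+ d) (x3 ^+ d) G1 G2 G3 => z1 z2 z3 g1 g2 g3; ring.
Qed.

Lemma jt_cshift nu i j : jt_entry ccoef nu i j = cshift (nth 0 nu i + j + 1 - i)%N.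
Proof.
rewrite /jt_entry; case: leqP => h; first by rewrite addn1 subSn.
by have -> : (nth 0 nu i + j + 1 - i = 0)%N by lia.
Qed.

Hypothesis vdm_neq0 : vdm y != 0.

(** By [vdm_cshift] the 3 x 3 matrix is a product of the matrix of powers
    x_l ^ (exponent of row i), a diagonal matrix and a Vandermonde matrix. *)
Lemma vdm_jt3 p q r :
  vdm y * jt_det ccoef [:: p.+1; q.+1; r.+1]
  = (x1 + b) * (x2 + b) * (x3 + b) * alternant y p.+2 q.+1 r.
Proof.
apply: (mulfI vdm_neq0); apply: (mulfI vdm_neq0).
have -> : jt_det ccoef [:: p.+1; q.+1; r.+1]
    = det3 (fun i j => cshift (nth 0 [:: p.+2; q.+1; r] i + j)%N).
  rewrite -det3E; congr (\det _); apply/matrixP => i j; rewrite !mxE jt_cshift.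
  by congr cshift; case: i => [[|[|[|i0]]] lt] //=; lia.
have -> D : vdm y * (vdm y * (vdm y * det3 D))
    = det3 (fun i j => vdm y * D i j).
  by rewrite /det3; move: (vdm y) => v; ring.
rewrite /det3 !vdm_cshift /= !addn0 !addnS !addn0 !exprS.
(* the last factor is det (x_l ^ j), and G1 G2 G3 carries the Vandermonde sign *)
transitivity (G1 * G2 * G3 * alternant y p.+2 q.+1 r
   * ((x2 - x1) * (x3 - x1) * (x3 - x2))).
  rewrite /alternant -/x1 -/x2 -/x3 !exprS.
  move: (x1 ^+ p) (x2 ^+ p) (x3 ^+ p) (x1 ^+ q) (x2 ^+ q) (x3 ^+ q) (x1 ^+ r) (x2 ^+ r) (x3 ^+ r).
  move: G1 G2 G3 x1 x2 x3 => g1 g2 g3 a1 a2 a3 p1 p2 p3 q1 q2 q3 r1 r2 r3; ring.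
rewrite /G1 /G2 /G3 /vdm -/x1 -/x2 -/x3; move: (alternant _ _ _ _) x1 x2 x3 => t a1 a2 a3; ring.
Qed.

End ThreeRoots.

(** * Thin partitions *)

Local Notation X3 := (fun j : 'I_3 => 'X_j : {mpoly {poly rat}[3]}).

(** Indices that share an alternant are told apart by the power of the extra
    variable. *)
Lemma weighted_alternant_independent (T : eqType) (L : seq T) (a : T -> int)
    (t : T -> nat * nat * nat) (k : T -> nat) :
  uniq L -> {in L &, injective (fun x => (t x, k x))} ->
  (forall x, x \in L -> (t x).2 < (t x).1.2 < (t x).1.1)%N ->
  \sum_(x <- L) ((a x)%:~R * 'X^(k x) : {poly rat})
     *: alternant X3 (t x).1.1 (t x).1.2 (t x).2 = 0 ->
  forall x, x \in L -> a x = 0.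
Proof.
move=> uL inj_tk strict_t E x xL.
pose s := [seq ((a x)%:~R * 'X^(k x) : {poly rat}, t x) | x <- L].
pose F (u : nat * nat * nat) := alternant X3 u.1.1 u.1.2 u.2.
have {}E : \sum_(c <- s) c.1 *: F c.2 = 0 by rewrite big_map.
have sub : {subset [seq c.2 | c <- s] <= undup [seq c.2 | c <- s]}.
  by move=> u; rewrite mem_undup.
rewrite (big_group F (undup_uniq _) sub) in E.
have txL : t x \in undup [seq c.2 | c <- s].
  by rewrite mem_undup -map_comp; exact: (map_f t).
have strict_s : all (fun u => u.2 < u.1.2 < u.1.1)%N (undup [seq c.2 | c <- s]).
  by apply/allP => u; rewrite mem_undup -map_comp => /mapP[z zL ->]; exact: strict_t.
have coefE n' l l' : ((n'%:~R * 'X^l : {poly rat})`_l') = (if l == l' then n' else 0)%:~R.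
  by rewrite mulrzl coefMrz coefXn eq_sym; case: eqP; rewrite ?mul0rz.
have := congr1 (fun p : {poly rat} => p`_(k x)) (alternant_independent (undup_uniq _) strict_s E txL).
rewrite coef0 /coef_at big_map big_mkcond coef_sum (bigD1_seq x) //= eqxx coefE eqxx.
rewrite big_seq_cond big1 ?addr0 => [/eqP|z /andP[zL ne]]; first by rewrite intr_eq0 => /eqP.
case: eqP => tE; last by rewrite coef0.
rewrite coefE; case: eqP => // kE.
by case/eqP: ne; apply: inj_tk; rewrite // tE kE.
Qed.

Lemma partition_nth nu i j : is_partition nu -> (i <= j)%N -> (nth 0 nu j <= nth 0 nu i)%N.
Proof.
case/andP=> srt _ le_ij; case: (ltnP j (size nu)) => lt; last by rewrite nth_default.
by apply: (sorted_leq_nth geq_trans leqnn 0%N srt); rewrite ?inE // (leq_ltn_trans le_ij).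
Qed.

Lemma partition_pos nu i : is_partition nu -> (i < size nu)%N -> (0 < nth 0 nu i)%N.
Proof.
by case/andP=> _ nz lt; rewrite lt0n; apply: contraNneq nz => <-; rewrite mem_nth.
Qed.

Lemma thin_tail nu : is_partition nu -> (nth 0 nu 3 <= 1)%N ->
  drop 3 nu = nseq (size nu - 3) 1%N.
Proof.
move=> part thin; rewrite -size_drop; apply/all_pred1P.
apply/(all_nthP 0%N) => i; rewrite size_drop => lt; rewrite nth_drop /=.
have := @partition_pos nu (3 + i) part; have := @partition_nth nu 3 (3 + i) part.
by move: (nth _ _ _) thin => z; lia.
Qed.

Section Short.
Variables (A : idomainType) (y : 'I_3 -> A).
Hypothesis vdm_neq0 : vdm y != 0.

(** At b = 0 this is the Jacobi-Trudi identity for the complete symmetric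
    polynomials in three variables. *)
Lemma vdm_jt_short nu : is_partition nu -> (size nu <= 3)%N ->
  vdm y * jt_det (ccoef y 0) nu
  = alternant y (nth 0 nu 0).+2 (nth 0 nu 1).+1 (nth 0 nu 2).
Proof.
case: nu => [|p [|q [|r []]]] // part _.
- rewrite /jt_det det_mx00 mulr1 /alternant /vdm /= !expr0 !expr1 !expr2.
  by move: (y _) (y _) (y _) => a1 a2 a3; ring.
- rewrite /jt_det det_mx11 mxE jt_cshift vdm_cshift /= addn0 addn1 subn0 !addr0.
  rewrite /alternant /= !exprS !expr0; move: (y _) (y _) (y _) => a1 a2 a3; ring.
- apply: (mulfI vdm_neq0); rewrite /jt_det det2E !jt_cshift.
  have -> z1 z2 z3 z4 : vdm y * (vdm y * (z1 * z2 - z3 * z4))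
      = (vdm y * z1) * (vdm y * z2) - (vdm y * z3) * (vdm y * z4).
    by move: (vdm y) => v; ring.
  rewrite !vdm_cshift /= !addn0 !addn1 !subn0 !subn1 /= !addr0.
  rewrite /alternant /vdm !exprS !expr0.
  move: (y _ ^+ p) (y _ ^+ p) (y _ ^+ p) (y _ ^+ q) (y _ ^+ q) (y _ ^+ q).
  by move: (y _) (y _) (y _) => a1 a2 a3 p3 p2 p1 q3 q2 q1; ring.
have := partition_pos part; case: p q r {part} => [|p] [|q] [|r].
all: try by move=> /(_ 0%N isT).
all: try by move=> /(_ 1%N isT).
all: try by move=> /(_ 2%N isT).
move=> _; rewrite vdm_jt3 // !addr0 /alternant !exprS.
move: (y _ ^+ p) (y _ ^+ p) (y _ ^+ p) (y _ ^+ q) (y _ ^+ q) (y _ ^+ q).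
move: (y _ ^+ r) (y _ ^+ r) (y _ ^+ r).
by move: (y _) (y _) (y _) => a1 a2 a3 r3 r2 r1 p3 p2 p1 q3 q2 q1; ring.
Qed.

(** The value 0 occurs for the conjugates of thick partitions, which span the
    kernel. *)
Lemma jt_long b nu : is_partition nu -> (3 < size nu)%N ->
  vdm y * jt_det (ccoef y b) nu
  = (\prod_(i < 3) (y i + b)) * (if (nth 0 nu 3 <= 1)%N then b ^+ (size nu - 3) else 0)
    * alternant y (nth 0 nu 0).+1 (nth 0 nu 1) (nth 0 nu 2).-1.
Proof.
case: nu => [|p [|q [|r nu]]] // part lt.
have pos : all (leq 1) [:: p, q, r & nu].
  by apply/(all_nthP 0%N) => i; exact: partition_pos.
have prodE : \prod_(v <- nu) (if v == 1%N then b else 0)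
    = if (nth 0 nu 0 <= 1)%N then b ^+ size nu else 0.
  case: leqP => [thin|thick].
    have tail : nu = nseq (size nu) 1%N.
      by have := thin_tail part thin; rewrite /= drop0 !subSS subn0.
    by rewrite [X in \prod_(_ <- X) _]tail big_nseq iter_mulr_1.
  case: nu thick {lt part pos} => [|[|[|v]] nu] //= _.
  by rewrite big_cons mul0r.
rewrite jt_det_split // prodE mulrA /=.
move: pos => /and4P[p_gt0 q_gt0 r_gt0 _].
case: p q r p_gt0 q_gt0 r_gt0 {part lt} => [|p] [|q] [|r] // _ _ _.
rewrite vdm_jt3 // !big_ord_recl big_ord0 mulr1 /= subSS subSS subSS subn0.
by rewrite !mulrA mulrAC.
Qed.

End Short.

(** * The kernel of the specialization of stable classes *)


Section Specialise.
Variable b : {poly rat}.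

Let var (l : 'I_(3 + 1)) : {mpoly {poly rat}[3]} :=
  match split l with inl i => - 'X_i | inr _ => b%:MP end.

Definition chern_spec : {rmorphism {mpoly rat[3 + 1]} -> {mpoly {poly rat}[3]}} :=
  mmap (@mpolyC 3 {poly rat} \o @polyC rat) var.

Lemma chern_spec_alpha i : chern_spec (- alpha 1 i) = 'X_i.
Proof.
rewrite rmorphN /= mmapX mmap1U /var.
by rewrite (unsplitK (inl i)) opprK.
Qed.

Lemma chern_spec_beta : chern_spec (beta 3 (ord0 : 'I_1)) = b%:MP.
Proof. by rewrite /= mmapX mmap1U /var (unsplitK (inr ord0)). Qed.

Lemma chern_spec_quotient d : chern_spec (quotient_chern 3 1 d) = ccoef X3 b%:MP d.
Proof.
rewrite /quotient_chern big_ord1 -(coef_map chern_spec); set p := map_poly _ _.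
suff -> : p = cser X3 b%:MP d by [].
rewrite /p rmorphM rmorphD rmorph1 rmorph_prod; congr (_ * _).
  by rewrite /= map_polyZ map_polyX chern_spec_beta.
apply: eq_bigr => i _; rewrite /geom rmorph_sum; apply: eq_bigr => k _.
by rewrite /= map_polyZ map_polyXn rmorphXn chern_spec_alpha.
Qed.

End Specialise.

Lemma partition_ext nu mu : is_partition nu -> is_partition mu ->
  (forall i, nth 0 nu i = nth 0 mu i)%N -> nu = mu.
Proof.
move=> pn pm E; apply: (@eq_from_nth _ 0%N) => // .
wlog lt : nu mu pn pm E / (size nu < size mu)%N.
  by move=> H; case: (ltngtP (size nu) (size mu)) => // h; [exact: H|apply/esym/H].
by have := partition_pos pm lt; rewrite -E nth_default.
Qed.

Lemma sumX_const_neq0 (c : {poly rat}) : \prod_(i < 3) ('X_i + c%:MP) != 0 :> {mpoly {poly rat}[3]}.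
Proof.
rewrite prodf_seq_neq0; apply/allP => i _; apply/eqP => /(congr1 (mcoeff U_(i)%MM)).
rewrite mcoeffD mcoeffXU mcoeffC eqxx mcoeff0 (_ : (U_(i)%MM == 0%MM) = false) ?mulr0 ?addr0.
  by move/eqP; rewrite oner_eq0.
by apply/negbTE/eqP => /(congr1 (fun m : 'X_{1..3} => m i)); rewrite mnm1E eqxx mnm0E.
Qed.

(** At b = 0 the determinants of more than three rows vanish and the others are
    distinct alternants, so the coefficients of the short ones are 0. With b a
    variable, what remains is, up to the factor prod (X_i + b), a combination
    of alternants with coefficients a power of b each. *)
Lemma thin_jt_independent (L : seq (seq nat)) (a : seq nat -> int) :
  uniq L -> all is_partition L ->
  \sum_(nu <- L) (a nu)%:~R * jt_det (quotient_chern 3 1) nu = 0 ->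
  forall nu, nu \in L -> (nth 0 nu 3 <= 1)%N -> a nu = 0.
Proof.
move=> uL /allP part E.
have V := vdm_X_neq0 {poly rat}.
have specE b : \sum_(nu <- L) (a nu)%:~R * (vdm X3 * jt_det (ccoef X3 b%:MP) nu) = 0.
  have H := congr1 (fun p => vdm X3 * chern_spec b p) E; rewrite /= rmorph0 mulr0 in H.
  apply: etrans H; rewrite (rmorph_sum (chern_spec b)) mulr_sumr.
  apply: eq_bigr => nu _; rewrite (rmorphM (chern_spec b)) (rmorph_int (chern_spec b)).
  by rewrite (map_jt_det (chern_spec b)) (eq_jt_det _ (chern_spec_quotient b)) mulrCA.
have small nu : nu \in L -> (size nu <= 3)%N -> a nu = 0.
  move=> nuL le3; pose L1 := [seq mu <- L | (size mu <= 3)%N].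
  have L1P mu : mu \in L1 -> is_partition mu /\ (size mu <= 3)%N.
    by rewrite mem_filter => /andP[-> /part].
  apply: (@weighted_alternant_independent _ L1 a
    (fun mu => ((nth 0 mu 0).+2, (nth 0 mu 1).+1, nth 0 mu 2)%N) (fun=> 0%N)).
  - exact: filter_uniq.
  - move=> mu la /L1P[pm lm] /L1P[pl ll] [e0 e1 e2].
    apply: partition_ext => // -[|[|[|i]]] //.
    by rewrite !nth_default // ?(leq_trans ll) ?(leq_trans lm).
  - move=> mu /L1P[pm _]; have := (partition_nth pm (leqnSn 0), partition_nth pm (leqnSn 1)).
    by rewrite /= => -[]; lia.
  - rewrite -[RHS](specE 0) [RHS](bigID (fun mu : seq nat => (size mu <= 3)%N)) /=.
    rewrite [X in _ + X]big1_seq ?addr0 => [|mu /andP[]]; last first.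
      rewrite -ltnNge => gt3 muL; rewrite jt_long ?part // mpolyC0 expr0n.
      have -> : (size mu - 3 == 0)%N = false by apply/negbTE; rewrite subn_eq0 -ltnNge.
      by rewrite if_same mulr0 mul0r mulr0.
    rewrite big_filter big_seq_cond [RHS]big_seq_cond; apply: eq_bigr => mu /andP[muL le].
    rewrite mpolyC0 vdm_jt_short ?part // expr0 mulr1 -mul_mpolyC.
    by rewrite (rmorph_int (@mpolyC 3 {poly rat})).
  by rewrite mem_filter le3.
move=> nu nuL thin; case: (leqP (size nu) 3) => [/(small nu nuL) //|gt3].
pose L2 := [seq mu <- L | (3 < size mu)%N && (nth 0 mu 3 <= 1)%N].
have L2P mu : mu \in L2 -> [/\ is_partition mu, (3 < size mu)%N & (nth 0 mu 3 <= 1)%N].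
  by rewrite mem_filter => /andP[/andP[-> ->] /part].
apply: (@weighted_alternant_independent _ L2 a
  (fun mu => ((nth 0 mu 0).+1, nth 0 mu 1, (nth 0 mu 2).-1)%N) (fun mu => size mu - 3)%N).
- exact: filter_uniq.
- move=> mu la /L2P[pm lm tm] /L2P[pl ll tl] [e0 e1 e2 ek].
  have h : (nth 0 mu 2 = nth 0 la 2)%N.
    by rewrite -(prednK (partition_pos pm (ltnW lm))) e2 (prednK (partition_pos pl (ltnW ll))).
  apply: partition_ext => // -[|[|[|i]]] //.
  have := congr1 (fun s => nth 0%N s i) (thin_tail pm tm).
  by rewrite ek -(thin_tail pl tl) !nth_drop.
- move=> mu /L2P[pm lm _].
  have := (partition_nth pm (leqnSn 0), partition_nth pm (leqnSn 1), @partition_pos mu 2 pm).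
  by move=> [[h0 h1] h2]; have := h2 (ltnW lm); rewrite /=; lia.
- apply: (mulfI (sumX_const_neq0 'X)); rewrite mulr0.
  rewrite -[RHS](specE 'X) mulr_sumr big_filter.
  rewrite [RHS](bigID (fun mu : seq nat => (3 < size mu)%N && (nth 0 mu 3 <= 1)%N)) /=.
  rewrite [X in _ = _ + X]big1_seq ?addr0 => [|mu /andP[]]; last first.
    rewrite negb_and -leqNgt => /orP[le muL|thick muL].
      by rewrite small ?mul0r.
    have gt : (3 < size mu)%N by rewrite ltnNge; apply: contra thick => le; rewrite nth_default.
    by rewrite jt_long ?part // (negPf thick) mulr0 mul0r mulr0.
  rewrite big_seq_cond [RHS]big_seq_cond; apply: eq_bigr => mu /andP[muL /andP[gt th]].
  rewrite jt_long ?part // th -mul_mpolyC mpolyCM (rmorph_int (@mpolyC 3 {poly rat})) rmorphXn.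
  by move: (\prod_(_ < _) _) (_ ^+ _) (alternant _ _ _ _) ((a mu)%:~R) => z1 z2 z3 z4; ring.
by rewrite mem_filter gt3 thin.
Qed.

Lemma quotient_chern0 n p : quotient_chern n p 0 = 1.
Proof.
rewrite /quotient_chern coef0M !coef0_prod !big1 ?mulr1 // => i _.
  by rewrite coef_sum big_ord1 expr0 coefZ coefXn eqxx mulr1.
by rewrite coefD coef1 coefZ coefX mulr0 addr0.
Qed.

(** Expand both sides in Schur polynomials. In three roots the thick ones give
    0 and the others are independent. *)
Theorem rho_thick (P T : infpoly int) : rho 3 1 P = rho 3 1 T -> congr_mod_thick P T.
Proof.
have [s [/allP ps Es]] := infpoly_schur P; have [t [/allP pt Et]] := infpoly_schur T.
rewrite /rho !(Es _ _ (quotient_chern0 3 1)) !(Et _ _ (quotient_chern0 3 1)) => E.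
pose r := s ++ [seq (- x.1, x.2) | x <- t].
have sumr (A : comNzRingType) (c : nat -> A) : \sum_(x <- r) x.1%:~R * jt_det c x.2
    = \sum_(x <- s) x.1%:~R * jt_det c x.2 - \sum_(x <- t) x.1%:~R * jt_det c x.2.
  rewrite big_cat big_map -sumrN; congr (_ + _); apply: eq_bigr => x _.
  by rewrite /= intrN mulNr.
pose L := undup [seq x.2 | x <- r].
have partL nu : nu \in L -> is_partition nu.
  rewrite mem_undup map_cat mem_cat -map_comp => /orP[] /mapP[x xs ->]; [exact: (ps x)|exact: (pt x)].
have group (A : comNzRingType) (c : nat -> A) : \sum_(x <- r) x.1%:~R * jt_det c x.2
    = \sum_(nu <- L) (coef_at r nu)%:~R * jt_det c nu.
  rewrite /coef_at; under [RHS]eq_bigr do rewrite big_mkcond rmorph_sum mulr_suml.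
  rewrite exchange_big /= big_seq [RHS]big_seq; apply: eq_bigr => x xr.
  rewrite (bigD1_seq x.2) ?undup_uniq //=; last by rewrite mem_undup; exact: map_f.
  by rewrite eqxx big1 ?addr0 // => u /negPf ne; rewrite eq_sym ne mul0r.
exists [seq (coef_at r nu, conj_part nu) | nu <- L & (1 < nth 0 nu 3)%N]; split.
  apply/allP => p /mapP[nu]; rewrite mem_filter => /andP[thick nuL] ->.
  have part_nu := partL nu nuL; apply/andP; split; first exact: conj_partition.
  by rewrite -(conj_thick part_nu) in thick.
have PE : infpoly_eval intr (fun i => chern_var i.+1) P
    - infpoly_eval intr (fun i => chern_var i.+1) T = P - T by rewrite !infpoly_eval_id.
rewrite -PE (Es _ _ (erefl _)) (Et _ _ (erefl _)) -sumr group.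
rewrite big_map big_filter (bigID (fun nu : seq nat => 1 < nth 0 nu 3)%N) /=.
rewrite [X in _ + X]big1_seq ?addr0 => [|nu /andP[thin nuL]]; last first.
  rewrite -leqNgt in thin; rewrite (@thin_jt_independent L (coef_at r)) ?undup_uniq ?mul0r //.
    exact/allP.
  by rewrite -group sumr E subrr.
rewrite big_seq_cond [RHS]big_seq_cond; apply: eq_bigr => nu /andP[nuL _].
by rewrite schur_conj ?partL // mulrzl -scaler_int intz.
Qed.

(** * Homogeneity and the ambiguity of Legendre Thom polynomials *)

Opaque legendre_hom Qfun.

Lemma legendre_root_homog n (i : 'I_n) : legendre_root i \is 1.-homog.
Proof.
by rewrite rpredB ?rpredZ // dhomogX; apply/eqP; exact: mdeg1.
Qed.

Lemma half_u_homog n : - half_u n \is 1.-homog.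
Proof. by rewrite rpredN rpredZ // dhomogX; apply/eqP; exact: mdeg1. Qed.

Lemma legendre_monomial_homog n j la :
  (- half_u n) ^+ j * legendre_hom n (Qfun _ n la) \is (j + sumn la).-homog.
Proof.
have := dhomogMn j (half_u_homog n); rewrite mul1n => hu.
by rewrite legendre_Qfun dhomogM //; apply: Qseq_homog => i; exact: legendre_root_homog.
Qed.

(** The part of c.1 Q_(c.2) of degree N, where t has degree 1. *)
Definition degree_part (N : nat) (c : {poly int} * seq nat) : {poly int} :=
  if (sumn c.2 <= N)%N then (c.1)`_(N - sumn c.2) *: 'X^(N - sumn c.2) else 0.

Lemma t_value_monomial n (a : int) j : t_value n (a *: 'X^j) = (- half_u n) ^+ j *~ a.
Proof.
by rewrite -mul_polyC rmorphM t_valueC rmorphXn t_valueX mulrzl.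
Qed.

Lemma pihomog_legendre n N (s : seq ({poly int} * seq nat)) :
  pihomog mdeg N (legendre_hom n (\sum_(c <- s) c.1 *: Qfun _ n c.2))
  = legendre_hom n (\sum_(c <- s) degree_part N c *: Qfun _ n c.2).
Proof.
transitivity (\sum_(c <- s) pihomog mdeg N (legendre_hom n (c.1 *: Qfun _ n c.2))).
  by rewrite (rmorph_sum (legendre_hom n)) raddf_sum.
rewrite (rmorph_sum (legendre_hom n)); apply: eq_bigr => c _.
rewrite !legendre_homZ; set Q := legendre_hom n _.
have monE (a : int) j : pihomog mdeg N (t_value n (a *: 'X^j) * Q)
    = if (j + sumn c.2)%N == N then t_value n (a *: 'X^j) * Q else 0.
  have h : t_value n (a *: 'X^j) * Q \is (j + sumn c.2).-homog.
    by rewrite t_value_monomial mulrzAl rpredMz // legendre_monomial_homog.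
  case: eqP => [E|/eqP ne]; first by rewrite pihomog_dE // -E.
  by rewrite (pihomog_ne0 ne h).
have -> : pihomog mdeg N (t_value n c.1 * Q)
    = \sum_(j < size c.1) pihomog mdeg N (t_value n ((c.1)`_j *: 'X^j) * Q).
  by rewrite -{1}[c.1]coefK poly_def (rmorph_sum (t_value n)) mulr_suml raddf_sum.
under eq_bigr do rewrite monE.
rewrite /degree_part; case: leqP => [le|gt]; last first.
  rewrite (rmorph0 (t_value n)) mul0r big1 // => j _; case: eqP => // E; lia.
have eqE j : ((j + sumn c.2)%N == N) = (j == N - sumn c.2)%N by lia.
case: (ltnP (N - sumn c.2) (size c.1)) => [lt|ge].
  rewrite (bigD1 (Ordinal lt)) //= subnK // eqxx big1 ?addr0 // => j.
  by rewrite -val_eqE eqE /= => /negPf ->.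
rewrite [in RHS](nth_default _ ge) scale0r (rmorph0 (t_value n)) mul0r big1 // => j _.
rewrite eqE; case: eqP => // E; have := ltn_ord j; rewrite E; lia.
Qed.

Section Determination.
Variables (N : nat) (P K : symfun_t) (sP sR : seq ({poly int} * seq nat)).
Hypothesis PE : forall n, P n = \sum_(c <- sP) c.1 *: Qfun _ n c.2.
Hypothesis P_homog : forall n, legendre_hom n (P n) \is N.-homog.
Hypothesis P_neq0 : P 3 != 0.
Hypothesis sR_long : all (fun c => is_strict c.2 && (4 <= size c.2)%N) sR.
Hypothesis KE : forall n, K n = P n + \sum_(c <- sR) c.1 *: Qfun _ n c.2.
Hypothesis K_homog : forall n, (3 <= n)%N -> exists d, legendre_hom n (K n) \is d.-homog.

Let R n := \sum_(c <- sR) degree_part N c *: Qfun _ n c.2.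

Let R3 : R 3 = 0.
Proof.
rewrite /R big1_seq // => c /= cs; have /andP[strict_c size_c] := allP sR_long c cs.
by rewrite Qfun3_long ?scaler0.
Qed.

(** K is P plus a combination of long Q-polynomials, which three variables
    cannot see. For more variables the image of K is homogeneous, since Thom
    polynomials are; its degree is that of P, so only the part of that
    degree of the combination can be present. *)
Lemma Legendre_determined n : K n = P n + R n.
Proof.
have large m : (3 <= m)%N -> K m = P m + R m.
  move=> le3m.
  have part : pihomog mdeg N (legendre_hom m (K m)) = legendre_hom m (P m + R m).
    rewrite KE (rmorphD (legendre_hom m)) pihomogD [RHS](rmorphD (legendre_hom m)).
    congr (_ + _); first exact/pihomog_dE/P_homog.
    exact: pihomog_legendre.
  have [d hd] := K_homog le3m; have [E|ne] := eqVneq d N.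
    have hN : legendre_hom m (K m) \is N.-homog by rewrite -E.
    by apply: (@legendre_hom_inj m); rewrite -part (pihomog_dE hN); exact: erefl.
  (* otherwise P m + R m = 0, and P 3 = 0 by restriction to three variables *)
  move: part; rewrite (pihomog_ne0 ne hd) -(rmorph0 (legendre_hom m)) => /legendre_hom_inj E0.
  case/eqP: P_neq0; have := congr1 (restrict m 3) E0.
  by rewrite rmorph0 rmorphD PE /R !(restrict_sum le3m) -PE -[X in _ + X]/(R 3) R3 addr0.
case: (leqP 3 n) => [/large //|lt_n3].
have := congr1 (restrict 3 n) (large 3 (leqnn 3)).
by rewrite KE rmorphD [RHS]rmorphD PE /R !(restrict_sum (ltnW lt_n3)) -!PE -KE.
Qed.

End Determination.

(** The smallest strict partition with four parts is (4, 3, 2, 1), of sum 10: below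
    degree 10 there is no ambiguity, in degree 10 there is one. *)
Lemma strict_long_sum la : is_strict la -> (4 <= size la)%N ->
  (10 < sumn la)%N \/ la = [:: 4; 3; 2; 1]%N.
Proof.
case: la => [|a [|b [|c [|d la]]]] //; rewrite /is_strict /= !inE !negb_or.
case: la => [|e la] /= h _.
  case: (leqP (a + (b + (c + (d + 0)))) 10) => [le|]; [right|by left].
  by have [-> -> -> ->] : [/\ a = 4, b = 3, c = 2 & d = 1]%N by split; lia.
left; move: h; rewrite inE negb_or; lia.
Qed.

(** The coefficient, exponent of t and partition of each term. *)
Definition stratum_terms (s : stratum) : seq (nat * nat * seq nat) :=
  match s with
  | Smooth => [:: (1, 0, [:: 3; 2; 1])]
  | Nodal => [:: (12, 0, [:: 4; 2; 1]); (12, 1, [:: 3; 2; 1])]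
  | Cuspidal =>
      [:: (24, 0, [:: 5; 2; 1]); (24, 0, [:: 4; 3; 1]); (48, 1, [:: 4; 2; 1]);
          (24, 2, [:: 3; 2; 1])]
  | ConicTransversal =>
      [:: (18, 0, [:: 5; 2; 1]); (27, 0, [:: 4; 3; 1]); (42, 1, [:: 4; 2; 1]);
          (21, 2, [:: 3; 2; 1])]
  | ConicTangent =>
      [:: (36, 0, [:: 6; 2; 1]); (90, 0, [:: 5; 3; 1]); (54, 0, [:: 4; 3; 2]);
          (120, 1, [:: 5; 2; 1]); (138, 1, [:: 4; 3; 1]);
          (126, 2, [:: 4; 2; 1]); (42, 3, [:: 3; 2; 1])]
  | Triangle =>
      [:: (12, 0, [:: 6; 2; 1]); (30, 0, [:: 5; 3; 1]); (45, 0, [:: 4; 3; 2]);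
          (40, 1, [:: 5; 2; 1]); (55, 1, [:: 4; 3; 1]);
          (45, 2, [:: 4; 2; 1]); (15, 3, [:: 3; 2; 1])]
  | Concurrent =>
      [:: (12, 0, [:: 7; 2; 1]); (42, 0, [:: 6; 3; 1]); (30, 0, [:: 5; 4; 1]);
          (75, 0, [:: 5; 3; 2]);
          (52, 1, [:: 6; 2; 1]); (125, 1, [:: 5; 3; 1]); (100, 1, [:: 4; 3; 2]);
          (85, 2, [:: 5; 2; 1]); (100, 2, [:: 4; 3; 1]);
          (60, 3, [:: 4; 2; 1]); (15, 4, [:: 3; 2; 1])]
  end%N.

Definition stratum_degree (s : stratum) : nat :=
  match s with
  | Smooth => 6 | Nodal => 7 | Cuspidal | ConicTransversal => 8
  | ConicTangent | Triangle => 9 | Concurrent => 10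
  end.

Definition stratum_combo (s : stratum) : seq ({poly int} * seq nat) :=
  [seq (x.1.1%:R * 'X^(x.1.2), x.2) | x <- stratum_terms s].

Lemma stratum_legendreE s n :
  stratum_legendre s n = \sum_(c <- stratum_combo s) c.1 *: Qfun _ n c.2.
Proof.
rewrite /stratum_combo big_map /stratum_legendre; move: (Qfun {poly int} n) => Q.
by case: s; rewrite !big_cons big_nil addr0 /= ?expr0 ?expr1 ?mulr1 ?scale1r ?addrA.
Qed.

Lemma stratum_legendre_homog s n :
  legendre_hom n (stratum_legendre s n) \is (stratum_degree s).-homog.
Proof.
rewrite stratum_legendreE big_map rmorph_sum big_seq; apply: rpred_sum => x xs /=.
rewrite legendre_homZ rmorphM rmorph_nat rmorphXn t_valueX -mulrA mulr_natl rpredMn //.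
have <- : (x.1.2 + sumn x.2 = stratum_degree s)%N; last exact: legendre_monomial_homog.
by apply/eqP; move: x xs; apply/allP; case: s.
Qed.

Lemma stratum_terms_strict s :
  all (fun x => is_strict x.2 && (size x.2 <= 3)%N) (stratum_terms s).
Proof. by case: s. Qed.

Lemma stratum_legendre3_neq0 s : stratum_legendre s 3 != 0.
Proof.
apply/eqP => E; have := E; rewrite stratum_legendreE.
pose L := [seq x.2 | x <- stratum_terms s].
have uL : uniq L by rewrite /L; case: (s).
have subL : {subset [seq c.2 | c <- stratum_combo s] <= L}.
  by move=> la; rewrite /stratum_combo -map_comp.
rewrite (big_group (Qfun {poly int} 3) uL subL) => /(Qfun3_independent uL).
have strictL : all (fun la => is_strict la && (size la <= 3)%N) L.
  by rewrite all_map; exact: stratum_terms_strict.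
move=> /(_ strictL [:: 3; 2; 1]%N).
have -> : [:: 3; 2; 1]%N \in L by rewrite /L; case: (s).
move=> /(_ isT); rewrite /coef_at /stratum_combo big_map.
case: (s) => /=; rewrite !big_cons big_nil /= ?addr0 ?add0r => /eqP;
by rewrite mulf_eq0 expf_eq0 polyX_eq0 andbF orbF ?oner_eq0 // -polyC_natr polyC_eq0 pnatr_eq0.
Qed.

(** * The Legendre polynomials of the strata at three variables *)

Opaque Qfun legendre_hom.

Local Notation i1 := (ord0 : 'I_3).
Local Notation i2 := (lift ord0 ord0 : 'I_3).
Local Notation i3 := (lift ord0 (lift ord0 ord0) : 'I_3).

(** Exponents in three variables are made explicit, so that identities between
    given polynomials are decided by cases. *)
Lemma mono3_split (m : 'X_{1..3}) : m = mono3 (m i1) (m i2) (m i3).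
Proof.
apply/mnmP => i; rewrite !mnmDE !mulmnE !mnm1E.
case: (unliftP ord0 i) => [j ->|->]; rewrite ?mul1n ?mul0n ?addn0 //.
case: (unliftP ord0 j) => [k ->|->]; rewrite ?mul1n ?mul0n ?addn0 //.
by rewrite (ord1 k) /= mul1n.
Qed.

Lemma mdeg_mono3 a b c : mdeg (mono3 a b c) = (a + b + c)%N.
Proof. by rewrite !mdegD !mdegMn !mdeg1 !mul1n. Qed.

Lemma euler_Pol_list d (L : seq 'X_{1..3}) : uniq L -> (forall m, (m \in L) = (mdeg m == d)) ->
  euler_Pol d 3 = \prod_(m <- L) linear_form rat (target_weight m (ord0 : 'I_1)).
Proof.
move=> uL memL.
transitivity (\prod_(m <- [seq bmnm (val i) | i <- enum (form_index d 3)])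
    linear_form rat (target_weight m (ord0 : 'I_1))).
  by rewrite big_map big_enum.
apply: perm_big; apply: uniq_perm => //.
  by rewrite map_inj_uniq ?enum_uniq // => ? ? /val_inj/val_inj.
by move=> m; rewrite memL -codom_form_monomial.
Qed.

Lemma half_uD : half_u 3 + half_u 3 = u_class 3.
Proof.
rewrite /half_u -scalerDl -[RHS]scale1r; congr (_ *: _).
Qed.

Lemma linear_form_mono3 a b c :
  linear_form rat (target_weight (mono3 a b c) (ord0 : 'I_1))
  = u_class 3 - (alpha 1 i1 *+ a + alpha 1 i2 *+ b + alpha 1 i3 *+ c).
Proof.
rewrite linear_form_target !big_ord_recl big_ord0 addr0 addrA; congr (_ - (_ *+ _ + _ *+ _ + _ *+ _));
by rewrite !mnmDE !mulmnE !mnm1E /= ?mul1n ?mul0n ?addn0 ?add0n.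
Qed.

Lemma euler_Pol1E : euler_Pol 1 3 = \prod_(l < 3) (u_class 3 - alpha 1 l).
Proof.
rewrite (@euler_Pol_list 1 [:: mono3 1 0 0; mono3 0 1 0; mono3 0 0 1]).
- by rewrite !big_cons big_nil !big_ord_recl big_ord0 !linear_form_mono3 !mulr0n !mulr1n
    ?addr0 ?add0r.
- by rewrite /= !inE !mono3_eq.
move=> m; rewrite (mono3_split m) !inE !mono3_eq mdeg_mono3.
by move: (m i1) (m i2) (m i3) => a b c; lia.
Qed.

Lemma linear_form_mono3_2 a b c : (a + b + c = 2)%N ->
  linear_form rat (target_weight (mono3 a b c) (ord0 : 'I_1))
  = legendre_root i1 *+ a + legendre_root i2 *+ b + legendre_root i3 *+ c.
Proof.
move=> E; rewrite linear_form_mono3 /legendre_root !mulrnBl.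
have -> : u_class 3 = half_u 3 *+ a + half_u 3 *+ b + half_u 3 *+ c.
  by rewrite -!mulrnDr E mulr2n half_uD.
move: (half_u 3 *+ a) (half_u 3 *+ b) (half_u 3 *+ c) (alpha _ _ *+ a) (alpha _ _ *+ b).
by move: (alpha _ _ *+ c) => z6 z5 z4 z3 z2 z1; ring.
Qed.

(** With x_i = u/2 - alpha_i the weights of quadratic forms are 2 x_i and
    x_i + x_j: the very factor of Q-polynomials of length 3 in three
    variables. *)
Lemma euler_Pol2E : euler_Pol 2 3
  = 8%:R * (legendre_root i1 * legendre_root i2 * legendre_root i3)
    * pairsums (@legendre_root 3).
Proof.
rewrite (@euler_Pol_list 2 [:: mono3 2 0 0; mono3 1 1 0; mono3 1 0 1; mono3 0 2 0;
  mono3 0 1 1; mono3 0 0 2]).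
- rewrite !big_cons big_nil !linear_form_mono3_2 // /pairsums.
  move: (legendre_root _) (legendre_root _) (legendre_root _) => x3 x2 x1.
  by rewrite !mulr0n !mulr1n !mulr2n; ring.
- by rewrite /= !inE !mono3_eq.
move=> m; rewrite (mono3_split m) !inE !mono3_eq mdeg_mono3.
by move: (m i1) (m i2) (m i3) => a b c; lia.
Qed.

Lemma vdm_legendre_neq0 : vdm (@legendre_root 3) != 0.
Proof.
have ne (i j : 'I_3) : i != j -> legendre_root i - legendre_root j != 0.
  move=> ne_ij; have -> : legendre_root i - legendre_root j = alpha 1 j - alpha 1 i.
    by rewrite /legendre_root; move: (half_u 3) (alpha 1 i) (alpha 1 j) => h a b; ring.
  apply/eqP => /(congr1 (mcoeff U_(lshift 1 i)%MM)).
  rewrite mcoeffD mcoeffN !mcoeffXU eqxx mcoeff0 (inj_eq (@lshift_inj _ _)) eq_sym (negPf ne_ij).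
  by rewrite sub0r => /eqP; rewrite oppr_eq0 oner_eq0.
by rewrite !mulf_neq0 // ne.
Qed.

Lemma mesym2E : mesym 3 rat 2
  = 'X_i1 * 'X_i2 + 'X_i1 * 'X_i3 + 'X_i2 * 'X_i3.
Proof.
apply/mpolyP => m; rewrite mcoeff_mesym (mono3_split m) /mechar mdeg_mono3.
have E (i j : 'I_3) : 'X_i * 'X_j = 'X_[U_(i) + U_(j)] :> {mpoly rat[3]} by rewrite mpolyXD.
rewrite !E !mcoeffD !mcoeffX.
have -> : [forall i, mono3 (m i1) (m i2) (m i3) i <= 1]%N
    = [&& m i1 <= 1, m i2 <= 1 & m i3 <= 1]%N.
  rewrite -mono3_split; apply/forallP/and3P => [h|[h1 h2 h3] i]; first by split; exact: h.
  case: (unliftP ord0 i) => [j ->|-> //]; case: (unliftP ord0 j) => [k ->|-> //].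
  by rewrite (ord1 k).
rewrite (mono3_split (U_(_) + U_(_))%MM) (mono3_split (U_(i1) + U_(i3))%MM)
  (mono3_split (U_(i2) + U_(i3))%MM) !mono3_eq !mnmDE !mnm1E /=.
move: (m i1) (m i2) (m i3) => a b c.
by case: a => [|[|a]]; case: b => [|[|b]]; case: c => [|[|c]]; rewrite ?ltnS ?andbF /= ?andbF ?addr0 ?add0r.
Qed.

(** [stratum_class] as a function of the elementary symmetric polynomials, to be
    evaluated in another ring. *)
Definition class_value (A : comNzRingType) (s : stratum) (c1 c2 c3 : A) : A :=
  match s with
  | Smooth => 1
  | Nodal => 12%:R * c1
  | Cuspidal => 24%:R * c1 ^+ 2
  | ConicTransversal => 18%:R * c1 ^+ 2 + 9%:R * c2
  | ConicTangent => 36%:R * c1 ^+ 3 + 18%:R * (c1 * c2)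
  | Triangle => 12%:R * c1 ^+ 3 + 6%:R * (c1 * c2) + 27%:R * c3
  | Concurrent => 12%:R * c1 ^+ 4 + 6%:R * (c1 ^+ 2 * c2) + 27%:R * (c1 * c3)
  end.

(** u/3 - alpha_i = x_i - u/6, and t = - u/2 is three times - u/6. *)
Definition sixth_u : {mpoly rat[3 + 1]} := - ((1 / 6%:R : rat) *: u_class 3).

Lemma dual_rootE i : (1 / 3%:R : rat) *: u_class 3 - alpha 1 i = legendre_root i + sixth_u.
Proof.
rewrite /legendre_root /sixth_u /half_u addrAC -scalerBl; congr (_ *: _ - _).
Qed.

Lemma half_u_sixth : - half_u 3 = 3%:R * sixth_u.
Proof.
rewrite /half_u /sixth_u mulrN mulr_natl -scaler_nat scalerA; congr (- (_ *: _)).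
Qed.

Lemma dual_root_class s :
  let z i := legendre_root i + sixth_u in
  dual_root_subst (stratum_class s)
  = class_value s (z i1 + z i2 + z i3) (z i1 * z i2 + z i1 * z i3 + z i2 * z i3)
      (z i1 * z i2 * z i3).
Proof.
move=> z; pose f : {rmorphism {mpoly rat[3]} -> {mpoly rat[3 + 1]}} :=
  comp_mpoly [tuple (1 / 3%:R : rat) *: u_class 3 - alpha 1 i | i < 3].
have fX i : f 'X_i = z i.
  by rewrite /f /= comp_mpolyXU -tnth_nth tnth_mktuple dual_rootE.
have f1 : f (mesym 3 rat 1) = z i1 + z i2 + z i3.
  by rewrite mesym1E !big_ord_recl big_ord0 addr0 !rmorphD !fX addrA.
have f2 : f (mesym 3 rat 2) = z i1 * z i2 + z i1 * z i3 + z i2 * z i3.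
  by rewrite mesym2E !rmorphD !rmorphM !fX.
have f3 : f (mesym 3 rat 3) = z i1 * z i2 * z i3.
  by rewrite mesymnnE !big_ord_recl big_ord0 mulr1 !rmorphM !fX mulrA.
rewrite -f1 -f2 -f3 -[dual_root_subst _]/(f (stratum_class s)).
case: s => /=; rewrite ?scaler_nat ?mulr_natl;
by rewrite ?rmorph1 ?rmorphD /= ?rmorphMn ?rmorphM ?rmorphXn.
Qed.

(** After the common factors are removed, the claimed Legendre polynomial is a
    polynomial identity in x_1, x_2, x_3 and v = - u/6. *)
Lemma stratum_identity (A : idomainType) (x : 'I_3 -> A) (v : A) s :
  let z i := x i + v in
  \sum_(w <- stratum_terms s) w.1.1%:R * (3%:R * v) ^+ w.1.2
     * alternant x (pad3 w.2).1.1 (pad3 w.2).1.2 (pad3 w.2).2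
  = x i1 * x i2 * x i3 * vdm x
    * class_value s (z i1 + z i2 + z i3) (z i1 * z i2 + z i1 * z i3 + z i2 * z i3)
        (z i1 * z i2 * z i3).
Proof.
rewrite /alternant /vdm /=; move: (x i1) (x i2) (x i3) => a b c.
by case: s; rewrite !big_cons big_nil /=; ring.
Qed.

(** The factor 8 prod_(i < j) (x_i + x_j) of all Q-polynomials of length 3, and the
    factor x_1 x_2 x_3 of alternants with positive exponents, make up the Euler class of quadratic
    forms. *)
Lemma stratum_legendre_value s :
  legendre_hom 3 (stratum_legendre s 3)
  = euler_Pol 2 3 * dual_root_subst (stratum_class s).
Proof.
have nz := vdm_legendre_neq0; apply: (mulfI nz).
rewrite stratum_legendreE big_map (rmorph_sum (legendre_hom 3)) mulr_sumr.
transitivity (\sum_(w <- stratum_terms s) 8%:R * pairsums (@legendre_root 3) *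
    (w.1.1%:R * (3%:R * sixth_u) ^+ w.1.2
     * alternant (@legendre_root 3) (pad3 w.2).1.1 (pad3 w.2).1.2 (pad3 w.2).2)).
  rewrite big_seq [RHS]big_seq; apply: eq_bigr => w ws /=.
  rewrite legendre_homZ rmorphM rmorph_nat rmorphXn t_valueX half_u_sixth legendre_Qfun.
  have : is_strict w.2 && (size w.2 == 3%N).
    by move: w ws; apply/allP; case: s.
  case/andP => strict_w /eqP size_w.
  have le3 : (size w.2 <= 3)%N by rewrite size_w.
  case: (strict_cases strict_w le3) size_w => [->|[a ->]|[a [b [-> _]]]|[a [b [c [-> _]]]]] //= _.
  by rewrite mulrCA (vdm_Qseq3 nz); ring.
rewrite -mulr_sumr stratum_identity -dual_root_class euler_Pol2E.
by ring.
Qed.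

(** * The theorem *)

Opaque legendre_hom.

Lemma root_factor_coef n (l : 'I_n) :
  u_class n - alpha 1 l != 0 /\ u_class n - alpha 1 l \is 1.-homog.
Proof.
split; last by rewrite rpredB // dhomogX; apply/eqP; exact: mdeg1.
apply/eqP => /(congr1 (mcoeff U_(lshift 1 l)%MM)).
rewrite mcoeffB !mcoeffXU eqxx mcoeff0 eq_rlshift sub0r => /eqP.
by rewrite oppr_eq0 oner_eq0.
Qed.

Lemma u_minus_alpha_neq0 n : \prod_(l < n) (u_class n - alpha 1 l) != 0.
Proof. by rewrite prodf_seq_neq0; apply/allP => l _; have [] := root_factor_coef l. Qed.

Lemma u_minus_alpha_homog n : \prod_(l < n) (u_class n - alpha 1 l) \is n.-homog.
Proof.
suff H (r : seq 'I_n) : \prod_(l <- r) (u_class n - alpha 1 l) \is (size r).-homog.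
  by have := H (index_enum 'I_n); rewrite /index_enum -enumT size_enum_ord.
elim: r => [|l r IH]; first by rewrite big_nil dhomog1.
by rewrite big_cons -[size _]/(1 + size r)%N dhomogM //; have [] := root_factor_coef l.
Qed.

(** No squares are added at i = 0, where the unfolding is [eta X] itself. *)
Lemma legendre_thom_base (C : numFieldType) (C_roots : forall c : C, exists z, z ^+ 3 = c)
    (X : Pol C 3 3 -> Prop) K : zclosed X -> GL_invariant X -> is_legendre_thom (eta X) K ->
  thom (eta X) = \prod_(l < 3) (u_class 3 - alpha 1 l) * legendre_hom 3 (K 3).
Proof.
move=> closedX inv [_ /(_ 0%N)] E; rewrite -{1}(quad_unfolding0 C_roots closedX inv).
by rewrite -Legendre_hom; exact: E.
Qed.

Theorem legendre_thom_long (C : numFieldType) (C_roots : forall c : C, exists z, z ^+ 3 = c)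
    (X : Pol C 3 3 -> Prop) K P : zclosed X -> GL_invariant X ->
  is_legendre_thom (eta X) K -> in_Gamma_t P ->
  \prod_(l < 3) (u_class 3 - alpha 1 l) * legendre_hom 3 (P 3) = thom (eta X) ->
  congr_mod_long P K.
Proof.
move=> closedX inv hK hP; rewrite (legendre_thom_base C_roots closedX inv hK).
move=> /(mulfI (u_minus_alpha_neq0 3)) /legendre_hom_inj E.
by apply: Q_span_congr E; apply: in_Gamma_span => //; case: hK.
Qed.

(** Its product by prod (u - alpha_l) is a Thom polynomial, hence homogeneous, and
    [homog_cancel] removes that factor. *)
Lemma legendre_thom_homog (C : numFieldType) k n0 (X : jet C k n0 1 -> Prop) K i :
  is_legendre_thom X K -> exists d, legendre_hom (n0 + i) (K (n0 + i)%N) \is d.-homog.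
Proof.
move=> [_ /(_ i) E]; have [D hD] := thom_homog (quad_unfolding i X).
rewrite E in hD; exact: homog_cancel (u_minus_alpha_neq0 _) (u_minus_alpha_homog _) hD.
Qed.

(** The long Q-polynomials that may be added have degree at least 10, the degree
    reached by concurrent lines only. *)
Theorem stratum_legendre_thom (C : numFieldType) (C_roots : forall c : C, exists z, z ^+ 3 = c)
    (s : stratum) K :
  form_class (@stratum_closure C s) = stratum_class s ->
  is_legendre_thom (eta (@stratum_closure C s)) K ->
  match s with
  | Concurrent =>
      exists z : int, forall n : nat,
        K n = stratum_legendre s n + z%:P *: Qfun {poly int} n [:: 4; 3; 2; 1]%N
  | _ => forall n : nat, K n = stratum_legendre s n
  end.
Proof.
move=> class_s hK; have closedX : zclosed (@stratum_closure C s) by exact: zclosed_zclosure.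
have inv : GL_invariant (@stratum_closure C s) := @stratum_closure_invariant C s.
have K3 : K 3 = stratum_legendre s 3.
  apply: (@legendre_hom_inj 3); apply: (mulfI (u_minus_alpha_neq0 3)).
  rewrite -(legendre_thom_base C_roots closedX inv hK) thom_eta class_s.
  by rewrite stratum_legendre_value euler_Pol1E mulrA.
have spanK : Q_span K by apply: in_Gamma_span; case: hK.
have spanP : Q_span (stratum_legendre s).
  exists (stratum_combo s); split; last exact: stratum_legendreE.
  by rewrite all_map; apply: sub_all (stratum_terms_strict s) => x /andP[].
have [sR [longR ER]] := Q_span_congr spanK spanP K3.
have KE n : K n = stratum_legendre s n + \sum_(c <- sR) c.1 *: Qfun _ n c.2.
  by rewrite -ER addrC subrK.
have K_homog n : (3 <= n)%N -> exists d, legendre_hom n (K n) \is d.-homog.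
  by move=> le3; have := legendre_thom_homog (n - 3) hK; rewrite subnKC.
have D := Legendre_determined (stratum_legendreE s) (stratum_legendre_homog s)
  (stratum_legendre3_neq0 s) longR KE K_homog.
have part0 c : (stratum_degree s < sumn c.2)%N -> degree_part (stratum_degree s) c = 0.
  by move=> lt; rewrite /degree_part leqNgt lt.
have sum_ge c : c \in sR -> (10 < sumn c.2)%N \/ c.2 = [:: 4; 3; 2; 1]%N.
  by move=> cR; have /andP[st sz] := allP longR c cR; exact: strict_long_sum.
have low : (stratum_degree s < 10)%N -> forall n, K n = stratum_legendre s n.
  move=> lt n; rewrite D big1_seq ?addr0 // => c /= cR; rewrite part0 ?scale0r //.
  by case: (sum_ge c cR) => [gt|->] //; exact: leq_trans lt (ltnW gt).
(* for concurrent lines only constant coefficients of Q_(4,3,2,1) have degree 10 *)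
have [E|//] : s = Concurrent \/ (stratum_degree s < 10)%N by case: (s); [right..|left].
  move: D part0; rewrite E => D part0.
  exists (\sum_(c <- sR | c.2 == [:: 4; 3; 2; 1]%N) (c.1)`_0) => n.
  rewrite D; congr (_ + _); rewrite (rmorph_sum (@polyC int)) scaler_suml [RHS]big_mkcond.
  rewrite big_seq [RHS]big_seq; apply: eq_bigr => c cR.
  case: eqP => [Ec|ne]; last by case: (sum_ge c cR) => // gt; rewrite part0 ?scale0r.
  by rewrite /degree_part Ec /= subnn expr0 alg_polyC.
move=> lt; have {}low := low lt.
by move: low lt; case: (s).
Qed.

Theorem theorem10p10 (R : realType) :
  (forall f : Pol R[i] 3 3 -> Prop, zclosed f -> GL_invariant f ->
     [/\ (* (1) *)
         thom (eta f)
           = euler_Pol 1 3 * euler_Pol 2 3 * dual_root_subst (form_class f),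
         (* (2) *)
         forall K : symfun_t, is_legendre_thom (eta f) K ->
           forall P : symfun_t, in_Gamma_t P ->
             \prod_(l < 3) (u_class 3 - alpha 1 l) * Legendre 3 P
               = thom (eta f) ->
             congr_mod_long P K &
         (* (3) *)
         forall Tp : infpoly int, is_stable_thom (eta f) Tp ->
           forall P : infpoly int,
             rho 3 1 P = thom (eta f) ->
             congr_mod_thick P Tp])
  /\
  (* strata of reduced cubics; the classes [f]_{GL_3} are known data *)
  (forall (s : stratum) (K : symfun_t),
     form_class (stratum_closure s : Pol R[i] 3 3 -> Prop) = stratum_class s ->
     is_legendre_thom (eta (stratum_closure s : Pol R[i] 3 3 -> Prop)) K ->
     match s with
     | Concurrent =>
         exists z : int, forall n : nat,
           K n = stratum_legendre s n
                 + z%:P *: Qfun {poly int} n [:: 4; 3; 2; 1]%N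
     | _ => forall n : nat, K n = stratum_legendre s n
     end).
Proof.
have C_roots (c : R[i]) : exists z, z ^+ 3 = c.
  by exists (nthroot 3 c); exact: rootCK.
split; last by move=> s K; exact: stratum_legendre_thom.
move=> f closed_f inv_f; split; first exact: thom_eta.
  by move=> K hK P hP; exact: legendre_thom_long.
move=> Tp /(_ 0%N) E P EP; apply: rho_thick; apply: etrans (EP) _; exact: E.
Qed.
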